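(* Let $\mathcal M$ be a model of $\mathsf{RCA}_0$. In $\mathcal M$, let $(a,A,\mu)$ be an $F_\sigma$-Mathias condition. If $\theta$ is an $(a,A,\mu)$-local $\Pi^0_2$ sentence of the forcing language, then $(a,A,\mu)\Vdash\theta$ if and only if $(a,A,\mu)\Vdash_S\theta$.
   Context: Conventions. $\mathcal M$ is a (possibly nonstandard) model of second-order arithmetic with first-order part $\mathbb N$. Everything is interpreted inside $\mathcal M$: sets, functions, sequences and reals belong to $\mathcal M$ and ''finite'' means finite in the sense of $\mathcal M$; ''class'' means a collection of second-order objects. $\mathcal P_{<\infty}(\mathbb N)$ is the set of (codes for) finite sets, $2^{<\infty}$ the set of finite binary strings, $\chi_X$ the characteristic function of $X$, $\langle\cdot,\cdot\rangle$ a pairing function. Submeasures. A submeasure is a function $\mu:\mathcal P_{<\infty}(\mathbb N)\to\mathbb R$ with $\mu(\varnothing)=0$ and $\max(\mu(x),\mu(y))\le\mu(x\cup y)\le\mu(x)+\mu(y)$ for all finite $x,y$. For $X\subseteq\mathbb N$: $\mu(X)<\infty$ means $\exists m\,\forall n\,\mu(X\cap\{0,\dots,n-1\})\le m$; otherwise $\mu(X)=\infty$. Submeasures are ordered pointwise on finite sets. Forcing. An $F_\sigma$-Mathias condition is a triple $(a,A,\mu)$ with $a$ finite, $a\subseteq A\subseteq\mathbb N$, and $\mu$ a submeasure with $\mu(A)=\infty$. Extension: $(b,B,\nu)\le(a,A,\mu)$ iff $a\subseteq b\subseteq A$, $B\subseteq A$ and $\nu\le\mu$. Put $[a,A,\mu]=\{B\subseteq\mathbb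 N: a\subseteq B\subseteq A,\ \mu(B)=\infty\}$ and $U(a,A)=\{\tau\in2^{<\infty}: a\cap\mathrm{dom}(\tau)\subseteq\tau^{-1}(1)\subseteq A\}$. Names. A partial $k$-ary name is a $\Sigma^0_1$ (parameters allowed) set $F\subseteq2^{<\infty}\times\mathbb N^{k+1}$ such that $(\tau,\bar x,y)\in F$, $\tau\subseteq\tau'$ imply $(\tau',\bar x,y)\in F$, and $(\tau,\bar x,y),(\tau,\bar x,y')\in F$ imply $y=y'$. Its domain is $\mathrm{dom}(F)=\{X\subseteq\mathbb N:\forall\bar x\,\exists\tau,y\,(\tau\subseteq\chi_X\wedge(\tau,\bar x,y)\in F)\}$. Every function $F$ of $\mathcal M$ has a canonical name $\check F=\{(\tau,\bar x,y): y=F(\bar x)\}$. Names can be composed: $F(F_1,\dots,F_\ell)$ is the set of $(\tau,\bar x,z)$ such that for some $\bar y$, $(\tau,\bar x,y_i)\in F_i$ for all $i$ and $(\tau,\bar y,z)\in F$. Substituting numbers $\bar x$ in a name $F$ gives the name $F(\bar x)$ in the remaining variables (a nullary name $\{(\tau,y):(\tau,\bar x,y)\in F\}$ if none remain). Formulas of the forcing language are built from atomic formulas $F(\bar v)=F'(\bar v')$ ($F,F'$ partial names, $\bar v,\bar v'$ number variables) by $\neg,\wedge$ and number quantification $\forall v$; $\vee,\to,\leftrightarrow,\exists$ are the usual classical abbreviations. Bounded quantification is $\forall w\le F(\bar v)$; bounded, $\Sigma^0_n$ and $\Pi^0_n$ formulas are defined as usual. Sentences have no free variables. Locality. $F$ is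 $(a,A,\mu)$-local if $[b,B,\nu]\cap\mathrm{dom}(F)\ne\varnothing$ for every $(b,B,\nu)\le(a,A,\mu)$; a formula is $(a,A,\mu)$-local if all names occurring in it are. Forcing relation, for $(a,A,\mu)$-local sentences: $(a,A,\mu)\Vdash F=F'$ iff for all $\tau\in U(a,A)$ and $y,y'$, $(\tau,y)\in F$ and $(\tau,y')\in F'$ imply $y=y'$; $\Vdash\phi\wedge\psi$ iff $\Vdash\phi$ and $\Vdash\psi$; $\Vdash\forall v\,\phi(v)$ iff $\Vdash\phi(x)$ for all $x\in\mathbb N$; $(a,A,\mu)\Vdash\neg\phi$ iff no $(b,B,\nu)\le(a,A,\mu)$ has $(b,B,\nu)\Vdash\phi$. Skolemization. For a formula $\theta(\bar v)$ and a placeholder $W$ for a unary name, $\theta_S(W;\bar v)$ and $\theta_H(W;\bar v)$ are defined by: for atomic $\theta$, $\theta_S=\theta_H=\theta$; if $\theta\equiv\neg\phi$, then $\theta_S(W;\bar v)\equiv\neg\phi_H(W;\bar v)$ and $\theta_H(W;\bar v)\equiv\neg\phi_S(W;\bar v)$; if $\theta\equiv\phi\wedge\psi$, then $\theta_S(W;\bar v)\equiv\phi_S(\lambda t\,W(2t);\bar v)\wedge\psi_S(\lambda t\,W(2t+1);\bar v)$ and $\theta_H(W;\bar v)\equiv\phi_H(W;\bar v)\wedge\psi_H(W;\bar v)$; if $\theta\equiv\forall w\,\phi(\bar v,w)$, then $\theta_S(W;\bar v)\equiv\forall w\,\phi_S(\lambda t\,W(\langle w,t\rangle);\bar v,w)$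 and $\theta_H(W;\bar v)\equiv\phi_H(\lambda t\,W(t+1);\bar v,W(0))$. For an $(a,A,\mu)$-local sentence $\theta$, $(a,A,\mu)\Vdash_S\theta$ means $(a,A,\mu)\Vdash\theta_S(W)$ for some $(a,A,\mu)$-local unary name $W$. *)

(* Defs.v *)
From mathcomp Require Import all_boot.
Set Implicit Arguments.
Unset Strict Implicit.
Unset Printing Implicit Defensive.

(* The second-order part is a type with a membership relation; equality of
   sets is never used, so no extensionality is required. *)
Record l2struct := L2Struct {
  num : Type;
  set2 : Type;
  l2zero : num;
  l2one : num;
  l2add : num -> num -> num;
  l2mul : num -> num -> num;
  l2lt : num -> num -> Prop;
  l2in : num -> set2 -> Prop }.

Declare Scope l2_scope.
Delimit Scope l2_scope with l2.
Notation "0" := (l2zero _) : l2_scope.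
Notation "1" := (l2one _) : l2_scope.
Notation "x + y" := (l2add x y) : l2_scope.
Notation "x * y" := (l2mul x y) : l2_scope.
Notation "x < y" := (l2lt x y) : l2_scope.
Notation "x <= y" := (l2lt x y \/ x = y) : l2_scope.
Notation "x ∈ X" := (l2in x X) (at level 70) : l2_scope.
Bind Scope l2_scope with num.
Local Open Scope l2_scope.

Inductive term :=
| TVar of nat
| TZero
| TOne
| TAdd of term & term
| TMul of term & term.

(* Bounded-quantifier formulas of second-order arithmetic.  Number variables
   are de Bruijn indices, set variables are free and named by a natural
   number; [BAll t phi] is "for all x < t, phi", where t does not see x. *)
Inductive bqf :=
| BEq of term & term
| BLt of term & term
| BIn of term & nat
| BNeg of bqf
| BAnd of bqf & bqf
| BAll of term & bqf.

Definition econs (T : Type) (x : T) (e : nat -> T) (i : nat) : T :=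
  if i is j.+1 then e j else x.

Definition ecat (T : Type) (s : seq T) (e : nat -> T) : nat -> T :=
  foldr (@econs T) e s.

Fixpoint teval (M : l2struct) (e : nat -> num M) (t : term) : num M :=
  match t with
  | TVar i => e i
  | TZero => 0
  | TOne => 1
  | TAdd t u => teval e t + teval e u
  | TMul t u => teval e t * teval e u
  end.

Fixpoint bsat (M : l2struct) (e : nat -> num M) (E : nat -> set2 M) (phi : bqf)
    : Prop :=
  match phi with
  | BEq t u => teval e t = teval e u
  | BLt t u => teval e t < teval e u
  | BIn t X => teval e t ∈ E X
  | BNeg phi => ~ bsat e E phi
  | BAnd phi psi => bsat e E phi /\ bsat e E psi
  | BAll t phi => forall x : num M, x < teval e t -> bsat (econs x e) E phi
  end.

Definition sat_Sigma1 (M : l2struct) (e : nat -> num M) (E : nat -> set2 M)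
    (phi : bqf) : Prop :=
  exists m : num M, bsat (econs m e) E phi.

Definition sat_Pi1 (M : l2struct) (e : nat -> num M) (E : nat -> set2 M)
    (phi : bqf) : Prop :=
  forall m : num M, bsat (econs m e) E phi.

Record basic_axioms (M : l2struct) : Prop := BasicAxioms {
  ax_succ_neq0 : forall n : num M, n + 1 <> 0;
  ax_succ_inj : forall m n : num M, m + 1 = n + 1 -> m = n;
  ax_add0 : forall m : num M, m + 0 = m;
  ax_addS : forall m n : num M, m + (n + 1) = (m + n) + 1;
  ax_mul0 : forall m : num M, m * 0 = 0;
  ax_mulS : forall m n : num M, m * (n + 1) = m * n + m;
  ax_lt0 : forall m : num M, ~ (m < 0);
  ax_ltS : forall m n : num M, m < n + 1 <-> (m < n \/ m = n) }.

Definition Sigma1_induction (M : l2struct) : Prop :=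
  forall (phi : bqf) (e : nat -> num M) (E : nat -> set2 M),
    sat_Sigma1 (econs 0 e) E phi ->
    (forall n, sat_Sigma1 (econs n e) E phi ->
               sat_Sigma1 (econs (n + 1) e) E phi) ->
    forall n, sat_Sigma1 (econs n e) E phi.

Definition Delta1_comprehension (M : l2struct) : Prop :=
  forall (phi psi : bqf) (e : nat -> num M) (E : nat -> set2 M),
    (forall n, sat_Sigma1 (econs n e) E phi <-> sat_Pi1 (econs n e) E psi) ->
    exists X : set2 M, forall n, n ∈ X <-> sat_Sigma1 (econs n e) E phi.

(* Valuations [E] are total, so they presuppose a set; that one exists, otherwise
   an instance of comprehension, has to be stated. *)
Record RCA0 (M : l2struct) : Prop := MkRCA0 {
  rca0_set : inhabited (set2 M);
  rca0_basic : basic_axioms M;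
  rca0_ind : Sigma1_induction M;
  rca0_comp : Delta1_comprehension M }.

Definition pair2 (M : l2struct) (i j : num M) : num M := (i + j) * (i + j) + i.

Notation "⟨ i , j ⟩" := (pair2 i j) (at level 0, i, j at level 99) : l2_scope.

Definition dvd2 (M : l2struct) (d n : num M) : Prop := exists k, n = d * k.

(* ⟨l,⟨m,n⟩⟩ represents the set of all i < l such that m(i+1)+1 divides n; the
   code of a finite set is its least representative. *)
Definition felem (M : l2struct) (i c : num M) : Prop :=
  exists l m n, [/\ c = ⟨l, ⟨m, n⟩⟩, i < l & dvd2 (m * (i + 1) + 1) n].

Definition fincode (M : l2struct) (c : num M) : Prop :=
  (exists l m n, c = ⟨l, ⟨m, n⟩⟩) /\
  forall c' : num M, c' < c -> (exists l m n, c' = ⟨l, ⟨m, n⟩⟩) ->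
    ~ (forall i, felem i c <-> felem i c').

(* A finite sequence of length l is the finite set of all ⟨i, s(i)⟩, i < l. *)
Definition finseq (M : l2struct) (s l : num M) : Prop :=
  [/\ fincode s,
      (forall z, felem z s -> exists i j, z = ⟨i, j⟩ /\ i < l) &
      (forall i, i < l -> exists! j, felem ⟨i, j⟩ s)].

Definition binstr (M : l2struct) (t : num M) : Prop :=
  (exists l, finseq t l) /\ forall i j, felem ⟨i, j⟩ t -> j = 0 \/ j = 1.

Definition fsub (M : l2struct) (c c' : num M) : Prop :=
  forall i, felem i c -> felem i c'.

Definition fsub_set (M : l2struct) (c : num M) (X : set2 M) : Prop :=
  forall i, felem i c -> i ∈ X.

Definition set_sub (M : l2struct) (X Y : set2 M) : Prop :=
  forall i, i ∈ X -> i ∈ Y.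

Definition charfun (M : l2struct) (X : set2 M) (i j : num M) : Prop :=
  (i ∈ X /\ j = 1) \/ (~ (i ∈ X) /\ j = 0).

Definition str_prefix (M : l2struct) (t : num M) (X : set2 M) : Prop :=
  forall i j, felem ⟨i, j⟩ t -> charfun X i j.

Definition pow2 (M : l2struct) (k y : num M) : Prop :=
  exists s, [/\ finseq s (k + 1),
                felem ⟨0, 1⟩ s,
                (forall i z, i < k -> felem ⟨i, z⟩ s -> felem ⟨i + 1, z + z⟩ s) &
                felem ⟨k, y⟩ s].

(* [QRep p n d], d <> 0, represents (p - n) / d. *)
Record qrep (M : l2struct) := QRep { qpos : num M; qneg : num M; qden : num M }.

Definition qcode (M : l2struct) (q : qrep M) : num M :=
  ⟨⟨qpos q, qneg q⟩, qden q⟩.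

Definition qadd (M : l2struct) (q r : qrep M) : qrep M :=
  QRep (qpos q * qden r + qpos r * qden q)
       (qneg q * qden r + qneg r * qden q)
       (qden q * qden r).

Definition qle (M : l2struct) (q r : qrep M) : Prop :=
  qpos q * qden r + qneg r * qden q <= qpos r * qden q + qneg q * qden r.

(* Reals are rapidly converging sequences of rationals, given by their graph. *)
Definition rseq (M : l2struct) := num M -> qrep M -> Prop.

Definition is_real (M : l2struct) (x : rseq M) : Prop :=
  [/\ (forall k, exists! q, x k q),
      (forall k q, x k q -> qden q <> 0) &
      (* |q_k - q_(k+i)| <= 2^-k *)
      (forall k i q r y, x k q -> x (k + i) r -> pow2 k y ->
         qle q (qadd r (QRep 1 0 y)) /\ qle r (qadd q (QRep 1 0 y)))].

(* q_k <= r_k + 2^(-k+1) for all k *)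
Definition rle (M : l2struct) (x x' : rseq M) : Prop :=
  forall k q r y, x k q -> x' k r -> pow2 k y ->
    qle q (qadd r (QRep (1 + 1) 0 y)).

Definition req (M : l2struct) (x x' : rseq M) : Prop := rle x x' /\ rle x' x.

(* The k-th term of x + x' is q_(k+1) + r_(k+1). *)
Definition radd (M : l2struct) (x x' : rseq M) : rseq M := fun k s =>
  exists q r, [/\ x (k + 1) q, x' (k + 1) r & s = qadd q r].

Definition rnat (M : l2struct) (m : num M) : rseq M := fun _ q => q = QRep m 0 1.

(* A function from finite sets to reals is a set of numbers ⟨⟨c,k⟩,q⟩, meaning
   that the k-th term of the value at the finite set c is q. *)
Definition mval (M : l2struct) (mu : set2 M) (c : num M) : rseq M := fun k q =>
  ⟨⟨c, k⟩, qcode q⟩ ∈ mu.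

Record is_submeasure (M : l2struct) (mu : set2 M) : Prop := IsSubmeasure {
  sm_dom : forall z, z ∈ mu -> exists c k q,
    [/\ fincode c, qden q <> 0 & z = ⟨⟨c, k⟩, qcode q⟩];
  sm_real : forall c, fincode c -> is_real (mval mu c);
  sm_empty : forall c, fincode c -> (forall i, ~ felem i c) ->
    req (mval mu c) (rnat 0);
  sm_union : forall x y z, fincode x -> fincode y -> fincode z ->
    (forall i, felem i z <-> (felem i x \/ felem i y)) ->
    [/\ rle (mval mu x) (mval mu z), rle (mval mu y) (mval mu z) &
        rle (mval mu z) (radd (mval mu x) (mval mu y))] }.

Definition mu_finite (M : l2struct) (mu : set2 M) (X : set2 M) : Prop :=
  exists m, forall n c, fincode c ->
    (forall i, felem i c <-> (i ∈ X /\ i < n)) -> rle (mval mu c) (rnat m).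

Definition mu_infinite (M : l2struct) (mu : set2 M) (X : set2 M) : Prop :=
  ~ mu_finite mu X.

Definition mu_le (M : l2struct) (nu mu : set2 M) : Prop :=
  forall c, fincode c -> rle (mval nu c) (mval mu c).

Record condition (M : l2struct) := Condition {
  stem : num M;
  reservoir : set2 M;
  smeas : set2 M;
  stem_fin : fincode stem;
  stem_sub : fsub_set stem reservoir;
  smeas_sub : is_submeasure smeas;
  reservoir_inf : mu_infinite smeas reservoir }.

Definition extends (M : l2struct) (q p : condition M) : Prop :=
  [/\ fsub (stem p) (stem q), fsub_set (stem q) (reservoir p),
      set_sub (reservoir q) (reservoir p) & mu_le (smeas q) (smeas p)].

(* X belongs to [a,A,mu]. *)
Definition in_cond (M : l2struct) (X : set2 M) (p : condition M) : Prop :=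
  [/\ fsub_set (stem p) X, set_sub X (reservoir p) & mu_infinite (smeas p) X].

(* t belongs to U(a,A). *)
Definition in_U (M : l2struct) (t : num M) (p : condition M) : Prop :=
  [/\ binstr t,
      (forall i, felem i (stem p) -> (exists j, felem ⟨i, j⟩ t) ->
         felem ⟨i, 1⟩ t) &
      (forall i, felem ⟨i, 1⟩ t -> i ∈ reservoir p)].

(* The partial k-ary names are the elements that satisfy [is_name]. *)
Definition rname (M : l2struct) (k : nat) :=
  num M -> k.-tuple (num M) -> num M -> Prop.

Definition Sigma1_class (M : l2struct) (k : nat) (F : rname M k) : Prop :=
  exists (phi : bqf) (e : nat -> num M) (E : nat -> set2 M),
    forall t x y, F t x y <-> sat_Sigma1 (ecat (t :: y :: x) e) E phi.

Record is_name (M : l2struct) (k : nat) (F : rname M k) : Prop := IsName {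
  name_str : forall t x y, F t x y -> binstr t;
  name_Sigma1 : Sigma1_class F;
  name_mono : forall t t' x y, F t x y -> binstr t' -> fsub t t' -> F t' x y;
  name_fun : forall t x y y', F t x y -> F t x y' -> y = y' }.

Definition in_dom (M : l2struct) (k : nat) (F : rname M k) (X : set2 M) : Prop :=
  forall x, exists t y, str_prefix t X /\ F t x y.

Definition local_name (M : l2struct) (k : nat) (p : condition M) (F : rname M k)
    : Prop :=
  forall q, extends q p -> exists X, in_cond X q /\ in_dom F X.

(* The canonical name of a function, given by its graph. *)
Definition canon (M : l2struct) (k : nat)
    (f : k.-tuple (num M) -> num M -> Prop) : rname M k :=
  fun t x y => binstr t /\ f x y.

Definition ncomp (M : l2struct) (l k : nat) (F : rname M l)
    (G : 'I_l -> rname M k) : rname M k :=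
  fun t x z => exists y : l.-tuple (num M),
    (forall i, G i t x (tnth y i)) /\ F t y z.

Definition nproj (M : l2struct) (k : nat) (i : 'I_k) : rname M k :=
  canon (fun x y => y = tnth x i).

(* [form M n] is the type of formulas with n free number variables; 'I_n are the
   de Bruijn indices, index 0 being the innermost bound variable. *)
Inductive form (M : l2struct) : nat -> Type :=
| FAtom n k (F : rname M k) (v : k.-tuple 'I_n)
          k' (F' : rname M k') (v' : k'.-tuple 'I_n) : form M n
| FNeg n (phi : form M n) : form M n
| FAnd n (phi psi : form M n) : form M n
| FAll n (phi : form M n.+1) : form M n.

Fixpoint all_names (M : l2struct) (P : forall k, rname M k -> Prop) n
    (phi : form M n) : Prop :=
  match phi with
  | FAtom _ _ F _ _ F' _ => P _ F /\ P _ F'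
  | FNeg _ phi => all_names P phi
  | FAnd _ phi psi => all_names P phi /\ all_names P psi
  | FAll _ phi => all_names P phi
  end.

Definition wf_form (M : l2struct) n (phi : form M n) : Prop :=
  all_names (@is_name M) phi.

Definition local_form (M : l2struct) (p : condition M) n (phi : form M n) : Prop :=
  all_names (fun k => @local_name M k p) phi.

Definition FEx (M : l2struct) n (phi : form M n.+1) : form M n :=
  FNeg (FAll (FNeg phi)).

Definition FImp (M : l2struct) n (phi psi : form M n) : form M n :=
  FNeg (FAnd phi (FNeg psi)).

Definition shift_vars n k (v : k.-tuple 'I_n) : k.-tuple 'I_n.+1 :=
  [tuple of map (lift ord0) v].

Definition le_name (M : l2struct) : rname M 2 :=
  canon (fun x y => (tnth x ord0 <= tnth x ord_max /\ y = 1) \/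
                    (~ (tnth x ord0 <= tnth x ord_max) /\ y = 0)).

(* The atomic formula w <= F(v), with w the variable of index 0:
   it is le(w, F(v)) = 1. *)
Definition FLe (M : l2struct) n k (F : rname M k) (v : k.-tuple 'I_n)
    : form M n.+1 :=
  FAtom (ncomp (@le_name M)
           (fun i : 'I_2 =>
              if i == ord0 then @nproj M k.+1 ord0
              else ncomp F (fun j : 'I_k => @nproj M k.+1 (lift ord0 j))))
        [tuple of ord0 :: shift_vars v]
        (canon (fun (_ : 0.-tuple (num M)) y => y = 1)) [tuple].

Definition FBAll (M : l2struct) n k (F : rname M k) (v : k.-tuple 'I_n)
    (phi : form M n.+1) : form M n :=
  FAll (FImp (FLe F v) phi).

Inductive bounded (M : l2struct) : forall n, form M n -> Prop :=
| bounded_atom n k (F : rname M k) (v : k.-tuple 'I_n)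
               k' (F' : rname M k') (v' : k'.-tuple 'I_n) :
    bounded (FAtom F v F' v')
| bounded_neg n (phi : form M n) : bounded phi -> bounded (FNeg phi)
| bounded_and n (phi psi : form M n) :
    bounded phi -> bounded psi -> bounded (FAnd phi psi)
| bounded_ball n k (F : rname M k) (v : k.-tuple 'I_n) (phi : form M n.+1) :
    is_name F -> bounded phi -> bounded (FBAll F v phi).

(* Blocks of like quantifiers are allowed and may be empty. *)
Inductive is_Sigma (M : l2struct) : nat -> forall n, form M n -> Prop :=
| Sigma_bounded n (phi : form M n) : bounded phi -> is_Sigma 0 phi
| Sigma_Pi m n (phi : form M n) : is_Pi m phi -> is_Sigma m.+1 phi
| Sigma_ex m n (phi : form M n.+1) :
    is_Sigma m.+1 phi -> is_Sigma m.+1 (FEx phi)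
with is_Pi (M : l2struct) : nat -> forall n, form M n -> Prop :=
| Pi_bounded n (phi : form M n) : bounded phi -> is_Pi 0 phi
| Pi_Sigma m n (phi : form M n) : is_Sigma m phi -> is_Pi m.+1 phi
| Pi_all m n (phi : form M n.+1) :
    is_Pi m.+1 phi -> is_Pi m.+1 (FAll phi).

(* [forces phi p x] is p ||- phi(x): the free variables of phi are replaced by
   the numbers x. *)
Fixpoint forces (M : l2struct) n (phi : form M n)
    : condition M -> n.-tuple (num M) -> Prop :=
  match phi in form _ n return condition M -> n.-tuple (num M) -> Prop with
  | FAtom _ _ F v _ F' v' => fun p x =>
      forall t, in_U t p -> forall y y',
        F t [tuple of map (tnth x) v] y ->
        F' t [tuple of map (tnth x) v'] y' -> y = y'
  | FNeg _ phi => fun p x => ~ exists q, extends q p /\ forces phi q x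
  | FAnd _ phi psi => fun p x => forces phi p x /\ forces psi p x
  | FAll _ phi => fun p x => forall w, forces phi p [tuple of w :: x]
  end.

Definition idvars n : n.-tuple 'I_n := ord_tuple n.

(* Adds an unused argument, in front. *)
Definition nweak (M : l2struct) n (G : rname M n) : rname M n.+1 :=
  ncomp G (fun i => @nproj M n.+1 (lift ord0 i)).

Definition scons (M : l2struct) m n (G : rname M n) (s : 'I_m -> rname M n)
    (i : 'I_m.+1) : rname M n :=
  if unlift ord0 i is Some j then s j else G.

(* The atom F(v) becomes F(s(v)), a composed name applied to all variables. *)
Fixpoint fsubst (M : l2struct) m (phi : form M m)
    : forall n, ('I_m -> rname M n) -> form M n :=
  match phi in form _ m return forall n, ('I_m -> rname M n) -> form M n with
  | FAtom _ _ F v _ F' v' => fun n s =>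
      FAtom (ncomp F (fun i => s (tnth v i))) (idvars n)
            (ncomp F' (fun i => s (tnth v' i))) (idvars n)
  | FNeg _ phi => fun n s => FNeg (fsubst phi s)
  | FAnd _ phi psi => fun n s => FAnd (fsubst phi s) (fsubst psi s)
  | FAll _ phi => fun n s =>
      FAll (fsubst phi (scons (@nproj M n.+1 ord0) (fun i => nweak (s i))))
  end.

(* The placeholder W occurs with the current n free variables as parameters, so
   it is represented by a name of arity n.+1 whose argument 0 is the displayed
   argument of W and whose other arguments are these parameters.
   [warg W f g] is the k-ary name W(f(z); z_(g 0), .., z_(g (n-1))) for a
   function f of the model, given by its graph. *)
Definition warg (M : l2struct) n k (W : rname M n.+1)
    (f : k.-tuple (num M) -> num M -> Prop) (g : 'I_n -> 'I_k) : rname M k :=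
  ncomp W (scons (canon f) (fun i => nproj (M := M) (g i))).

(* t |-> W(2t) *)
Definition weven (M : l2struct) n (W : rname M n.+1) : rname M n.+1 :=
  warg W (fun z y => y = (1 + 1) * tnth z ord0) (lift ord0).

(* t |-> W(2t+1) *)
Definition wodd (M : l2struct) n (W : rname M n.+1) : rname M n.+1 :=
  warg W (fun z y => y = (1 + 1) * tnth z ord0 + 1) (lift ord0).

(* t |-> W(⟨w,t⟩), with arguments t, w and the n parameters *)
Definition wsect (M : l2struct) n (W : rname M n.+1) : rname M n.+2 :=
  warg W (fun z y => y = ⟨tnth z (lift ord0 ord0), tnth z ord0⟩)
    (fun i => lift ord0 (lift ord0 i)).

(* t |-> W(t+1), with arguments t, w (unused) and the n parameters *)
Definition wtail (M : l2struct) n (W : rname M n.+1) : rname M n.+2 :=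
  warg W (fun z y => y = tnth z ord0 + 1) (fun i => lift ord0 (lift ord0 i)).

(* W(0) *)
Definition whead (M : l2struct) n (W : rname M n.+1) : rname M n :=
  warg W (fun _ y => y = 0) id.

(* theta_S for [s = true], theta_H for [s = false]. *)
Fixpoint skolem (M : l2struct) (s : bool) n (theta : form M n)
    : rname M n.+1 -> form M n :=
  match theta in form _ n return rname M n.+1 -> form M n with
  | FAtom _ _ F v _ F' v' => fun _ => FAtom F v F' v'
  | FNeg _ phi => fun W => FNeg (skolem (~~ s) phi W)
  | FAnd _ phi psi => fun W =>
      if s then FAnd (skolem s phi (weven W)) (skolem s psi (wodd W))
      else FAnd (skolem s phi W) (skolem s psi W)
  | FAll n phi => fun W =>
      if s then FAll (skolem s phi (wsect W))
      else fsubst (skolem s phi (wtail W))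
             (scons (whead W) (fun i : 'I_n => nproj (M := M) i))
  end.

Definition forces_S (M : l2struct) (theta : form M 0) (p : condition M) : Prop :=
  exists W : rname M 1,
    [/\ is_name W, local_name p W & forces (skolem true theta W) p (nil_tuple _)].

(* Main.v *)
(* A name F is local to p if and only if it is densely total: below any q <= p, every
   string in U(q) extends to a string in U(q) that decides F(x).  (From right to left one
   builds, by primitive recursion, a set of infinite submeasure whose initial segments
   decide more and more values.)  Hence local names are closed under composition and
   under the search for the least y with T(y, x) = 1 when the search densely succeeds.
   Also a condition that decides the values of the substituted names forces a substituted
   formula if and only if it forces its instance at these values.

   Every formula is implied by theta_S and implies theta_H, for any local W.  Conversely,
   a bounded formula has a local name for its truth value, and by induction on the formula
   local Skolem functions for it and for its negation: a failing bounded quantifier is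
   witnessed by the least counterexample.  If p forces a Pi2 sentence, the search for
   witnesses of its existential quantifiers densely succeeds, so the least witness is a
   local name, and with the Skolem function of the matrix it forms W. *)
From Stdlib Require Import Classical Ring Setoid.
From mathcomp Require Import all_boot.
Require Import Defs.
Set Implicit Arguments.
Unset Strict Implicit.
Unset Printing Implicit Defensive.
Local Open Scope l2_scope.
#[local] Hint Resolve iff_refl : core.

(** Locality of two names yields a set in the domain of each, and nothing makes the two sets equal;
    this is the obstacle to composing names. Density replaces sets by strings: values of names
    persist to longer strings, so one string can be lengthened until it decides all the names at
    hand. Formulas and arities are standard, so inductions on them are external. Inductions over
    numbers of the model must concern Sigma1 statements. A failed test is therefore always expressed
    positively, as a decided value other than 1, and truth values are names with values everywhere,
    not merely on true instances. This keeps a search for a least witness Sigma1 and persistent.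
    Such a search is local only if it densely ends. Under a bounded quantifier it ends at the latest
    beyond the bound, which gives a truth value. For an unbounded one it is only known to end where
    the formula is forced, so there no truth value is claimed and the witnesses are handled apart.
    Negation exchanges theta_S and theta_H, hence Skolem functions for a formula and for its
    negation are carried along together. *)

(** * Renaming and interleaving of variables *)

Fixpoint tren (r : nat -> nat) (t : term) : term :=
  match t with
  | TVar i => TVar (r i)
  | TZero => TZero
  | TOne => TOne
  | TAdd t u => TAdd (tren r t) (tren r u)
  | TMul t u => TMul (tren r t) (tren r u)
  end.

Definition upr (r : nat -> nat) (i : nat) : nat := if i is j.+1 then (r j).+1 else 0%N.

Fixpoint bren (r s : nat -> nat) (phi : bqf) : bqf :=
  match phi with
  | BEq t u => BEq (tren r t) (tren r u)
  | BLt t u => BLt (tren r t) (tren r u)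
  | BIn t X => BIn (tren r t) (s X)
  | BNeg phi => BNeg (bren r s phi)
  | BAnd phi psi => BAnd (bren r s phi) (bren r s psi)
  | BAll t phi => BAll (tren r t) (bren (upr r) s phi)
  end.

Lemma teval_ren (M : l2struct) (e e' : nat -> num M) r t :
  (forall i, e (r i) = e' i) -> teval e (tren r t) = teval e' t.
Proof. by move=> h; elim: t => //= [t -> u ->|t -> u ->]. Qed.

Lemma bsat_ren (M : l2struct) (E E' : nat -> set2 M) s phi :
  (forall X, E (s X) = E' X) ->
  forall r (e e' : nat -> num M), (forall i, e (r i) = e' i) ->
  bsat e E (bren r s phi) <-> bsat e' E' phi.
Proof.
move=> hs; elim: phi => [t u|t u|t X|phi IH|phi IH psi IH'|t phi IH] r e e' h /=.
- by rewrite !(teval_ren _ h).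
- by rewrite !(teval_ren _ h).
- by rewrite (teval_ren _ h) hs.
- by rewrite IH.
- by rewrite IH ?IH'.
- rewrite (teval_ren _ h); split=> H x hx; have {H hx} := H x hx;
    by rewrite (IH _ _ (econs x e')) //; case.
Qed.

(** Interleaving keeps arguments and parameters apart without any bound on the free variables of a
    formula. A nested interleaving stores the parameters of two formulas at once, and [renl] and
    [renr] rename each formula accordingly. *)
Definition mix (T : Type) (e c : nat -> T) (i : nat) : T :=
  if odd i then c i./2 else e i./2.

Definition renl (i : nat) : nat := if odd i then i./2.*2.*2.+1 else i.
Definition renr (i : nat) : nat := if odd i then i./2.*2.+1.*2.+1 else i.

Lemma mixl (T : Type) (e c c' : nat -> T) i : mix e (mix c c') (renl i) = mix e c i.
Proof.
rewrite /renl /mix; case oi: (odd i); last by rewrite oi.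
by rewrite /= !odd_double /= !uphalf_double odd_double half_double.
Qed.

Lemma mixr (T : Type) (e c c' : nat -> T) i : mix e (mix c c') (renr i) = mix e c' i.
Proof.
rewrite /renr /mix; case oi: (odd i); last by rewrite oi.
by rewrite /= !odd_double /= !uphalf_double odd_double.
Qed.

Lemma mix_double (T : Type) (e c : nat -> T) i : mix e c i.*2 = e i.
Proof. by rewrite /mix odd_double half_double. Qed.

Lemma mix_doubleS (T : Type) (e c : nat -> T) i : mix e c i.*2.+1 = c i.
Proof. by rewrite /mix /= odd_double /= uphalf_double. Qed.

(** * Definability by bounded formulas *)

Section Definability.
Variable M : l2struct.
Notation N := (num M).
Notation env := (nat -> N).

Definition tm (f : env -> N) : Prop := exists t c, forall e, teval (mix e c) t = f e.

(* Relations on valuations that are defined by a bounded formula with number and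
   set parameters; the parameters [c] occupy the odd variables. *)
Definition d0 (P : env -> Prop) : Prop :=
  exists phi c E, forall e, bsat (mix e c) E phi <-> P e.

Definition sig (P : env -> Prop) : Prop :=
  exists Q : env -> Prop, d0 Q /\ forall e, P e <-> exists m, Q (econs m e).

Lemma tm_var i : tm (fun e => e i).
Proof. by exists (TVar i.*2), (fun=> 0) => e; rewrite /= mix_double. Qed.

Lemma tm_const x : tm (fun=> x).
Proof. by exists (TVar 1), (fun=> x). Qed.

Lemma tm2 f g : tm f -> tm g ->
  exists t u c, (forall e, teval (mix e c) t = f e) /\ (forall e, teval (mix e c) u = g e).
Proof.
move=> [t [c h]] [t' [c' h']]; exists (tren renl t), (tren renr t'), (mix c c').
split=> e; first by rewrite -h; apply: teval_ren => i; rewrite mixl.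
by rewrite -h'; apply: teval_ren => i; rewrite mixr.
Qed.

Lemma tm_add f g : tm f -> tm g -> tm (fun e => f e + g e).
Proof.
move=> hf hg; have [t [u [c [h h']]]] := tm2 hf hg.
by exists (TAdd t u), c => e; rewrite /= h h'.
Qed.

Lemma tm_mul f g : tm f -> tm g -> tm (fun e => f e * g e).
Proof.
move=> hf hg; have [t [u [c [h h']]]] := tm2 hf hg.
by exists (TMul t u), c => e; rewrite /= h h'.
Qed.

Lemma tm_pair f g : tm f -> tm g -> tm (fun e => ⟨f e, g e⟩).
Proof. by move=> hf hg; rewrite /pair2; do ![apply: tm_add | apply: tm_mul]. Qed.

Lemma d0_ext P Q : d0 P -> (forall e, P e <-> Q e) -> d0 Q.
Proof. by move=> [phi [c [E h]]] PQ; exists phi, c, E => e; rewrite h. Qed.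

Lemma d0_eq f g : inhabited (set2 M) -> tm f -> tm g -> d0 (fun e => f e = g e).
Proof.
move=> [X] hf hg; have [t [u [c [h h']]]] := tm2 hf hg.
by exists (BEq t u), c, (fun=> X) => e; rewrite /= h h'.
Qed.

Lemma d0_lt f g : inhabited (set2 M) -> tm f -> tm g -> d0 (fun e => f e < g e).
Proof.
move=> [X] hf hg; have [t [u [c [h h']]]] := tm2 hf hg.
by exists (BLt t u), c, (fun=> X) => e; rewrite /= h h'.
Qed.

Lemma d0_in f (X : set2 M) : tm f -> d0 (fun e => f e ∈ X).
Proof. by move=> [t [c h]]; exists (BIn t 0), c, (fun=> X) => e; rewrite /= h. Qed.

Lemma d0_not P : d0 P -> d0 (fun e => ~ P e).
Proof. by move=> [phi [c [E h]]]; exists (BNeg phi), c, E => e; rewrite /= h. Qed.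

Lemma d0_and P Q : d0 P -> d0 Q -> d0 (fun e => P e /\ Q e).
Proof.
move=> [phi [c [E h]]] [phi' [c' [E' h']]].
exists (BAnd (bren renl double phi) (bren renr (fun i => i.*2.+1) phi')), (mix c c'), (mix E E').
move=> e /=; rewrite -h -h'.
rewrite (bsat_ren phi (mix_double E E') (e' := mix e c)); last exact: mixl.
by rewrite (bsat_ren phi' (mix_doubleS E E') (e' := mix e c')) //; exact: mixr.
Qed.

Lemma d0_ball f (Q : env -> N -> Prop) : tm f ->
  d0 (fun e => Q (fun i => e i.+1) (e 0%N)) -> d0 (fun e => forall x, x < f e -> Q e x).
Proof.
move=> [t [c h]] [phi' [c' [E' h']]].
(* Binding x shifts every variable by one, whereas interleaving the extended valuation shifts only
   the arguments, by two; [r] translates between the two layouts. *)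
pose r i := if odd i then i.+1 else i.-1.
have rE x e i : econs x (mix e c') (r i) = mix (econs x e) c' i.
  rewrite /r /mix; case oi: (odd i) => /=; first by rewrite oi /=.
  rewrite -[i in LHS]odd_double_half oi add0n; case: i./2 => //= k.
  by rewrite -/(mix e c' k.*2) mix_double.
exists (BAll (tren renl t) (bren (upr renr) id (bren r id phi'))), (mix c c'), E'.
move=> e /=.
rewrite (@teval_ren _ _ (mix e c)) ?h; last by move=> i; rewrite mixl.
suff H x : bsat (econs x (mix e (mix c c'))) E' (bren (upr renr) id (bren r id phi')) <-> Q e x.
  by split=> K x hx; apply/H/K.
rewrite (@bsat_ren _ E' E' id _ _ _ _ (econs x (mix e c'))) //; last first.
  by case=> //= i; rewrite mixr.
rewrite (@bsat_ren _ E' E' id _ _ _ _ (mix (econs x e) c')) //.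
Qed.

Lemma d0_bsat phi E (g : nat -> nat + N) :
  d0 (fun e => bsat (fun i => match g i with inl j => e j | inr c => c end) E phi).
Proof.
exists (bren (fun i => if g i is inl j then j.*2 else i.*2.+1) id phi),
  (fun i => if g i is inr c then c else 0), E => e.
apply: bsat_ren => // i.
by case E1: (g i) => [j|c]; rewrite ?mix_double // mix_doubleS E1.
Qed.

Lemma bsat_ext phi E (e e' : env) : (forall i, e i = e' i) -> bsat e E phi <-> bsat e' E phi.
Proof.
move=> h; elim: phi e e' h => [t u|t u|t X|phi IH|phi IH psi IH'|t phi IH] e e' h /=.
all: have th t' : teval e t' = teval e' t' by elim: t' => //= [t1 -> t2 ->|t1 -> t2 ->].
- by rewrite !th.
- by rewrite !th.
- by rewrite th.
- by rewrite (IH _ _ h).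
- by rewrite (IH _ _ h) (IH' _ _ h).
- rewrite th; split=> H x hx; have {H hx} := H x hx;
    by rewrite (IH (econs x e) (econs x e')) //; case.
Qed.

Definition esub (g : nat -> nat + N) (e : env) (i : nat) : N :=
  match g i with inl j => e j | inr c => c end.

(** Lets a definable relation trade some of its variables for constants of the model, which become
    parameters. *)
Lemma d0_sub P g : d0 P -> d0 (fun e => P (esub g e)).
Proof.
move=> [phi [c [E h]]].
apply: d0_ext (d0_bsat phi E (fun i => if odd i then inr (c i./2) else g i./2)) _ => e.
by rewrite -h; apply: bsat_ext => i; rewrite /mix /esub; case: ifP.
Qed.

Lemma d0_ren P (r : nat -> nat) : d0 P -> d0 (fun e => P (fun i => e (r i))).
Proof. exact: (d0_sub (fun i => inl (r i))). Qed.

Lemma tm_ren f (r : nat -> nat) : tm f -> tm (fun e => f (fun i => e (r i))).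
Proof.
move=> [t [c h]]; exists (tren (fun i => if odd i then i else (r i./2).*2) t), c => e.
rewrite -h; apply: teval_ren => i; case oi: (odd i); first by rewrite /mix oi.
by rewrite mix_double /mix oi.
Qed.

(** Valuations are functions, and having the same values does not make them equal; definable
    relations cannot tell them apart. *)
Lemma d0_resp P e e' : d0 P -> (forall i, e i = e' i) -> P e <-> P e'.
Proof.
move=> [phi [c [E h]]] ee; rewrite -!h; apply: bsat_ext => i.
by rewrite /mix; case: ifP.
Qed.

Lemma d0_or P Q : d0 P -> d0 Q -> d0 (fun e => P e \/ Q e).
Proof.
move=> hP hQ; apply: d0_ext (d0_not (d0_and (d0_not hP) (d0_not hQ))) _ => e.
by split; [case: (classic (P e)); case: (classic (Q e)); tauto | tauto].
Qed.

Lemma d0_imp P Q : d0 P -> d0 Q -> d0 (fun e => P e -> Q e).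
Proof.
move=> hP hQ; apply: d0_ext (d0_not (d0_and hP (d0_not hQ))) _ => e.
by split; [case: (classic (Q e)); tauto | tauto].
Qed.

Lemma d0_iff P Q : d0 P -> d0 Q -> d0 (fun e => P e <-> Q e).
Proof. by move=> hP hQ; apply: d0_and; apply: d0_imp. Qed.

Lemma d0_bex f (Q : env -> N -> Prop) : tm f ->
  d0 (fun e => Q (fun i => e i.+1) (e 0%N)) -> d0 (fun e => exists x, x < f e /\ Q e x).
Proof.
move=> hf hQ.
apply: d0_ext (d0_not (d0_ball (Q := fun e x => ~ Q e x) hf (d0_not hQ))) _ => e; split.
  by move=> h; apply: NNPP => h'; apply: h => x xf Qx; apply: h'; exists x.
by move=> [x [xf Qx]] h; apply: (h x).
Qed.

Lemma sig_ext P Q : sig P -> (forall e, P e <-> Q e) -> sig Q.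
Proof. by move=> [R [hR h]] PQ; exists R; split=> // e; rewrite -PQ. Qed.

Lemma sig_d0 P : d0 P -> sig P.
Proof.
move=> hP; exists (fun e => P (fun i => e i.+1)); split; first exact: d0_ren.
by move=> e; split=> [|[]//]; exists 0.
Qed.

Lemma sig_ex_d0 (Q : env -> N -> Prop) :
  d0 (fun e => Q (fun i => e i.+1) (e 0%N)) -> sig (fun e => exists x, Q e x).
Proof. by move=> hQ; exists (fun e => Q (fun i => e i.+1) (e 0%N)); split. Qed.

Lemma sig_resp P e e' : sig P -> (forall i, e i = e' i) -> P e <-> P e'.
Proof.
move=> [Q [hQ h]] ee; rewrite !h; split=> -[m Hm]; exists m; move: Hm.
all: by rewrite (@d0_resp Q (econs m e) (econs m e') hQ) //; case.
Qed.

Lemma sig_sub P g : sig P -> sig (fun e => P (esub g e)).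
Proof.
move=> [Q [hQ h]].
pose g' i : nat + N := if i is j.+1 then (match g j with inl k => inl k.+1 | inr c => inr c end) else inl 0%N.
exists (fun e => Q (esub g' e)); split; first exact: d0_sub.
move=> e; rewrite h; split=> -[m Hm]; exists m; move: Hm;
  by rewrite (@d0_resp Q _ (econs m (esub g e)) hQ) //;
     case=> //= i; rewrite /esub /=; case: (g i).
Qed.

Lemma sig_ren P (r : nat -> nat) : sig P -> sig (fun e => P (fun i => e (r i))).
Proof. exact: (sig_sub (fun i => inl (r i))). Qed.

Lemma ecat_lt (s : seq N) (e e' : env) i : (i < size s)%N -> ecat s e i = ecat s e' i.
Proof. by elim: s i => //= x s IH [|i]//= /IH. Qed.

Lemma ecat_ge k (s : seq N) (e : env) i : size s = k -> ecat s e (k + i)%N = e i.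
Proof. by move<-; elim: s i => //=. Qed.

Lemma ecat_econs x (s : seq N) (e : env) : ecat (x :: s) e = econs x (ecat s e).
Proof. by []. Qed.

(** The way back from semantic definability to the syntax in which the axioms of [RCA0] and
    [Sigma1_class] are stated. *)
Lemma sig_Sigma1 P (k : nat) : sig P -> exists phi e0 E, forall s : seq N, size s = k ->
  P (ecat s (fun=> 0)) <-> sat_Sigma1 (ecat s e0) E phi.
Proof.
move=> [Q [[phi [c [E hE]]] h]].
(* The witness and the k arguments take the first [k.+1] variables, and parameters follow at odd
   offsets. Even variables past the arguments have the value 0 and are all sent to [k.+1], where the
   new valuation is 0. *)
pose r i := if odd i then (k.+1 + i)%N else if (i./2 < k.+1)%N then i./2 else k.+1.
exists (bren r id phi), (fun i => if odd i then c i./2 else 0), E => s sk.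
rewrite h; suff H m : Q (econs m (ecat s (fun=> 0))) <->
  bsat (econs m (ecat s (fun i => if odd i then c i./2 else 0))) E (bren r id phi).
  by split=> -[m /H hm]; exists m.
rewrite -hE (@bsat_ren _ E E id _ _ _ _ (mix (econs m (ecat s (fun=> 0))) c)) // => i.
have sk1 : size (m :: s) = k.+1 by rewrite /= sk.
rewrite -!ecat_econs /r /mix; case oi: (odd i).
  by rewrite (ecat_ge _ _ sk1) oi.
case: ifP => hi; first by apply: ecat_lt; rewrite sk1.
rewrite -{1}(addn0 k.+1) (ecat_ge _ _ sk1) /=.
have /subnKC <- : (k.+1 <= i./2)%N by rewrite leqNgt hi.
by rewrite -ecat_econs (ecat_ge _ _ sk1).
Qed.

End Definability.

Ltac tm_extra := fail.
Ltac d0_extra := fail.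
Ltac tm_step :=
  cbv beta; first
  [ lazymatch goal with
    | |- tm (fun e => ?f (fun i => e (@?r i))) => apply: (@tm_ren _ f r)
    end |
    apply: tm_const | apply: tm_var | apply: tm_add | apply: tm_mul | apply: tm_pair
  | assumption | tm_extra ].
Ltac d0_step :=
  cbv beta;
  lazymatch goal with
  | |- tm _ => tm_step
  | |- inhabited _ => assumption
  | |- d0 (fun e => ?P (fun i => e (@?r i))) => apply: (@d0_ren _ P r)
  | |- d0 (fun e => ~ @?P e) => apply: (@d0_not _ P)
  | |- d0 (fun e => @?P e /\ @?Q e) => apply: (@d0_and _ P Q)
  | |- d0 (fun e => @?P e \/ @?Q e) => apply: (@d0_or _ P Q)
  | |- d0 (fun e => @?P e <-> @?Q e) => apply: (@d0_iff _ P Q)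
  | |- d0 (fun e => exists x, x < @?f e /\ @?Q e x) => apply: (@d0_bex _ f Q)
  | |- d0 (fun e => forall x, x < @?f e -> @?Q e x) => apply: (@d0_ball _ f Q)
  | |- d0 (fun e => @?P e -> @?Q e) => apply: (@d0_imp _ P Q)
  | |- d0 (fun e => @?f e = @?g e) => apply: (@d0_eq _ f g)
  | |- d0 (fun e => @?f e < @?g e) => apply: (@d0_lt _ f g)
  | |- d0 (fun e => @?f e ∈ ?X) => apply: (@d0_in _ f X)
  | |- _ => first [assumption | d0_extra]
  end.
Ltac d0_tac := repeat d0_step.

(** * Arithmetic *)

Section Model.
Variables (M : l2struct) (hM : RCA0 M).
Notation N := (num M).
Notation env := (nat -> N).

Let hset : inhabited (set2 M) := rca0_set hM.

Lemma sig_ind (P : N -> Prop) : sig (fun e : env => P (e 0%N)) ->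
  P 0 -> (forall n, P n -> P (n + 1)) -> forall n, P n.
Proof.
move=> /(sig_Sigma1 1) [phi [e0 [E h]]] P0 PS n.
have H m : P m <-> sat_Sigma1 (econs m e0) E phi by apply: (h [:: m]).
rewrite H; apply: (rca0_ind hM); first by rewrite -H.
by move=> m; rewrite -!H; apply: PS.
Qed.

Lemma d0_ind (P : N -> Prop) : d0 (fun e : env => P (e 0%N)) ->
  P 0 -> (forall n, P n -> P (n + 1)) -> forall n, P n.
Proof. by move=> /sig_d0 /sig_ind. Qed.

Let B := rca0_basic hM.

Lemma add0 (m : N) : m + 0 = m. Proof. exact: ax_add0. Qed.
Lemma addS (m n : N) : m + (n + 1) = (m + n) + 1. Proof. exact: ax_addS. Qed.

Lemma add0x (n : N) : 0 + n = n.
Proof.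
move: n; apply: d0_ind; [by d0_tac | exact: add0|].
by move=> n h; rewrite addS h.
Qed.

Lemma addSx (m n : N) : (m + 1) + n = (m + n) + 1.
Proof.
move: n; apply: d0_ind; [by d0_tac | by rewrite !add0|].
by move=> n h; rewrite !addS h.
Qed.

Lemma addC (m n : N) : m + n = n + m.
Proof.
move: n; apply: d0_ind; [by d0_tac | by rewrite add0x add0|].
by move=> n h; rewrite addS h addSx.
Qed.

Lemma addA (m n k : N) : m + (n + k) = (m + n) + k.
Proof.
move: k; apply: d0_ind; [by d0_tac | by rewrite !add0|].
by move=> k h; rewrite !addS h.
Qed.

Lemma mul0x (n : N) : 0 * n = 0.
Proof.
move: n; apply: d0_ind; [by d0_tac | exact: (ax_mul0 B)|].
by move=> n h; rewrite (ax_mulS B) h add0.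
Qed.

Lemma mulSx (m n : N) : (m + 1) * n = m * n + n.
Proof.
move: n; apply: d0_ind; [by d0_tac | by rewrite !(ax_mul0 B) add0|].
move=> n h; rewrite !(ax_mulS B) h -!addA; congr (_ + _).
by rewrite !addA (addC n m).
Qed.

Lemma mulC (m n : N) : m * n = n * m.
Proof.
move: n; apply: d0_ind; [by d0_tac | by rewrite mul0x (ax_mul0 B)|].
by move=> n h; rewrite (ax_mulS B) mulSx h.
Qed.

Lemma mulDl (m n k : N) : (m + n) * k = m * k + n * k.
Proof.
move: k; apply: d0_ind; [by d0_tac | by rewrite !(ax_mul0 B) add0|].
move=> k h; rewrite !(ax_mulS B) h -!addA; congr (_ + _).
by rewrite !addA (addC m).
Qed.

Lemma mulA (m n k : N) : m * (n * k) = (m * n) * k.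
Proof.
move: m; apply: d0_ind; [by d0_tac | by rewrite !mul0x|].
by move=> m h; rewrite !mulSx h mulDl.
Qed.

Lemma mul1x (n : N) : 1 * n = n.
Proof. by rewrite -[l2one M]add0x mulSx mul0x add0x. Qed.

Lemma M_semi_ring : semi_ring_theory (l2zero M) (l2one M) (@l2add M) (@l2mul M) eq.
Proof.
split; [exact: add0x|exact: addC|exact: addA|exact: mul1x|exact: mul0x|exact: mulC|exact: mulA|].
exact: mulDl.
Qed.
Add Ring Mring : M_semi_ring.

Lemma addIx (m n k : N) : m + k = n + k -> m = n.
Proof.
move: k; apply: d0_ind; [by d0_tac | by rewrite !add0|].
by move=> k h; rewrite !addS => /(ax_succ_inj B).
Qed.

Lemma zero_or_succ (n : N) : n = 0 \/ exists m, n = m + 1.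
Proof.
move: n; apply: sig_ind; last by move=> n _; right; exists n.
  apply: (@sig_ext _ (fun e => exists m, e 0%N = 0 \/ e 0%N = m + 1)).
    by apply: sig_ex_d0; d0_tac.
  by move=> e; split=> [[m [?|?]]|[?|[m ?]]]; [left|right; exists m|exists 0; left|exists m; right].
by left.
Qed.

(** Turns the order into an equation, so that later inequalities are settled by naming the
    difference and calling [ring]. *)
Lemma ltP (x y : N) : x < y <-> exists k, y = x + k + 1.
Proof.
split; last first.
  move=> [k ->]; move: k; apply: d0_ind; first by d0_tac.
    by rewrite (ax_ltS B) add0; right.
  by move=> n h; rewrite (ax_ltS B); left; rewrite addA.
move: y; apply: sig_ind.
(* For a Sigma1 statement the witness has to stand in front of the implication; where the premise
   fails it is set to 0. *)
- apply: (@sig_ext _ (fun e => exists m, x < e 0%N -> e 0%N = x + m + 1)).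
    by apply: sig_ex_d0; d0_tac.
  move=> e; split=> [[m h] /h H|h]; first by exists m.
  case: (classic (x < e 0%N)) => [/h [m hm]|]; first by exists m.
  by exists 0.
- by move/(ax_lt0 B).
- move=> n IH; rewrite (ax_ltS B) => -[/IH [k ->]|->]; last by exists 0; rewrite add0.
  by exists (k + 1); ring.
Qed.

Lemma leP (x y : N) : (x < y \/ x = y) <-> exists k, y = x + k.
Proof.
rewrite ltP; split=> [[[k ->]| ->]|[k ->]].
- by exists (k + 1); ring.
- by exists 0; ring.
- by case: (zero_or_succ k) => [->|[m ->]]; [right; ring | left; exists m; ring].
Qed.

Lemma lt0 (x : N) : ~ x < 0. Proof. exact: (ax_lt0 B). Qed.
Lemma ltS (x y : N) : x < y + 1 <-> (x < y \/ x = y). Proof. exact: (ax_ltS B). Qed.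

Lemma ltS' (x y : N) : x < y + 1 <-> exists k, y = x + k.
Proof. by rewrite ltS leP. Qed.

Lemma lt_irr (x : N) : ~ x < x.
Proof.
rewrite ltP => -[k h]; have: 0 + x = (k + 1) + x by rewrite [LHS]add0x {1}h; ring.
by move/addIx/esym/(ax_succ_neq0 B).
Qed.

Lemma lt_trans (x y z : N) : x < y -> y < z -> x < z.
Proof. by rewrite !ltP => -[k ->] [l ->]; exists (k + l + 1); ring. Qed.

Lemma le_lt_trans (x y z : N) : x <= y -> y < z -> x < z.
Proof. by move=> [|->] //; apply: lt_trans. Qed.

Lemma lt_le_trans (x y z : N) : x < y -> y <= z -> x < z.
Proof. by move=> h [/(lt_trans h)|<-]. Qed.

Lemma lt_total (x y : N) : x <= y \/ y < x.
Proof.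
move: y; apply: d0_ind; first by d0_tac.
  by case: (zero_or_succ x) => [->|[m ->]]; [left; right | right; apply/ltP; exists m; ring].
move=> y [|]; first by rewrite -ltS; left; left.
move/ltP => [k ->]; case: (zero_or_succ k) => [->|[m ->]].
  by left; right; ring.
by right; apply/ltP; exists m; ring.
Qed.

Lemma nlt (x y : N) : ~ x < y <-> y <= x.
Proof.
split; first by case: (lt_total y x).
by move=> h h'; case: (lt_irr (le_lt_trans h h')).
Qed.

Lemma nle (x y : N) : ~ (x <= y) <-> y < x.
Proof.
split; first by case: (lt_total x y).
by move=> h h'; case: (lt_irr (le_lt_trans h' h)).
Qed.

Lemma mulIle (x y d : N) : d <> 0 -> x * d <= y * d -> x <= y.
Proof.
move=> d0 h; case: (zero_or_succ d) => // -[d' ed]; apply: NNPP; rewrite nle ltP => -[k e].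
by case: (proj2 (nle _ _) _ h); rewrite ltP; exists (y * 0 + k * d' + k + d'); rewrite e ed; ring.
Qed.

(** * Sigma1 relations *)

Lemma ub2 (x y : N) : exists b, x < b /\ y < b.
Proof. by exists (x + y + 1); rewrite !ltP; split; [exists y | exists x]; ring. Qed.

(** Contracts two unbounded quantifiers to one: the new witness is a common bound, below which both
    old witnesses are found by bounded search. *)
Lemma sig_ex (Q : env -> N -> Prop) :
  sig (fun e => Q (fun i => e i.+1) (e 0%N)) -> sig (fun e => exists x, Q e x).
Proof.
move=> [R [hR h]].
pose r i : nat := if i is j.+2 then j.+3 else i.
exists (fun e => exists x, x < e 0%N /\ exists m, m < e 0%N /\
          R (econs m (econs x (fun i => e i.+1)))); split.
  apply: (@d0_bex _ (fun e => e 0%N)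
    (fun e x => exists m, m < e 0%N /\ R (econs m (econs x (fun i => e i.+1))))); first by d0_tac.
  apply: (@d0_bex _ (fun e => e 1%N)
    (fun e m => R (econs m (econs (e 0%N) (fun i => e i.+2))))); first by d0_tac.
  have dP : d0 (fun e => R (fun i => e (r i))) by apply: d0_ren.
  by apply: d0_ext dP _ => e; apply: d0_resp hR _; case=> [|[|i]].
have hx e x : Q e x <-> exists m, R (econs m (econs x e)) by apply: (h (econs x e)).
move=> e; split.
  move=> [x /hx [m Rm]]; have [b [xb mb]] := ub2 x m.
  by exists b, x; split=> //; exists m.
by move=> [b [x [_ [m [_ Rm]]]]]; exists x; apply/hx; exists m.
Qed.

Lemma sig_and P Q : sig P -> sig Q -> sig (fun e : env => P e /\ Q e).
Proof.
move=> [R [hR h]] [R' [hR' h']].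
apply: (@sig_ext _ (fun e => exists m, exists m', R (econs m e) /\ R' (econs m' e))); last first.
  by move=> e; rewrite h h'; split=> [[m [m' []]]|[[m ?] [m' ?]]]; eauto.
apply: sig_ex; apply: sig_ex_d0; apply: d0_and.
  by apply: d0_ext (d0_ren succn hR) _ => e; apply: d0_resp hR _; case.
by apply: d0_ext (d0_ren (upr succn) hR') _ => e; apply: d0_resp hR' _; case.
Qed.

Lemma sig_or P Q : sig P -> sig Q -> sig (fun e : env => P e \/ Q e).
Proof.
move=> [R [hR h]] [R' [hR' h']]; exists (fun e => R e \/ R' e); split; first exact: d0_or.
by move=> e; rewrite h h'; split=> [[[m ?]|[m ?]]|[m [?|?]]]; eauto.
Qed.

Lemma sig_imp P Q : d0 P -> sig Q -> sig (fun e : env => P e -> Q e).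
Proof.
move=> hP hQ; apply: sig_ext (sig_or (sig_d0 (d0_not hP)) hQ) _ => e.
by split; [tauto | case: (classic (P e)); tauto].
Qed.

(** Induction on j: for bounded R, that one bound serves all x < j is a Sigma1 statement.
    Restricting to j <= n keeps the induction where witnesses are known to exist. *)
Lemma d0_collection (R : N -> N -> Prop) n : d0 (fun e => R (e 0%N) (e 1%N)) ->
  (forall x, x < n -> exists m, R m x) -> exists b, forall x, x < n -> exists m, m < b /\ R m x.
Proof.
move=> hR h.
suff H j : j < n + 1 -> exists b, forall x, x < j -> exists m, m < b /\ R m x.
  by apply: H; rewrite ltS; right.
move: j; apply: sig_ind.
- apply: sig_imp; first by d0_tac.
  apply: sig_ex_d0; d0_tac.
- by exists 0 => x /lt0.
- move=> j IH; rewrite ltS => hj.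
  have [|b hb] := IH.
    by rewrite ltS; left; apply: lt_le_trans hj; rewrite ltS; right.
  have [|m hm] := h j; first by apply: lt_le_trans hj; rewrite ltS; right.
  have [b' [mb bb]] := ub2 m b.
  exists b' => x; rewrite ltS => -[/hb [m' [m'b R']]|->]; last by exists m.
  by exists m'; split=> //; apply: lt_trans m'b bb.
Qed.

(** Collection supplies one bound for the witnesses of all x < f, and the bound moves in front of
    the bounded quantifier. *)
Lemma sig_ball f (Q : env -> N -> Prop) : tm f ->
  sig (fun e => Q (fun i => e i.+1) (e 0%N)) -> sig (fun e => forall x, x < f e -> Q e x).
Proof.
move=> hf [R [hR h]].
have hx e x : Q e x <-> exists m, R (econs m (econs x e)) by apply: (h (econs x e)).
apply: (@sig_ext _ (fun e => exists b, forall x, x < f e ->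
  exists m, m < b /\ R (econs m (econs x e)))); last first.
  move=> e; split; first by move=> [b hb] x /hb [m [_ hm]]; apply/hx; exists m.
  move=> H; apply: d0_collection; last by move=> x /H /hx.
  pose g i : nat + N := if i is j.+2 then inr (e j) else inl i.
  by apply: d0_ext (d0_sub g hR) _ => e'; apply: d0_resp hR _; case=> [|[|i]].
apply: sig_ex_d0.
apply: (@d0_ball _ (fun e => f (fun i => e i.+1))
  (fun e x => exists m, m < e 0%N /\ R (econs m (econs x (fun i => e i.+1))))).
  by d0_tac.
apply: (@d0_bex _ (fun e => e 1%N)
    (fun e m => R (econs m (econs (e 0%N) (fun i => e i.+2))))); first by d0_tac.
pose r i : nat := if i is j.+2 then j.+3 else i.
have dP : d0 (fun e => R (fun i => e (r i))) by apply: d0_ren.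
by apply: d0_ext dP _ => e; apply: d0_resp hR _; case=> [|[|i]].
Qed.

Lemma sig_let P f : sig (fun e => P (fun i => e i.+1) (e 0%N)) -> tm f ->
  sig (fun e : env => P e (f e)).
Proof.
move=> hP hf.
apply: (@sig_ext _ (fun e => exists x, x = f e /\ P e x)).
  by apply: sig_ex; apply: sig_and => //; apply: sig_d0; d0_tac.
by move=> e; split=> [[x [-> ]]//|]; exists (f e).
Qed.

Lemma d0_let P f : d0 (fun e => P (fun i => e i.+1) (e 0%N)) -> tm f ->
  d0 (fun e : env => P e (f e)).
Proof.
move=> hP hf.
apply: (@d0_ext _ (fun e => exists x, x < f e + 1 /\ (x = f e /\ P e x))).
  by d0_tac.
move=> e; split=> [[x [_ [-> ]]]//|h]; exists (f e); split=> //.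
by rewrite ltS; right.
Qed.

Definition sig1 (P : N -> Prop) := sig (fun e => P (e 0%N)).
Definition sig2 (P : N -> N -> Prop) := sig (fun e => P (e 0%N) (e 1%N)).
Definition sig3 (P : N -> N -> N -> Prop) := sig (fun e => P (e 0%N) (e 1%N) (e 2%N)).

Lemma sig1_app P f : sig1 P -> tm f -> sig (fun e => P (f e)).
Proof.
move=> hP hf; apply: (@sig_let (fun e x => P x)) => //.

Qed.

Lemma sig2_app P f g : sig2 P -> tm f -> tm g -> sig (fun e => P (f e) (g e)).
Proof.
move=> hP hf hg; apply: (@sig_let (fun e x => P x (g e))) => //.
apply: (@sig_let (fun e x => P (e 0%N) x)); last by d0_tac.
by apply: (@sig_ren _ _ (fun i => if i is 0 then 1%N else 0%N) hP).
Qed.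

Lemma sig3_app P f g h : sig3 P -> tm f -> tm g -> tm h ->
  sig (fun e => P (f e) (g e) (h e)).
Proof.
move=> hP hf hg hh; apply: (@sig_let (fun e x => P x (g e) (h e))) => //.
apply: (@sig_let (fun e x => P (e 0%N) x (h (fun i => e i.+1)))); last by d0_tac.
apply: (@sig_let (fun e x => P (e 1%N) (e 0%N) x)); last by d0_tac.
by apply: (@sig_ren _ _ (fun i => if i is 0 then 2%N else if i is 1 then 1%N else 0%N) hP).
Qed.

Lemma least (P : N -> Prop) : d0 (fun e => P (e 0%N)) -> (exists n, P n) ->
  exists n, P n /\ forall m, m < n -> ~ P m.
Proof.
move=> hP [n Pn]; apply: NNPP => h.
suff H : forall n m, m < n -> ~ P m.
  by apply: (H (n + 1) n) => //; rewrite ltS; right.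
move=> {n Pn}; apply: d0_ind.
- by d0_tac; apply: (d0_ren (fun i => 0%N) hP).
- by move=> m /lt0.
- move=> n IH m; rewrite ltS => -[/IH//|->] Pn; apply: h.
  by exists n.
Qed.

Lemma comprehension (P : N -> Prop) : sig1 P -> sig1 (fun n => ~ P n) ->
  exists X : set2 M, forall n, n ∈ X <-> P n.
Proof.
move=> /(sig_Sigma1 1) [phi [c [E h]]] /(sig_Sigma1 1) [phi' [c' [E' h']]].
have {}h n : P n <-> sat_Sigma1 (econs n c) E phi by apply: (h [:: n]).
have {}h' n : ~ P n <-> sat_Sigma1 (econs n c') E' phi' by apply: (h' [:: n]).
(* Variables 0 and 1, the witness and n, stay in place; the parameters of the two definitions move
   to the even and the odd places of one valuation. *)
pose r i : nat := if i is j.+2 then j.*2.+2 else i.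
pose r' i : nat := if i is j.+2 then j.*2.+3 else i.
have [|X hX] := @rca0_comp _ hM (bren r double phi) (BNeg (bren r' (fun i => i.*2.+1) phi'))
   (mix c c') (mix E E').
  move=> n.
  have H m : bsat (econs m (econs n (mix c c'))) (mix E E') (bren r double phi) <->
             bsat (econs m (econs n c)) E phi.
    by apply: bsat_ren (mix_double E E') _ _ _ _; case=> [|[|i]] //=; rewrite mix_double.
  have H' m : bsat (econs m (econs n (mix c c'))) (mix E E') (bren r' (fun i => i.*2.+1) phi')
     <-> bsat (econs m (econs n c')) E' phi'.
    by apply: bsat_ren (mix_doubleS E E') _ _ _ _; case=> [|[|i]] //=; rewrite mix_doubleS.
  split.
    move=> [m /H hm] m' /= /H' hm'.
    have: ~ P n by apply/h'; exists m'.
    by apply; apply/h; exists m.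
  move=> hm; case: (classic (P n)) => [/h [m /H Hm]|/h' [m /H' Hm]]; first by exists m.
  by case: (hm m).
exists X => n; rewrite hX h; split=> -[m hm]; exists m; move: hm;
  by rewrite (@bsat_ren _ _ E double phi (mix_double E E') r _ (econs m (econs n c))) //;
     case=> [|[|i]] //=; rewrite mix_double.
Qed.

Lemma d0_comprehension (P : N -> Prop) : d0 (fun e => P (e 0%N)) ->
  exists X : set2 M, forall n, n ∈ X <-> P n.
Proof. by move=> hP; apply: comprehension; apply: sig_d0; d0_tac. Qed.

(** With s = i + j the code lies between s^2 and s^2 + s, hence below (s + 1)^2; so the code
    determines s, then i, then j. *)
Lemma pair_inj (i j i' j' : N) : ⟨i, j⟩ = ⟨i', j'⟩ -> i = i' /\ j = j'.
Proof.
have lt (s s' x y : N) : s < s' -> x <= s -> s * s + x < s' * s' + y.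
  rewrite ltP leP ltP => -[k ->] [d ->].
  by exists (d + (1 + 1) * x * k + (1 + 1) * d * k + k * k + (1 + 1) * k + x + d + y); ring.
have le (x y : N) : x <= x + y by rewrite leP; exists y.
rewrite /pair2 => e.
have es : i + j = i' + j'.
  case: (lt_total (i + j) (i' + j')) => [[h|//]|h].
    by have := lt _ _ i i' h (le _ _); rewrite e => /lt_irr.
  by have := lt _ _ i' i h (le _ _); rewrite e => /lt_irr.
have ei : i = i'.
  by move: e; rewrite es => e; apply: (@addIx _ _ ((i' + j') * (i' + j'))); rewrite addC e addC.
by split=> //; move: es; rewrite ei => e'; apply: (@addIx _ _ i'); rewrite addC e' addC.
Qed.

Lemma pair_gel (i j : N) : i < ⟨i, j⟩ + 1.
Proof. by rewrite ltS leP /pair2; exists ((i + j) * (i + j)); ring. Qed.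

Lemma pair_ger (i j : N) : j < ⟨i, j⟩ + 1.
Proof.
rewrite ltS leP /pair2; case: (zero_or_succ j) => [->|[k ->]].
  by exists (i * i + i); ring.
by exists (i * i + (1 + 1) * i * (k + 1) + k * k + k + i); ring.
Qed.

Ltac sig_extra := fail.
Ltac sig_step :=
  cbv beta;
  lazymatch goal with
  | |- sig1 _ => rewrite /sig1
  | |- sig2 _ => rewrite /sig2
  | |- sig3 _ => rewrite /sig3
  | |- sig (fun e => ?P (fun i => e (@?r i))) => apply: (@sig_ren _ P r)
  | |- sig (fun e => @?P e /\ @?Q e) => apply: (@sig_and P Q)
  | |- sig (fun e => @?P e \/ @?Q e) => apply: (@sig_or P Q)
  | |- sig (fun e => exists x, @?Q e x) => apply: (@sig_ex Q)
  | |- sig (fun e => forall x, x < @?f e -> @?Q e x) => apply: (@sig_ball f Q)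
  | |- sig (fun e => ~ _) => apply: sig_d0
  | |- sig (fun e => _ <-> _) => apply: sig_d0
  | |- sig (fun e => @?P e -> @?Q e) => apply: (@sig_imp P Q)
  | |- sig (fun e => _ = _) => apply: sig_d0
  | |- sig (fun e => _ < _) => apply: sig_d0
  | |- sig (fun e => _ ∈ _) => apply: sig_d0
  | |- sig _ => first [assumption | sig_extra | apply: sig_d0; first [assumption | d0_extra]]
  | |- _ => d0_step
  end.
Ltac sig_tac := repeat sig_step.

(** * Codes of finite sets *)

Lemma le_refl (x : N) : x < x + 1. Proof. by rewrite ltS; right. Qed.
Lemma lt_0S (x : N) : 0 < x + 1. Proof. by rewrite ltP; exists x; ring. Qed.
Lemma ltW (x y : N) : x < y -> x < y + 1. Proof. by rewrite ltS; left. Qed.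
Lemma one_neq0 : (1 : N) <> 0.
Proof. by move=> h; apply: (ax_succ_neq0 (rca0_basic hM) (n := 0)); rewrite add0x. Qed.

Lemma dvd2E (d n : N) : dvd2 d n <-> exists k, k < n + 1 /\ n = d * k.
Proof.
split=> [[k ->]|[k [_ ->]]]; last by exists k.
(* For d = 0 the given quotient may be arbitrarily large, so it is replaced by 0; otherwise it is at
   most n. *)
case: (zero_or_succ d) => [->|[d' ->]].
  by exists 0; split; [rewrite ltP; exists 0; ring | ring].
by exists k; split=> //; rewrite ltS'; exists (d' * k); ring.
Qed.

Lemma d0_dvd2 f g : tm f -> tm g -> d0 (fun e : env => dvd2 (f e) (g e)).
Proof.
move=> hf hg; apply: (@d0_ext _ (fun e => exists k, k < g e + 1 /\ g e = f e * k)).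
  by d0_tac.
by move=> e; rewrite dvd2E.
Qed.

Lemma dvd2_sub (d a b : N) : d <> 0 -> dvd2 d (a + b) -> dvd2 d b -> dvd2 d a.
Proof.
move=> d0 [k ek] [l el].
have : l * d <= k * d by rewrite leP; exists a; rewrite (mulC k) (mulC l) -el -ek; ring.
move/(mulIle d0); rewrite leP => -[r er]; exists r.
by apply: (@addIx _ _ b); rewrite ek er el; ring.
Qed.

Lemma dvd2_mulr (d a b : N) : dvd2 d a -> dvd2 d (a * b).
Proof. by move=> [k ->]; exists (k * b); ring. Qed.

Lemma dvd2_add (d a b : N) : dvd2 d a -> dvd2 d b -> dvd2 d (a + b).
Proof. by move=> [k ->] [l ->]; exists (k + l); ring. Qed.

Lemma dvd2_refl (d : N) : dvd2 d d.
Proof. by exists 1; ring. Qed.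

(* With [d_i = m (i + 1) + 1] and [m = k (j - i)], the combination
   [k (i + 1)^2 d_j - (k (i + 1) (j + 1) - 1) d_i] is [1]. *)
Lemma beta_coprime (m n i j l : N) :
  (forall k, k < l -> dvd2 (k + 1) m) -> i < l -> j < l -> i <> j ->
  dvd2 (m * (i + 1) + 1) (n * (m * (j + 1) + 1)) -> dvd2 (m * (i + 1) + 1) n.
Proof.
move=> hm il jl ij h.
have dn0 : m * (i + 1) + 1 <> 0 by apply: ax_succ_neq0 (rca0_basic hM) _.
have : exists d, d < l /\ (j = i + d + 1 \/ i = j + d + 1).
  case: (lt_total i j) => [[|//]|]; rewrite ltP => -[d e]; exists d; split; [|by left| |by right].
    by apply: lt_trans jl; rewrite ltP; exists i; rewrite e; ring.
  by apply: lt_trans il; rewrite ltP; exists j; rewrite e; ring.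
move=> [d [/hm [k em] [e|e]]].
  apply: (dvd2_sub dn0 (b := n * (m * (i + 1) + 1) * (k * (i + 1) * (j + 1)))).
    have -> : n + n * (m * (i + 1) + 1) * (k * (i + 1) * (j + 1)) =
       n * (m * (j + 1) + 1) * (k * (i + 1) * (i + 1)) + (m * (i + 1) + 1) * n.
      by rewrite e em; ring.
    by apply: dvd2_add; [apply: dvd2_mulr | apply/dvd2_mulr/dvd2_refl].
  by rewrite (mulC n) -mulA; apply/dvd2_mulr/dvd2_refl.
(* For j < i the identity is used with i and j exchanged; the terms containing d_j are then
   multiples of n d_j, to which [h] applies. *)
apply: (dvd2_sub dn0 (b := n * (m * (j + 1) + 1) * (k * (i + 1) * (j + 1)))).
  have -> : n + n * (m * (j + 1) + 1) * (k * (i + 1) * (j + 1)) =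
     (m * (i + 1) + 1) * (n * k * (j + 1) * (j + 1)) + n * (m * (j + 1) + 1).
    by rewrite e em; ring.
  by apply: dvd2_add => //; apply/dvd2_mulr/dvd2_refl.
exact: dvd2_mulr.
Qed.

(** Plays the part of the factorial before recursion is available: only its existence is proved by
    induction. *)
Lemma common_multiple (l : N) : exists m, m <> 0 /\ forall k, k < l -> dvd2 (k + 1) m.
Proof.
move: l; apply: sig_ind.
- apply: sig_ex_d0; d0_tac; apply: d0_dvd2; d0_tac.
- by exists 1; split; [exact: one_neq0 | move=> k /lt0].
- move=> l [m [m0 hm]]; exists (m * (l + 1)); split.
    case: (zero_or_succ m) => // -[m' ->] e.
    by apply: (ax_succ_neq0 (rca0_basic hM) (n := m' * l + m' + l)); rewrite -[RHS]e; ring.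
  move=> k; rewrite ltS => -[/hm|->]; first exact: dvd2_mulr.
  by rewrite mulC; apply/dvd2_mulr/dvd2_refl.
Qed.

(** Goedel's beta function: n is the product of the moduli m (i + 1) + 1 over the elements i < l of
    X, obtained factor by factor. By [beta_coprime] a new factor does not make the modulus of
    another index divide the product. *)
Lemma beta_set (X : set2 M) (l : N) :
  exists m n, forall i, i < l -> dvd2 (m * (i + 1) + 1) n <-> i ∈ X.
Proof.
have [m [m0 hm]] := common_multiple l; exists m.
suff H j : exists n, forall i, i < l -> dvd2 (m * (i + 1) + 1) n <-> i < j /\ i ∈ X.
  by have [n hn] := H l; exists n => i il; rewrite hn //; tauto.
move: j; apply: sig_ind.
- apply: sig_ex_d0; d0_tac; apply: d0_dvd2; d0_tac.
(* The empty product: since m <> 0, every modulus exceeds 1 and does not divide it. *)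
- exists 1 => i il; split; last by move=> [/lt0].
  case: (zero_or_succ m) => // -[m' em]; rewrite em => -[k].
  case: (zero_or_succ k) => [->|[k' ->]] e; first by case: one_neq0; rewrite e; ring.
  case: (ax_succ_neq0 (rca0_basic hM) (n := m' * i + m' + i + k' * (m' + 1) * (i + 1) + k')).
  by apply: (@addIx _ _ 1); rewrite add0x [RHS]e; ring.
- move=> j [n hn]; case: (classic (j < l /\ j ∈ X)) => [[jl jX]|jX].
    exists (n * (m * (j + 1) + 1)) => i il; case: (classic (i = j)) => [->|ij].
      split=> _; first by split=> //; apply: le_refl.
      by rewrite (mulC n); apply/dvd2_mulr/dvd2_refl.
    rewrite ltS; split=> [/(beta_coprime hm il jl ij)/hn|]; first by tauto.
    by move=> h; apply: dvd2_mulr; apply/(hn i il); tauto.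
  exists n => i il; rewrite hn // ltS; split; first by tauto.
  by move=> [[|ij]] //; subst; tauto.
Qed.

Definition shape (c : N) : Prop := exists l m n, c = ⟨l, ⟨m, n⟩⟩.

(** The components of a code are at most the code. This and the similar equivalences [felemE],
    [fincodeE], [finseqE], [binstrE] and [fsubE] bound all quantifiers, so that the coding notions
    become Delta0. *)
Lemma shapeE (c : N) : shape c <->
  exists l, l < c + 1 /\ exists m, m < c + 1 /\ exists n, n < c + 1 /\ c = ⟨l, ⟨m, n⟩⟩.
Proof.
split=> [[l [m [n e]]]|[l [_ [m [_ [n [_ e]]]]]]]; last by exists l, m, n.
exists l; split; first by rewrite e; apply: pair_gel.
have mn : ⟨m, n⟩ < c + 1 by rewrite e; apply: pair_ger.
exists m; split; first by apply: le_lt_trans mn; rewrite -ltS; apply: pair_gel.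
by exists n; split=> //; apply: le_lt_trans mn; rewrite -ltS; apply: pair_ger.
Qed.

Lemma d0_shape f : tm f -> d0 (fun e : env => shape (f e)).
Proof. by move=> hf; apply: (d0_ext _ (fun e => iff_sym (shapeE (f e)))); d0_tac. Qed.

Lemma felemE (i c : N) : felem i c <->
  exists l, l < c + 1 /\ exists m, m < c + 1 /\ exists n, n < c + 1 /\
    (c = ⟨l, ⟨m, n⟩⟩ /\ (i < l /\ dvd2 (m * (i + 1) + 1) n)).
Proof.
split=> [[l [m [n [e il d]]]]|[l [_ [m [_ [n [_ [e [il d]]]]]]]]]; last by exists l, m, n.
exists l; split; first by rewrite e; apply: pair_gel.
have mn : ⟨m, n⟩ < c + 1 by rewrite e; apply: pair_ger.
exists m; split; first by apply: le_lt_trans mn; rewrite -ltS; apply: pair_gel.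
by exists n; split=> //; apply: le_lt_trans mn; rewrite -ltS; apply: pair_ger.
Qed.

Lemma d0_felem f g : tm f -> tm g -> d0 (fun e : env => felem (f e) (g e)).
Proof.
move=> hf hg; apply: (d0_ext _ (fun e => iff_sym (felemE (f e) (g e)))); d0_tac.
by apply: d0_dvd2; d0_tac.
Qed.

Lemma felem_lt (i c : N) : felem i c -> i < c + 1.
Proof. by move=> /felemE [l [lc [_ [_ [_ [_ [_ [il _]]]]]]]]; apply: lt_trans il lc. Qed.

Lemma fincodeE (c : N) : fincode c <->
  shape c /\ forall c', c' < c -> shape c' -> ~ (forall i, i < c + 1 -> felem i c <-> felem i c').
Proof.
split=> -[hc h]; split=> // c' c'c sc' H; apply: (h c' c'c sc').
  move=> i; split=> hi; first by rewrite -H //; apply: felem_lt.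
  by rewrite H //; apply: lt_trans (felem_lt hi) _; rewrite !ltP in c'c *;
     have [k ->] := c'c; exists k; ring.
by move=> i _; apply: H.
Qed.

Lemma d0_fincode f : tm f -> d0 (fun e : env => fincode (f e)).
Proof.
move=> hf; apply: (d0_ext _ (fun e => iff_sym (fincodeE (f e)))); d0_tac.
- exact: d0_shape.
- by apply: d0_shape; d0_tac.
- by apply: d0_felem; d0_tac.
- by apply: d0_felem; d0_tac.
Qed.

(** [beta_set] provides some representative, and the least number principle the canonical one. *)
Lemma code_set (X : set2 M) (l : N) :
  exists c, fincode c /\ forall i, felem i c <-> i < l /\ i ∈ X.
Proof.
pose P c := shape c /\ ((forall i, i < c + 1 -> felem i c -> i < l /\ i ∈ X) /\
                        forall i, i < l -> i ∈ X -> felem i c).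
have PE c : P c <-> shape c /\ forall i, felem i c <-> i < l /\ i ∈ X.
  split=> [[s [h h']]|[s h]]; split=> //.
    by move=> i; split=> [hi|[]]; [apply: h => //; apply: felem_lt | exact: h'].
  by split=> i; rewrite ?h.
have [||c [/PE [sc hc] h]] := @least P.
- rewrite /P; d0_tac; [apply: d0_shape | apply: d0_felem | apply: d0_felem]; d0_tac.
- have [m [n h]] := beta_set X l; exists ⟨l, ⟨m, n⟩⟩; apply/PE; split; first by exists l, m, n.
  move=> i; split=> [[l' [m' [n' [/pair_inj [<- /pair_inj [<- <-]]] il]]]|[il iX]].
    by rewrite h.
  by exists l, m, n; split=> //; apply/h.
- exists c; split=> //; split=> // c' c'c sc' H; apply: (h c' c'c); apply/PE; split=> // i.
  by rewrite -H.
Qed.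

Lemma code_d0 (P : N -> Prop) (l : N) : d0 (fun e => P (e 0%N)) ->
  exists c, fincode c /\ forall i, felem i c <-> i < l /\ P i.
Proof.
move=> /d0_comprehension [X hX]; have [c [fc hc]] := code_set X l.
by exists c; split=> // i; rewrite hc hX.
Qed.

Lemma finseqE (s l : N) : finseq s l <->
  fincode s /\ ((forall z, z < s + 1 -> felem z s ->
                   exists i, i < z + 1 /\ exists j, j < z + 1 /\ (z = ⟨i, j⟩ /\ i < l)) /\
  (forall i, i < l -> exists j, j < s + 1 /\ (felem ⟨i, j⟩ s /\
     forall j', j' < s + 1 -> felem ⟨i, j'⟩ s -> j = j'))).
Proof.
have fs i j : felem ⟨i, j⟩ s -> j < s + 1.
  by move/felem_lt; apply: le_lt_trans; rewrite -ltS; apply: pair_ger.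
split=> [[fc h1 h2]|[fc [h1 h2]]].
  split=> //; split=> [z zs /h1 [i [j [-> il]]]|i /h2 [j [hj u]]].
    exists i; split; first exact: pair_gel.
    by exists j; split=> //; exact: pair_ger.
  by exists j; split; [exact: fs hj | split=> // j' _ /u].
split=> // [z hz|i /h2 [j [_ [hj u]]]].
  by have [i [_ [j [_ [-> il]]]]] := h1 z (felem_lt hz) hz; exists i, j.
by exists j; split=> // j' hj'; apply: u => //; apply: fs hj'.
Qed.

Lemma d0_finseq f g : tm f -> tm g -> d0 (fun e : env => finseq (f e) (g e)).
Proof.
move=> hf hg; apply: (d0_ext _ (fun e => iff_sym (finseqE (f e) (g e)))); d0_tac;
  by [exact: d0_fincode | apply: d0_felem; d0_tac].
Qed.

Lemma binstrE (t : N) : binstr t <->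
  (exists l, l < t + 1 + 1 /\ finseq t l) /\
  forall i, i < t + 1 -> forall j, j < t + 1 -> felem ⟨i, j⟩ t -> j = 0 \/ j = 1.
Proof.
split=> -[[l h] h']; last first.
  split; first by exists l; case: h.
  move=> i j hij; have := felem_lt hij; rewrite ltS => ht.
  by apply: (h' i _ j) => //; apply: lt_le_trans (_ : ⟨i, j⟩ + 1 <= t + 1);
     rewrite ?leP; try exact: pair_gel; try exact: pair_ger;
     move: ht; rewrite leP => -[k ->]; exists k; ring.
split; last by move=> i _ j _; apply: h'.
(* A nonempty sequence has an entry at its last place l - 1, and the pair coding this entry is an
   element of t, which bounds the length. *)
exists l; split=> //; case: (zero_or_succ l) => [->|[k ek]]; first by rewrite ltP; exists (t + 1); ring.
case: h => _ _ h; have [|j [/felem_lt hj _]] := h k; first by rewrite ek; apply: le_refl.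
have : k < t + 1 by apply: le_lt_trans hj; rewrite -ltS; apply: pair_gel.
by rewrite ek !ltP => -[x ->]; exists x; ring.
Qed.

Lemma d0_binstr f : tm f -> d0 (fun e : env => binstr (f e)).
Proof.
move=> hf; apply: (d0_ext _ (fun e => iff_sym (binstrE (f e)))); d0_tac;
  by [apply: d0_finseq; d0_tac | apply: d0_felem; d0_tac].
Qed.

Lemma fsubE (c c' : N) : fsub c c' <-> forall i, i < c + 1 -> felem i c -> felem i c'.
Proof. by split=> h i; [move=> _; exact: h | move=> hi; apply: h => //; apply: felem_lt]. Qed.

Lemma d0_fsub f g : tm f -> tm g -> d0 (fun e : env => fsub (f e) (g e)).
Proof.
move=> hf hg; apply: (d0_ext _ (fun e => iff_sym (fsubE (f e) (g e)))); d0_tac;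
  by apply: d0_felem; d0_tac.
Qed.

Ltac d0_extra ::= first
  [ apply: d0_dvd2 | apply: d0_felem | apply: d0_fincode | apply: d0_finseq
  | apply: d0_binstr | apply: d0_fsub ].

(** * Primitive recursion *)

(** The argument of [d0_collection] again, now that closure under bounded quantifiers makes its
    induction statement Sigma1 for Sigma1 relations as well. *)
Lemma collection (R : N -> N -> Prop) n : sig2 R ->
  (forall x, x < n -> exists m, R m x) -> exists b, forall x, x < n -> exists m, m < b /\ R m x.
Proof.
move=> hR h.
suff H j : j < n + 1 -> exists b, forall x, x < j -> exists m, m < b /\ R m x.
  by apply: H; rewrite ltS; right.
move: j; apply: sig_ind.
- sig_tac; exact: sig2_app hR (tm_var _ _) (tm_var _ _).
- by exists 0 => x /lt0.
- move=> j IH; rewrite ltS => hj.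
  have [|b hb] := IH.
    by rewrite ltS; left; apply: lt_le_trans hj; rewrite ltS; right.
  have [|m hm] := h j; first by apply: lt_le_trans hj; rewrite ltS; right.
  have [b' [mb bb]] := ub2 m b.
  exists b' => x; rewrite ltS => -[/hb [m' [m'b R']]|->]; last by exists m.
  by exists m'; split=> //; apply: lt_trans m'b bb.
Qed.

Lemma pair_mono (i j i' j' : N) : i <= i' -> j <= j' -> ⟨i, j⟩ <= ⟨i', j'⟩.
Proof.
rewrite !leP => -[a ->] [b ->]; rewrite /pair2.
exists ((a + b) * (i + j) * (1 + 1) + (a + b) * (a + b) + a); ring.
Qed.

Lemma code_delta (P : N -> Prop) (l : N) : sig1 P -> sig1 (fun n => ~ P n) ->
  exists c, fincode c /\ forall i, felem i c <-> i < l /\ P i.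
Proof.
move=> h h'; have [X hX] := comprehension h h'; have [c [fc hc]] := code_set X l.
by exists c; split=> // i; rewrite hc hX.
Qed.

(** A total function misses j at i exactly when it takes some other value there, so a Sigma1 graph
    is Delta1. *)
Lemma sig_graph_compl (H : N -> N -> Prop) : sig2 H ->
  (forall i, exists! j, H i j) -> sig2 (fun i j => ~ H i j).
Proof.
move=> hH u; apply: (@sig_ext _ (fun e => exists j, H (e 0%N) j /\ j <> e 1%N)).
  sig_tac; exact: sig2_app hH (tm_var _ _) (tm_var _ _).
move=> e; split=> [[j [Hj ne]] H1|nH].
  by have [k [Hk uk]] := u (e 0%N); apply: ne; rewrite -(uk _ Hj) -(uk _ H1).
by have [k [Hk uk]] := u (e 0%N); exists k; split=> // ek; apply: nH; rewrite -ek.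
Qed.

(** Collection bounds the values on arguments below l by some b; by monotonicity of pairing the
    graph up to l then lies below ⟨l, b⟩, and it is Delta1. *)
Lemma code_graph (H : N -> N -> Prop) (l : N) : sig2 H -> (forall i, exists! j, H i j) ->
  exists s, finseq s l /\ forall i j, felem ⟨i, j⟩ s <-> i < l /\ H i j.
Proof.
move=> hH u; have [b hb] : exists b, forall i, i < l -> exists j, j < b /\ H i j.
  apply: collection; first exact: sig2_app hH (tm_var _ _) (tm_var _ _).
  by move=> i _; have [j [Hj _]] := u i; exists j.
have [||s [fs hs']] := @code_delta
    (fun z => exists i, i < l /\ exists j, z = ⟨i, j⟩ /\ H i j) (⟨l, b⟩ + 1).
- sig_tac; exact: sig2_app hH (tm_var _ _) (tm_var _ _).
- pose K i j := ~ H i j.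
  apply: (@sig_ext _ (fun e => forall i, i < l -> forall j, j < e 0%N + 1 ->
     (K i j \/ e 0%N <> ⟨i, j⟩))).
    sig_tac; exact: sig2_app (sig_graph_compl hH u) (tm_var _ _) (tm_var _ _).
  move=> e; split=> [h [i [il [j [ez Hj]]]]|h i il j _].
    by case: (h i il j) => //; rewrite ez; apply: pair_ger.
  case: (classic (H i j)) => Hij; last by left.
  by right=> ez; apply: h; exists i; split=> //; exists j.
have hs2 i j : felem ⟨i, j⟩ s <-> i < l /\ H i j.
  rewrite hs'; split=> [[_ [i' [il [j' [/pair_inj [-> ->]]]]]]//|[il Hij]].
  split; last by exists i; split=> //; exists j.
  rewrite ltS; apply: pair_mono; first by left.
  by have [j' [jb Hj']] := hb _ il; have [k [_ uk]] := u i; left; rewrite -(uk _ Hij) (uk _ Hj').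
exists s; split=> //; split=> //.
  by move=> z /hs' [_ [i [il [j [-> _]]]]]; exists i, j.
move=> i il; have [j [Hj uj]] := u i; exists j; split; first by apply/hs2.
by move=> j' /hs2 [_ /uj].
Qed.

(** Of all pairs of a value and a witness for the bounded matrix, the one with the least code is
    chosen. Minimality is a bounded condition, so the choice stays Sigma1. *)
Lemma uniformize (R : N -> N -> N -> Prop) : sig3 R ->
  exists G, [/\ sig3 G, forall s x y, G s x y -> R s x y,
    forall s x y y', G s x y -> G s x y' -> y = y' &
    forall s x y, R s x y -> exists y', G s x y'].
Proof.
move=> [Q [hQ hRQ]].
pose ev (s x y : N) := ecat [:: s; x; y] (fun=> 0).
have RQ s x y : R s x y <-> exists m, Q (econs m (ev s x y)) by apply: (hRQ (ev s x y)).
pose T (u s x : N) := exists y, y < u + 1 /\ exists m, m < u + 1 /\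
  (u = ⟨y, m⟩ /\ Q (econs m (ev s x y))).
have dQ (a b c d : nat) : d0 (fun e => Q (econs (e a) (ev (e b) (e c) (e d)))).
  pose g i : nat + N := match i with
    0 => inl a | 1 => inl b | 2 => inl c | 3 => inl d | _ => inr (l2zero M) end%N.
  by apply: d0_ext (d0_sub g hQ) _ => e; apply: d0_resp hQ _; case=> [|[|[|[|i]]]].
have dT : d0 (fun e => T (e 0%N) (e 1%N) (e 2%N)) by rewrite /T; d0_tac; exact: dQ.
have dT' (a b c : nat) : d0 (fun e => T (e a) (e b) (e c)).
  exact: (d0_ren (fun i => match i with 0 => a | 1 => b | _ => c end%N) dT).
have TP s x y : R s x y <-> exists m, T ⟨y, m⟩ s x.
  rewrite RQ; split=> -[m Hm]; last first.
    by have [y' [_ [m' [_ [/pair_inj [-> _] ?]]]]] := Hm; exists m'.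
  by exists m, y; split; [exact: pair_gel | exists m; split; [exact: pair_ger|]].
pose G s x y := exists m, T ⟨y, m⟩ s x /\ forall u', u' < ⟨y, m⟩ -> ~ T u' s x.
exists G; split.
- rewrite /sig3 /G; sig_tac.
    apply: sig_d0; apply: (@d0_let (fun e u => T u (e 1%N) (e 2%N))); last by d0_tac.
    exact: dT'.
  by d0_tac; apply: dT'.
- by move=> s x y [m [Hm _]]; apply/TP; exists m.
- move=> s x y y' [m [Hm h]] [m' [Hm' h']].
  case: (lt_total ⟨y, m⟩ ⟨y', m'⟩) => [[/h'//|/pair_inj []//]|/h//].
- move=> s x y /TP [m Tm]; have [||u [Tu hu]] := @least (fun u => T u s x).
  + pose g i : nat + N := match i with 0 => inl 0 | 1 => inr s | _ => inr x end%N.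
    by apply: d0_ext (d0_sub g dT) _.
  + by exists ⟨y, m⟩.
  + by have [y' [_ [m' [_ [e _]]]]] := Tu; exists y', m'; rewrite -e.
Qed.

(* After uniformization, approximations are finite sets that contain, with a pair
   ⟨i + 1, y⟩, a predecessor ⟨i, x⟩; any two of them agree where both are defined. *)
Lemma dependent_choice (D : N -> Prop) (R : N -> N -> N -> Prop) (x0 : N) :
  sig1 D -> sig3 R -> D x0 -> (forall s x, D x -> exists y, D y /\ R s x y) ->
  exists H : N -> N -> Prop, [/\ sig2 H, forall s, exists! x, H s x, H 0 x0,
    forall s x, H s x -> D x & forall s x y, H s x -> H (s + 1) y -> R s x y].
Proof.
move=> hD hR D0 step.
(* [D] is joined to the relation so that the uniformization cannot pick a successor outside it. *)
have [|G [hG GR Gu GR']] := @uniformize (fun s x y => D y /\ R s x y).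
  by sig_tac; first apply: sig1_app hD _; tm_step.
pose A w := (forall x, x < w + 1 -> felem ⟨0, x⟩ w -> x = x0) /\
  forall i, i < w + 1 -> forall y, y < w + 1 -> felem ⟨i + 1, y⟩ w ->
    exists x, felem ⟨i, x⟩ w /\ G i x y.
pose H s x := exists w, felem ⟨s, x⟩ w /\ A w.
have hA : sig1 A.
  by rewrite /A; sig_tac; apply: sig3_app hG _ _ _; tm_step.
have hH : sig2 H by rewrite /sig2 /H; sig_tac; apply: sig1_app hA _; tm_step.
have fb (i x w : N) : felem ⟨i, x⟩ w -> i < w + 1 /\ x < w + 1.
  move/felem_lt => h; split; apply: le_lt_trans h; rewrite -ltS; [exact: pair_gel|exact: pair_ger].
have A0 w x : A w -> felem ⟨0, x⟩ w -> x = x0.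
  by move=> [h _] hx; apply: h => //; case: (fb _ _ _ hx).
have AS w i y : A w -> felem ⟨i + 1, y⟩ w -> exists x, felem ⟨i, x⟩ w /\ G i x y.
  move=> [_ h] hx; have [b1 b2] := fb _ _ _ hx; apply: h => //.
  by apply: lt_trans b1; apply: le_refl.
have uniq w w' i : A w -> A w' -> forall x x', felem ⟨i, x⟩ w -> felem ⟨i, x'⟩ w' -> x = x'.
  move=> Aw Aw'; suff K : forall x, x < w + 1 -> forall x', x' < w' + 1 ->
       felem ⟨i, x⟩ w -> felem ⟨i, x'⟩ w' -> x = x'.
    by move=> x x' hx hx'; apply: K => //; [case: (fb _ _ _ hx) | case: (fb _ _ _ hx')].
  move: i; apply: d0_ind.
  - by d0_tac; apply: d0_felem; d0_tac.
  - by move=> x _ x' _ /(A0 _ _ Aw) -> /(A0 _ _ Aw') ->.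
  - move=> i IH y _ y' _ /(AS _ _ _ Aw) [x [hx Gx]] /(AS _ _ _ Aw') [x' [hx' Gx']].
    have exx : x = x' by apply: IH => //; [case: (fb _ _ _ hx) | case: (fb _ _ _ hx')].
    by move: Gx'; rewrite -exx; apply: Gu.
have Hu s x x' : H s x -> H s x' -> x = x'.
  by move=> [w [hw Aw]] [w' [hw' Aw']]; apply: (uniq w w' s).
have HG s x y : H s x -> H (s + 1) y -> G s x y.
  move=> Hx [w [hw Aw]]; have [x' [hx' Gx']] := AS _ _ _ Aw hw.
  by rewrite (Hu _ _ x' Hx) //; exists w.
have [w0 [_ hw0]] : exists w, fincode w /\ forall z, felem z w <-> z < ⟨0, x0⟩ + 1 /\ z = ⟨0, x0⟩.
  by apply: (@code_d0 (fun z => z = ⟨0, x0⟩)); d0_tac.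
have H0 : H 0 x0.
  exists w0; split; first by apply/hw0; split=> //; apply: le_refl.
  split=> [x _ /hw0 [_ /pair_inj []]//|i _ y _ /hw0 [_ /pair_inj [/(ax_succ_neq0 (rca0_basic hM))]]//].
have HD : forall s, exists x, D x /\ H s x.
  apply: sig_ind; first by sig_tac; apply: sig2_app hH _ _; tm_step.
    by exists x0.
  move=> s [x [Dx [w [hx Aw]]]].
  have [y0 Ry0] := step s x Dx; have [y Gy] := GR' s x y0 Ry0.
  exists y; split; first by case: (GR _ _ _ Gy).
  have [w' [_ hw']] : exists w', fincode w' /\ forall z, felem z w' <->
      z < w + ⟨s + 1, y⟩ + 1 /\ (felem z w \/ z = ⟨s + 1, y⟩).
    by apply: (@code_d0 (fun z => felem z w \/ z = ⟨s + 1, y⟩)); d0_tac.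
  have {}hw' z : felem z w' <-> felem z w \/ z = ⟨s + 1, y⟩.
    rewrite hw'; split=> [[]//|h]; split=> //.
    case: h => [/felem_lt|->]; last by rewrite ltS leP; exists w; ring.
    by rewrite !ltS' => -[k ->]; exists (k + ⟨s + 1, y⟩); ring.
  exists w'; split; first by apply/hw'; right.
  split=> [x' _ /hw' [/(A0 _ _ Aw)//|/pair_inj [/esym/(ax_succ_neq0 (rca0_basic hM))]]//|].
  move=> i _ y' _ /hw' [/(AS _ _ _ Aw) [x' [hx' Gx']]|/pair_inj [ei ->]].
    by exists x'; split=> //; apply/hw'; left.
  exists x; rewrite (addIx ei); split=> //.
  by apply/hw'; left.
exists H; split=> //.
- by move=> s; have [x [_ Hx]] := HD s; exists x; split=> // x'; apply: Hu.
- by move=> s x Hx; have [x' [Dx' Hx']] := HD s; rewrite (Hu _ _ _ Hx Hx').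
- by move=> s x y Hx Hy; case: (GR _ _ _ (HG _ _ _ Hx Hy)).
Qed.

(** * Powers of two *)

Lemma pow2_fun : exists H : N -> N -> Prop, [/\ sig2 H, forall s, exists! x, H s x, H 0 1,
  forall s x y, H s x -> H (s + 1) y -> y = x + x & forall k y, H k y -> pow2 k y].
Proof.
have [||//||H [hH Hu H0 _ HS]] := @dependent_choice (fun _ => True) (fun _ x y => y = x + x) 1.
- by apply: sig_d0; apply: (@d0_ext _ (fun e : env => (0 : N) = 0)); [d0_tac | ].
- by rewrite /sig3; sig_tac.
- by move=> _ x _; exists (x + x).
exists H; split=> //; move=> k y Hy.
have [s [fs hs']] := code_graph (k + 1) hH Hu.
exists s; split=> //.
- by apply/hs'; split=> //; apply: lt_0S.
- move=> i z ik /hs' [_ Hz]; apply/hs'; split; first by move: ik; rewrite !ltP => -[d ->]; exists d; ring.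
  by have [z' [Hz' _]] := Hu (i + 1); rewrite -(HS _ _ _ Hz Hz').
- by apply/hs'; split=> //; apply: le_refl.
Qed.

Lemma finseq_fun (s l i j j' : N) : finseq s l -> felem ⟨i, j⟩ s -> felem ⟨i, j'⟩ s -> j = j'.
Proof.
move=> [_ h1 h2] h h'; have [i' [j0 [/pair_inj [ei _] il]]] := h1 _ h.
by rewrite -ei in il; have [k [_ uk]] := h2 i il; rewrite -(uk _ h) -(uk _ h').
Qed.

Lemma finseq_lt (s l i : N) : finseq s l -> i < l <-> exists j, felem ⟨i, j⟩ s.
Proof.
move=> [_ h1 h2]; split=> [/h2 [j [hj _]]|[j /h1 [i' [j' [/pair_inj [-> _]]]]]//].
by exists j.
Qed.

Lemma pow2_val (H : N -> N -> Prop) k y y' : sig2 H -> (forall s, exists! x, H s x) ->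
  H 0 1 -> (forall s x y, H s x -> H (s + 1) y -> y = x + x) -> pow2 k y -> H k y' -> y = y'.
Proof.
move=> hH Hu H0 HS [s [fs s0 sS sk]].
have : forall i, i < k + 1 -> exists x, H i x /\ felem ⟨i, x⟩ s.
  apply: sig_ind.
  - by sig_tac; apply: sig2_app hH _ _; tm_step.
  - by exists 1.
  - move=> i IH hi; have ik : i < k by move: hi; rewrite !ltP => -[d /addIx ->]; exists d; ring.
    have [x [Hx hx]] := IH (ltW ik); have [x' [Hx' _]] := Hu (i + 1).
    by exists x'; split=> //; rewrite (HS _ _ _ Hx Hx'); apply: sS.
move=> /(_ k (le_refl _)) [x [Hx hx]] Hy'.
have [z [_ uz]] := Hu k; rewrite -(uz _ Hy') (uz _ Hx).
exact: finseq_fun fs sk hx.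
Qed.

Lemma pow2_spec : exists H : N -> N -> Prop, [/\ forall k y, pow2 k y <-> H k y, sig2 H,
  forall s, exists! x, H s x, H 0 1 & forall s x y, H s x -> H (s + 1) y -> y = x + x].
Proof.
have [H [hH Hu H0 HS Hp]] := pow2_fun; exists H; split=> // k y; split=> [p2|/Hp//].
by have [y' [Hy' _]] := Hu k; rewrite (pow2_val hH Hu H0 HS p2 Hy').
Qed.

Lemma sig_pow2 : sig2 (@pow2 M).
Proof. by have [H [e hH _ _ _]] := pow2_spec; apply: sig_ext hH _ => v; rewrite e. Qed.

Lemma pow2_ex (k : N) : exists y, pow2 k y.
Proof. by have [H [e _ u _ _]] := pow2_spec; have [y [/e]] := u k; exists y. Qed.

Lemma pow2_uniq (k y y' : N) : pow2 k y -> pow2 k y' -> y = y'.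
Proof.
have [H [e _ u _ _]] := pow2_spec; have [z [_ uz]] := u k.
by move=> /e/uz <- /e/uz <-.
Qed.

Lemma pow2_0 : pow2 (0 : N) 1.
Proof. by have [H [e _ _ H0 _]] := pow2_spec; apply/e. Qed.

Lemma pow2_S (k y : N) : pow2 k y -> pow2 (k + 1) (y + y).
Proof.
have [H [e _ u _ HS]] := pow2_spec; move=> /e Hy; apply/e.
by have [z [Hz _]] := u (k + 1); rewrite -(HS _ _ _ Hy Hz).
Qed.

Lemma pow2_gt (k y : N) : pow2 k y -> k < y.
Proof.
move: k y; suff H : forall k : N, exists y, pow2 k y /\ k < y.
  by move=> k y p2; have [y' [p2' h]] := H k; rewrite (pow2_uniq p2 p2').
apply: sig_ind; first by sig_tac; apply: sig2_app sig_pow2 _ _; tm_step.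
  by exists 1; split; [exact: pow2_0 | rewrite ltP; exists 0; ring].
move=> k [y [/pow2_S p2]]; rewrite ltP => -[d ey]; exists (y + y); split=> //.
by rewrite ltP ey; exists (k + d + d); ring.
Qed.

(** * Reals and submeasures *)

Section Reals.
Implicit Types a b q r : qrep M.

Notation frac p d := (QRep p 0 d).

Lemma addIle (x y z : N) : x + z <= y + z -> x <= y.
Proof. by rewrite !leP => -[k e]; exists k; apply: (@addIx _ _ z); rewrite e; ring. Qed.

Lemma mul_neq0 (x y : N) : x <> 0 -> y <> 0 -> x * y <> 0.
Proof.
case: (zero_or_succ x) => // -[x' ->] _; case: (zero_or_succ y) => // -[y' ->] _.
have -> : (x' + 1) * (y' + 1) = (x' * y' + x' + y') + 1 by ring.
exact: ax_succ_neq0 (rca0_basic hM) _.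
Qed.

Lemma qle_refl a : qle a a.
Proof. by rewrite /qle; right; ring. Qed.

Lemma qle_trans b a (c : qrep M) : qden b <> 0 -> qle a b -> qle b c -> qle a c.
Proof.
rewrite /qle !leP => b0 [k ek] [l el]; rewrite -leP; apply: (mulIle b0).
apply: (@addIle _ _ (qneg b * qden a * qden c + qpos b * qden c * qden a)).
rewrite leP; exists (k * qden c + l * qden a).
transitivity ((qpos b * qden a + qneg a * qden b) * qden c + (qpos c * qden b + qneg b * qden c) * qden a).
  by ring.
by rewrite ek el; ring.
Qed.

Lemma qle_add a b (c d : qrep M) : qle a b -> qle c d -> qle (qadd a c) (qadd b d).
Proof.
rewrite /qle /qadd /= !leP => -[k ek] [l el].
exists (k * qden c * qden d + l * qden a * qden b).
transitivity ((qpos b * qden a + qneg a * qden b) * qden c * qden d +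
              (qpos d * qden c + qneg c * qden d) * qden a * qden b); first by ring.
by rewrite ek el; ring.
Qed.

Lemma qadd_den a b : qden a <> 0 -> qden b <> 0 -> qden (qadd a b) <> 0.
Proof. exact: mul_neq0. Qed.

Lemma qle_step a b (c e e' : qrep M) : qden b <> 0 -> qden e <> 0 ->
  qle a (qadd b e) -> qle b (qadd c e') -> qle a (qadd (qadd c e') e).
Proof.
move=> b0 e0 h h'; apply: qle_trans h _; first exact: qadd_den.
by apply: qle_add => //; apply: qle_refl.
Qed.

(** If a > b, the difference is at least 1 / (qden a * qden b), and K / y is smaller than that as
    soon as y exceeds K * qden b * qden a. *)
Lemma qle_arch a b (K : N) : qden a <> 0 -> qden b <> 0 ->
  (forall i : N, exists y, i < y /\ qle a (qadd b (frac K y))) -> qle a b.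
Proof.
move=> a0 b0 h; rewrite /qle; apply: NNPP; rewrite nle ltP => -[k ek].
have [y [ly]] := h (K * qden b * qden a); rewrite /qle /qadd /= leP => -[l el].
case: (lt_irr (x := K * qden b * qden a)); apply: lt_le_trans ly _.
rewrite leP; exists (k * y + l); apply: (@addIx _ _ ((qpos b * qden a + qneg a * qden b) * y)).
transitivity ((qpos b * y + K * qden b) * qden a + qneg a * (qden b * y)); first by ring.
rewrite el.
transitivity ((qpos a * qden b + qneg b * qden a) * y + l); first by ring.
by rewrite ek; ring.
Qed.

Lemma pow2_neq0 (k y : N) : pow2 k y -> y <> 0.
Proof. by move=> /pow2_gt h e; move: h; rewrite e => /lt0. Qed.

Lemma rle_refl (x : rseq M) : is_real x -> rle x x.
Proof.
move=> [u _ _] k q r y xq xr p2; have [z [_ uz]] := u k.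
by rewrite -(uz _ xr) (uz _ xq) /qle /qadd /= leP; exists ((1 + 1) * qden q * qden q); ring.
Qed.

Lemma rle_trans (x y z : rseq M) : is_real x -> is_real y -> is_real z ->
  rle x y -> rle y z -> rle x z.
Proof.
move=> [ux dx cx] [uy dy cy] [uz dz cz] xy yz k q s w xq zs pw.
have w0 := pow2_neq0 pw.
(* The detour through the terms of index k + i costs 2^-k twice, which is the slack allowed by
   [rle], and 2 * 2^-(k + i) twice. The latter is 4 over a power of two that grows with i. *)
apply: (@qle_arch _ _ ((1 + 1) * (1 + 1))).
- exact: dx xq.
- by apply: qadd_den => //=; apply: dz zs.
move=> i.
have [w' pw'] := pow2_ex (k + i); have w'0 := pow2_neq0 pw'.
exists w'; split; first by apply: le_lt_trans (pow2_gt pw'); rewrite leP; exists k; ring.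
have [q' [xq' _]] := ux (k + i); have [r' [yr' _]] := uy (k + i); have [s' [zs' _]] := uz (k + i).
have h1 : qle q (qadd q' (frac 1 w)) by case: (cx k i q q' w).
have h2 : qle q' (qadd r' (frac (1 + 1) w')) by apply: (xy (k + i)).
have h3 : qle r' (qadd s' (frac (1 + 1) w')) by apply: (yz (k + i)).
have h4 : qle s' (qadd s (frac 1 w)) by case: (cz k i s s' w).
have n1 := dx _ _ xq'; have n2 := dy _ _ yr'; have n3 := dz _ _ zs'; have n4 := dz _ _ zs.
have h := qle_step n2 (w'0 : qden (frac (1 + 1) w') <> 0) h2 h3.
have {}h := qle_step n1 (w0 : qden (frac 1 w) <> 0) h1 h.
have {}h : qle q (qadd (qadd (qadd (qadd s (frac 1 w)) (frac (1 + 1) w')) (frac (1 + 1) w')) (frac 1 w)).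
  apply: qle_trans h _; first by do !apply: qadd_den.
  by do 3!(apply: qle_add; last exact: qle_refl).
apply: qle_trans h _; first by do !apply: qadd_den.
by rewrite /qle /qadd /=; right; ring.
Qed.

Lemma qle_frac1 (k y : N) : y <> 0 -> qle (frac k y) (frac k 1).
Proof.
by case: (zero_or_succ y) => // -[y' ->] _; rewrite /qle /= leP; exists (k * y'); ring.
Qed.

Lemma qle_fracD (x y : N) : qle (qadd (frac x 1) (frac y 1)) (frac (x + y) 1).
Proof. by rewrite /qle /qadd /=; right; ring. Qed.

Lemma qle_pos q : qden q <> 0 -> qle q (frac (qpos q) 1).
Proof.
by case: (zero_or_succ (qden q)) => // -[y' e] _; rewrite /qle /= e leP; exists (qpos q * y' + qneg q); ring.
Qed.

(** By monotonicity and subadditivity, mu(A below n) <= mu(X below n) + mu(A below l), and the last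
    summand does not depend on n. *)
Lemma infinite_tail (mu A X : set2 M) (l : N) : is_submeasure mu -> mu_infinite mu A ->
  (forall i, i ∈ A -> i < l \/ i ∈ X) -> mu_infinite mu X.
Proof.
move=> hmu infA AX [m hm]; apply: infA.
have [c0 [fc0 hc0]] := code_set A l.
have [u0 d0 cr0] := sm_real hmu fc0.
have [q0 [hq0 _]] := u0 0.
(* [m + 2] bounds the terms at [c1], with slack 2 from [rle]; [qpos q0 + 1] bounds those at [c0],
   which stay within 1 of the term of index 0; the last 2 is the slack in subadditivity. *)
exists (m + (1 + 1) + (qpos q0 + 1) + (1 + 1)) => n c fc hc.
have [c1 [fc1 hc1]] := code_set X n.
have [z [fz hz]] : exists z, fincode z /\ forall i,
    felem i z <-> i < c0 + c1 + 1 /\ (felem i c0 \/ felem i c1).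
  by apply: (@code_d0 (fun i => felem i c0 \/ felem i c1)); d0_tac.
have {}hz i : felem i z <-> (felem i c1 \/ felem i c0).
  rewrite hz; split; first by tauto.
  move=> h; split; last by tauto.
  case: h => /felem_lt; rewrite !ltS' => -[k ->]; [exists (k + c0)|exists (k + c1)]; ring.
have [h1 _ _] : [/\ rle (mval mu c) (mval mu z), rle (mval mu z) (mval mu z) &
    rle (mval mu z) (radd (mval mu c) (mval mu z))].
  apply: (sm_union hmu) => // i; split; first by right.
  move=> [] //; rewrite hc hz hc1 hc0 => -[iA il].
  by case: (AX i iA); tauto.
have [_ _ h2] := sm_union hmu fc1 fc0 fz hz.
have h3 : rle (mval mu c1) (rnat m).
  by apply: (hm n) => // i; rewrite hc1; tauto.
move=> k q r y cq -> py; have y0 := pow2_neq0 py.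
have [uz dz _] := sm_real hmu fz; have [zk [hzk _]] := uz k; have dzk := dz _ _ hzk.
have [u1 d1 _] := sm_real hmu fc1; have [q1 [hq1 _]] := u1 (k + 1); have dq1 := d1 _ _ hq1.
have [q2 [hq2 _]] := u0 (k + 1); have dq2 := d0 _ _ hq2.
have dq0 := d0 _ _ hq0.
have py2 : pow2 (k + 1) (y + y) by exact: pow2_S.
have y20 := pow2_neq0 py2.
have one0 : (1 : N) <> 0 by exact: one_neq0.
have b1 : qle q1 (frac (m + (1 + 1)) 1).
  apply: qle_trans (h3 _ _ _ _ hq1 (erefl _) py2) _; first by rewrite /qadd /=; apply: mul_neq0.
  apply: qle_trans (qle_add (qle_refl _) (qle_frac1 _ y20)) (qle_fracD _ _).
  by rewrite /qadd /=; apply: mul_neq0.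
have b2 : qle q2 (frac (qpos q0 + 1) 1).
  have hq2' : mval mu c0 (0 + (k + 1)) q2 by rewrite add0x.
  have [_ h] := cr0 _ _ _ _ _ hq0 hq2' pow2_0.
  apply: qle_trans h _; first by apply: qadd_den.
  apply: qle_trans (qle_add (qle_pos dq0) (qle_refl _)) (qle_fracD _ _).
  by rewrite /qadd /=; apply: mul_neq0.
have b3 : qle zk (frac (m + (1 + 1) + (qpos q0 + 1) + (1 + 1)) 1).
  have hr : radd (mval mu c1) (mval mu c0) k (qadd q1 q2) by exists q1, q2.
  apply: qle_trans (h2 _ _ _ _ hzk hr py) _; first by do !apply: qadd_den.
  apply: qle_trans (qle_fracD _ _); first by do !apply: qadd_den.
  apply: qle_add (qle_frac1 _ y0).
  by apply: qle_trans (qle_add b1 b2) (qle_fracD _ _); do !apply: qadd_den.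
apply: qle_trans (h1 _ _ _ _ cq hzk py) _; first by do !apply: qadd_den.
by apply: qle_add => //; apply: qle_refl.
Qed.

(** A violation of [rle] shows at a single index, so a search can wait for a finite set of large
    submeasure. *)
Lemma sig_big (mu : set2 M) : sig2 (fun (c m : N) => ~ rle (mval mu c) (rnat m)).
Proof.
apply: (@sig_ext _ (fun e => exists k, exists p, exists n, exists d : N, exists y,
  ⟨⟨e 0%N, k⟩, ⟨⟨p, n⟩, d⟩⟩ ∈ mu /\ (pow2 k y /\
   ~ (p * (1 * y) + (0 * y + 0 * 1) * d <= (e 1%N * y + (1 + 1) * 1) * d + n * (1 * y))))).
  by sig_tac; apply: sig2_app sig_pow2 _ _; tm_step.
move=> e; split.
  move=> [k [p [n [d [y [h [py hq]]]]]]] H; apply: hq.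
  exact: (H k (QRep p n d) (frac (e 1%N) 1) y h (erefl _) py).
move=> H; apply: NNPP => H'; apply: H => k [p n d] r y h -> py.
by apply: NNPP => hq; apply: H'; exists k, p, n, d, y.
Qed.

Lemma mu_le_refl (mu : set2 M) : is_submeasure mu -> mu_le mu mu.
Proof. by move=> h c fc; apply: rle_refl; apply: sm_real. Qed.

Lemma mu_le_trans (mu nu la : set2 M) : is_submeasure mu -> is_submeasure nu ->
  is_submeasure la -> mu_le la nu -> mu_le nu mu -> mu_le la mu.
Proof.
move=> h1 h2 h3 h h' c fc; apply: rle_trans (h c fc) (h' c fc); exact: sm_real.
Qed.

End Reals.

(** * Conditions and strings *)

Implicit Types (p q r : condition M) (X Y : set2 M) (t : N).

Lemma charfun_ex X (i : N) : exists! j, charfun X i j.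
Proof.
case: (classic (i ∈ X)) => iX.
  by exists 1; split=> [|j [[_ ->]|[]]//]; left.
by exists 0; split=> [|j [[]|[_ ->]]//]; right.
Qed.

Lemma charfun_uniq X (i j j' : N) : charfun X i j -> charfun X i j' -> j = j'.
Proof. by have [k [_ uk]] := charfun_ex X i; move=> /uk <- /uk <-. Qed.

Lemma restriction X (l : N) : exists t, [/\ binstr t, finseq t l & str_prefix t X].
Proof.
have [|t [ft ht]] := @code_graph (charfun X) l _ (charfun_ex X).
  by rewrite /charfun; sig_tac; d0_tac.
exists t; split=> //; last by move=> i j /ht [].
split; first by exists l.
by move=> i j /ht [_ [[_ ->]|[_ ->]]]; [right|left].
Qed.

Lemma prefix_sub X t t' l l' : finseq t l -> finseq t' l' -> l <= l' ->
  str_prefix t X -> str_prefix t' X -> fsub t t'.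
Proof.
move=> ft ft' ll' pt pt' z hz; have [_ h1 _] := ft.
have [i [j [ez il]]] := h1 _ hz; rewrite ez in hz *.
have [j' hj'] := proj1 (finseq_lt _ ft') (lt_le_trans il ll').
by rewrite (charfun_uniq (pt _ _ hz) (pt' _ _ hj')).
Qed.

Lemma common_prefix X t t' : binstr t -> binstr t' -> str_prefix t X -> str_prefix t' X ->
  exists t'', [/\ binstr t'', str_prefix t'' X, fsub t t'' & fsub t' t''].
Proof.
move=> [[l ft] _] [[l' ft'] _] pt pt'; have [t'' [bt'' ft'' pt'']] := restriction X (l + l').
exists t''; split=> //.
  by apply: (prefix_sub ft ft'' _ pt pt''); rewrite leP; exists l'.
by apply: (prefix_sub ft' ft'' _ pt' pt''); rewrite leP; exists l; ring.
Qed.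

(** The set follows t on its domain and the reservoir beyond it. So it contains all but a bounded
    part of the reservoir and keeps infinite submeasure. *)
Lemma U_set p t : in_U t p -> exists X, [/\ fsub_set (stem p) X, set_sub X (reservoir p),
  str_prefix t X & mu_infinite (smeas p) X].
Proof.
move=> [[[l ft] bt] h1 h2].
have [|X hX] := @d0_comprehension (fun i => felem ⟨i, 1⟩ t \/ (i ∈ reservoir p /\ ~ i < l)).
  by d0_tac.
exists X; split.
- move=> i hi; apply/hX; case: (classic (i < l)) => il; last by right; split=> //; apply: stem_sub.
  by left; apply: h1 => //; apply/(finseq_lt _ ft).
- by move=> i /hX [/h2|[]].
- move=> i j hij; case: (bt _ _ hij) => ej; rewrite ej in hij *; last by left; split=> //; apply/hX; left.
  right; split=> // /hX [h|[_]]; first by case: one_neq0; apply: finseq_fun ft h hij.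
  by apply; apply/(finseq_lt _ ft); exists 0.
- apply: (@infinite_tail _ _ _ l (smeas_sub p) (@reservoir_inf _ p)) => i iA.
  by case: (classic (i < l)); [left | right; apply/hX; right].
Qed.

Lemma prefix_U p X t : fsub_set (stem p) X -> set_sub X (reservoir p) -> binstr t ->
  str_prefix t X -> in_U t p.
Proof.
move=> h1 h2 bt pt; split=> // [i /h1 iX [j hj]|i /pt [[iX _]|[_ /one_neq0]]//]; last exact: h2.
by move: (hj); case: (pt _ _ hj) => [[_ ->]|[]].
Qed.

Lemma U_ext p q t : extends q p -> in_U t q -> in_U t p.
Proof.
move=> [h1 h2 h3 _] [bt k1 k2]; split=> // [i /h1|i /k2]; [exact: k1 | exact: h3].
Qed.

Lemma U_binstr p t : in_U t p -> binstr t. Proof. by case. Qed.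

Lemma extends_refl p : extends p p.
Proof. by split=> //; [exact: stem_sub | apply: mu_le_refl; apply: smeas_sub]. Qed.

Lemma extends_trans p q r : extends r q -> extends q p -> extends r p.
Proof.
move=> [h1 h2 h3 h4] [k1 k2 k3 k4]; split.
- by move=> i /k1 /h1.
- by move=> i /h2 /k3.
- by move=> i /h3 /k3.
- by apply: mu_le_trans h4 k4; apply: smeas_sub.
Qed.

Lemma U_inhabited p : exists t, in_U t p.
Proof.
have [t [bt _ pt]] := restriction (reservoir p) 0; exists t.
by apply: (@prefix_U _ (reservoir p)) => //; apply: stem_sub.
Qed.

(* [t] is an initial segment of every element of [[a, A, mu]]. *)
Definition below t r : Prop :=
  (forall i, felem ⟨i, 1⟩ t -> felem i (stem r)) /\
  (forall i, felem ⟨i, 0⟩ t -> ~ i ∈ reservoir r).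

Lemma below_ext r r' t : extends r' r -> below t r -> below t r'.
Proof. by move=> [h1 _ h3 _] [k1 k2]; split=> [i /k1 /h1//|i /k2 h /h3]. Qed.

Lemma below_prefix r t X : binstr t -> below t r -> fsub_set (stem r) X ->
  set_sub X (reservoir r) -> str_prefix t X.
Proof.
move=> [_ bt] [k1 k2] h1 h2 i j hij; case: (bt _ _ hij) => ej; rewrite ej in hij *.
  by right; split=> // /h2; apply: k2.
by left; split=> //; apply/h1/k1.
Qed.

(** The reservoir shrinks to a set with initial segment t, and the stem grows to a finite part of
    this set that is long enough to contain the old stem and the ones of t. *)
Lemma cond_below q t : in_U t q -> exists r, extends r q /\ below t r.
Proof.
move=> ut; have [X [h1 h2 pt iX]] := U_set ut.
have [b [fb hb]] := code_set X (stem q + t + 1).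
have bX : fsub_set b X by move=> i /hb [].
exists (Condition fb bX (smeas_sub q) iX); split.
  split=> //=; last by apply: mu_le_refl; apply: smeas_sub.
    move=> i hi; apply/hb; split; last exact: h1.
    by move/felem_lt: hi; rewrite !ltS' => -[k ->]; exists (k + t); ring.
  by move=> i /bX /h2.
split=> i hi /=; last by case: (pt _ _ hi) => [[_ /esym/one_neq0]|[]].
apply/hb; split; last by case: (pt _ _ hi) => [[]//|[_ /one_neq0]].
apply: le_lt_trans (_ : ⟨i, 1⟩ < _); first by rewrite -ltS; apply: pair_gel.
by move/felem_lt: hi; rewrite !ltS' => -[k ->]; exists (k + stem q); ring.
Qed.

(** A set between stem and reservoir that starts with [t'] also starts with t, so one of its initial
    segments extends both. *)
Lemma amalgamation r t t' : binstr t -> below t r -> in_U t' r ->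
  exists t'', [/\ in_U t'' r, fsub t t'' & fsub t' t''].
Proof.
move=> bt btr ut'; have [X [h1 h2 pt' _]] := U_set ut'.
have [t'' [bt'' pt'' s s']] := common_prefix bt (U_binstr ut') (below_prefix bt btr h1 h2) pt'.
by exists t''; split=> //; apply: prefix_U h1 h2 bt'' pt''.
Qed.

Lemma d0_in_U q f : tm f -> d0 (fun e : env => in_U (f e) q).
Proof.
move=> hf; apply: (@d0_ext _ (fun e => binstr (f e) /\
  ((forall i, i < stem q + 1 -> felem i (stem q) ->
     (exists j, j < f e + 1 /\ felem ⟨i, j⟩ (f e)) -> felem ⟨i, 1⟩ (f e)) /\
   (forall i, i < f e + 1 -> felem ⟨i, 1⟩ (f e) -> i ∈ reservoir q)))); first by d0_tac.
have lt (i j t : N) : felem ⟨i, j⟩ t -> i < t + 1 /\ j < t + 1.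
  move/felem_lt => h; split; apply: le_lt_trans h; rewrite -ltS; [exact: pair_gel|exact: pair_ger].
move=> e; split=> [[bt [h1 h2]]|[bt h1 h2]]; split=> //.
- move=> i hi [j hj]; apply: h1 => //; first exact: felem_lt.
  by exists j; split=> //; case: (lt _ _ _ hj).
- by move=> i hi; apply: h2 => //; case: (lt _ _ _ hi).
- by split=> [i _ hi [j [_ hj]]|i _]; [apply: h1 => //; exists j | exact: h2].
Qed.

Ltac d0_extra ::= first
  [ apply: d0_dvd2 | apply: d0_felem | apply: d0_fincode | apply: d0_finseq
  | apply: d0_binstr | apply: d0_fsub | apply: d0_in_U ].

(** * Names *)

Definition val1 (e : env) (s : nat + N) : N := match s with inl j => e j | inr c => c end.

Lemma ecat_nth (s : seq N) (e : env) z i : (i < size s)%N -> ecat s e i = nth z s i.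
Proof. by elim: s i => //= x s IH [|i] //= /IH. Qed.

Lemma ecat_tnth k (x : k.-tuple N) (e : env) (i : 'I_k) : ecat x e i = tnth x i.
Proof. by rewrite (ecat_nth e (tnth x i)) ?size_tuple // -tnth_nth. Qed.

Lemma ecat_tuple_ge k (x : k.-tuple N) (e : env) i : ecat x e (k + i)%N = e i.
Proof. by apply: ecat_ge; rewrite size_tuple. Qed.

Lemma mktuple_tnth k (x : k.-tuple N) : [tuple tnth x i | i < k] = x.
Proof. by apply: eq_from_tnth => i; rewrite tnth_mktuple. Qed.

Lemma cons_mktuple k c (F : 'I_k -> N) : [tuple of c :: [tuple F i | i < k]] =
  [tuple if unlift ord0 i is Some j then F j else c | i < k.+1].
Proof.
apply: eq_from_tnth => i; rewrite tnth_mktuple; case: unliftP => [j ->|->].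
  by rewrite tnthS tnth_mktuple.
by rewrite tnth0.
Qed.

(** Passes from [Sigma1_class], with its fixed order of string, value and arguments, to relations in
    which each of these places holds a variable or a constant. *)
Lemma sig_name k (F : rname M k) (g : 'I_k -> nat + N) a b : Sigma1_class F ->
  sig (fun e => F (val1 e a) [tuple val1 e (g i) | i < k] (val1 e b)).
Proof.
move=> [phi [e0 [E hF]]].
pose up (s : nat + N) : nat + N := if s is inl j then inl j.+1 else s.
pose G i : nat + N := match i with 0 => inl 0%N | 1 => up a | 2 => up b
  | j.+3 => if insub j is Some i then up (g i) else inr (e0 (j - k)%N) end%N.
exists (fun e => bsat (esub G e) E phi); split; first exact: (d0_bsat phi E G).
move=> e; rewrite hF /sat_Sigma1.
set x := [tuple _ | _ < k]; have xE j : tnth x j = val1 e (g j) by rewrite tnth_mktuple.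
have H m i : econs m (ecat (val1 e a :: val1 e b :: x) e0) i = esub G (econs m e) i.
  have upE (s : nat + N) : val1 e s = match up s with inl j => econs m e j | inr c => c end by case: s.
  case: i => [|[|[|i]]]; [by [] | exact: upE | exact: upE |].
  change (ecat x e0 i = esub G (econs m e) i.+3); rewrite /esub /G.
  case: insubP => [j _ <-|]; first by rewrite ecat_tnth xE upE.
  by rewrite -leqNgt => /subnKC {1}<-; rewrite ecat_tuple_ge.
by split=> -[m Hm]; exists m; move: Hm; rewrite (bsat_ext phi E (H m)).
Qed.

Lemma sig_name_cons k (F : rname M k.+1) (g : 'I_k -> nat + N) a b c : Sigma1_class F ->
  sig (fun e => F (val1 e a) [tuple of val1 e c :: [tuple val1 e (g i) | i < k]] (val1 e b)).
Proof.
move=> hF.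
apply: sig_ext (sig_name (fun i => if unlift ord0 i is Some j then g j else c) a b hF) _ => e.
rewrite cons_mktuple.
suff -> : [tuple val1 e (if unlift ord0 i is Some j then g j else c) | i < k.+1] =
  [tuple if unlift ord0 i is Some j then val1 e (g j) else val1 e c | i < k.+1] by [].
by apply: eq_from_tnth => i; rewrite !tnth_mktuple; case: unlift.
Qed.

Lemma sig_name_at k (F : rname M k.+1) (x : k.-tuple N) a b c : Sigma1_class F ->
  sig (fun e => F (val1 e a) [tuple of val1 e c :: x] (val1 e b)).
Proof.
move=> hF; apply: sig_ext (sig_name_cons (fun i => inr (tnth x i)) a b c hF) _ => e.
by have -> : [tuple val1 e (inr (tnth x i)) | i < k] = x := mktuple_tnth x.
Qed.

Lemma sig_class k (F : rname M k) :
  sig (fun e => F (e 0%N) [tuple e i.+2 | i < k] (e 1%N)) -> Sigma1_class F.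
Proof.
move=> /(sig_Sigma1 k.+2) [phi [e0 [E h]]]; exists phi, e0, E => t x y.
rewrite -h /=; last by rewrite size_tuple.
suff -> : [tuple ecat x (fun=> 0) i | i < k] = x by [].
by apply: eq_from_tnth => i; rewrite tnth_mktuple ecat_tnth.
Qed.

(** The length l is standard, so a quantifier over tuples is an external iteration of number
    quantifiers. *)
Lemma sig_ex_tuple l (P : env -> Prop) : sig P ->
  sig (fun e => exists y : l.-tuple N, P (ecat y e)).
Proof.
elim: l P => [|l IH] P hP.
  by apply: sig_ext hP _ => e; split=> [|[y]]; [exists [tuple] | rewrite tuple0].
apply: sig_ext (IH (fun e => exists x, P (econs x e)) _) _ => [|e].
  by apply: sig_ex; apply: sig_ext (hP) _ => e; apply: sig_resp hP _; case.
split=> [[y [x Px]]|[y]]; first by exists [tuple of x :: y].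
by case/tupleP: y => x y Px; exists y, x.
Qed.

Lemma sig_all (I : eqType) (s : seq I) (P : I -> env -> Prop) : (forall i, sig (P i)) ->
  sig (fun e => forall i, i \in s -> P i e).
Proof.
move=> hP; elim: s => [|j s IH].
  by apply: (@sig_ext _ (fun=> (0 : N) = 0)) => //; sig_tac.
apply: sig_ext (sig_and (hP j) IH) _ => e; split.
  by move=> [h1 h2] i; rewrite inE => /orP [/eqP ->|/h2].
by move=> h; split=> [|i hi]; apply: h; rewrite inE ?eqxx // hi orbT.
Qed.

Definition dense p k (F : rname M k) : Prop := forall q, extends q p ->
  forall x t, in_U t q -> exists t' y, [/\ in_U t' q, fsub t t' & F t' x y].

Record good p k (F : rname M k) : Prop :=
  Good { good_name : is_name F; good_dense : dense p F }.

Lemma good_ext p q k (F : rname M k) : extends q p -> good p F -> good q F.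
Proof. by move=> qp [h1 h2]; split=> // r rq; apply: h2; apply: extends_trans rq qp. Qed.

Lemma dense_all p l k (G : 'I_l -> rname M k) : (forall i, good p (G i)) ->
  forall q, extends q p -> forall x t, in_U t q ->
  exists t' (y : l.-tuple N), [/\ in_U t' q, fsub t t' & forall i, G i t' x (tnth y i)].
Proof.
move=> hG q qp x t ut.
have [t' [ut' tt' h]] : exists t', [/\ in_U t' q, fsub t t' &
    forall i, i \in enum 'I_l -> exists y, G i t' x y].
  elim: (enum 'I_l) => [|j s [t1 [ut1 tt1 h1]]]; first by exists t; split.
  have [t2 [y [ut2 t12 hy]]] := good_dense (hG j) qp x ut1; exists t2; split=> //.
    by move=> i /tt1 /t12.
  move=> i; rewrite inE => /orP [/eqP ->|/h1 [y' hy']]; first by exists y.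
  by exists y'; apply: (name_mono (good_name (hG i)) hy' (U_binstr ut2)).
have [|f hf] := @fin_all_exists _ (fun=> N) (fun i y => G i t' x y).
  by move=> i; apply: h; rewrite mem_enum.
by exists t', [tuple f i | i < l]; split=> // i; rewrite tnth_mktuple.
Qed.

Lemma name_ncomp k l (F : rname M l) (G : 'I_l -> rname M k) :
  is_name F -> (forall i, is_name (G i)) -> is_name (ncomp F G).
Proof.
move=> hF hG; split.
- by move=> t x z [y [_ /(name_str hF)]].
- apply: sig_class.
  pose P e := (forall i : 'I_l, G i (e l) [tuple e (l + j.+2)%N | j < k] (e i)) /\
              F (e l) [tuple e i | i < l] (e l.+1).
  apply: sig_ext (@sig_ex_tuple l P _) _ => [|e].
    apply: sig_and.
      apply: sig_ext (@sig_all _ (enum 'I_l)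
        (fun i e => G i (e l) [tuple e (l + j.+2)%N | j < k] (e i)) _) _ => [i|e].
        exact: (sig_name (fun j : 'I_k => inl (l + j.+2)%N) (inl l) (inl (i : nat)) (name_Sigma1 (hG i))).
      by split=> h i; [apply: h; rewrite mem_enum | move=> _; apply: h].
    exact: (sig_name (fun j : 'I_l => inl (j : nat)) (inl l) (inl l.+1) (name_Sigma1 hF)).
  have eE (y : l.-tuple N) : P (ecat y e) <->
      (forall i, G i (e 0%N) [tuple e j.+2 | j < k] (tnth y i)) /\ F (e 0%N) y (e 1%N).
    rewrite /P; have -> : ecat y e l = e 0%N by rewrite -{2}(addn0 l) ecat_tuple_ge.
    have -> : ecat y e l.+1 = e 1%N by rewrite -(addn1 l) ecat_tuple_ge.
    have -> : [tuple ecat y e i | i < l] = y.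
      by apply: eq_from_tnth => i; rewrite tnth_mktuple ecat_tnth.
    have -> : [tuple ecat y e (l + j.+2) | j < k] = [tuple e j.+2 | j < k].
      by apply: eq_from_tnth => i; rewrite !tnth_mktuple ecat_tuple_ge.
    by split=> -[h hy]; split=> // i; have := h i; rewrite ecat_tnth.
  by split=> -[y hy]; exists y; apply/eE.
- move=> t t' x z [y [hy Fz]] bt' tt'; exists y; split=> [i|].
    exact: (name_mono (hG i) (hy i) bt' tt').
  exact: (name_mono hF Fz bt' tt').
- move=> t x z z' [y [hy Fz]] [y' [hy' Fz']].
  suff e : y = y' by move: Fz'; rewrite -e; apply: (name_fun hF) Fz.
  by apply: eq_from_tnth => i; apply: (name_fun (hG i)) (hy i) (hy' i).
Qed.

Lemma good_ncomp p k l (F : rname M l) (G : 'I_l -> rname M k) :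
  good p F -> (forall i, good p (G i)) -> good p (ncomp F G).
Proof.
move=> hF hG; split; first by apply: name_ncomp => [|i]; [apply: good_name hF | apply: good_name (hG i)].
move=> q qp x t ut.
have [t1 [y [ut1 tt1 h1]]] := dense_all hG qp x ut.
have [t2 [z [ut2 t12 h2]]] := good_dense hF qp y ut1.
exists t2, z; split=> //; first by move=> i /tt1 /t12.
exists y; split=> // i; apply: (name_mono (good_name (hG i)) (h1 i)) => //; exact: U_binstr ut2.
Qed.

Record gfun k (f : k.-tuple N -> N -> Prop) : Prop := GFun {
  gfun_sig : sig (fun e => f [tuple e i.+1 | i < k] (e 0%N));
  gfun_fun : forall x y y', f x y -> f x y' -> y = y';
  gfun_tot : forall x, exists y, f x y }.

Lemma good_canon p k (f : k.-tuple N -> N -> Prop) : gfun f -> good p (canon f).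
Proof.
move=> [sf ff tf]; split.
  split.
  - by move=> t x y [].
  - apply: sig_class; rewrite /canon; apply: sig_and; first by sig_tac.
    exact: (sig_ren (fun i => if i is j.+1 then j.+2 else 1%N) sf).
  - by move=> t t' x y [_ h].
  - by move=> t x y y' [_ h] [_ h']; apply: ff h h'.
move=> q qp x t ut; have [y hy] := tf x; exists t, y; split=> //.
by split=> //; apply: U_binstr ut.
Qed.

(** The values below y have to be decided and differ from 1. Merely asking that they are not yet
    decided as 1 would be neither Sigma1 nor persistent under longer strings. *)
Definition minN k (T : rname M k.+1) : rname M k := fun t x y =>
  T t [tuple of y :: x] 1 /\ forall y', y' < y -> exists z, z <> 1 /\ T t [tuple of y' :: x] z.

Lemma good_minN p k (T : rname M k.+1) : good p T ->
  (forall q, extends q p -> forall (x : k.-tuple N) t, in_U t q ->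
     exists t' y, [/\ in_U t' q, fsub t t' & T t' [tuple of y :: x] 1]) ->
  good p (minN T).
Proof.
move=> [hT dT] h; split.
  split.
  - by move=> t x y [/(name_str hT)].
  - apply: sig_class; rewrite /minN; sig_tac.
      exact: (sig_name_cons (fun i : 'I_k => inl i.+2) (inl 0%N) (inr 1) (inl 1%N) (name_Sigma1 hT)).
    exact: (sig_name_cons (fun i : 'I_k => inl i.+4) (inl 2%N) (inl 0%N) (inl 1%N) (name_Sigma1 hT)).
  - move=> t t' x y [h1 h2] bt' tt'; split; first exact: (name_mono hT) h1 bt' tt'.
    by move=> y' /h2 [z [z1 hz]]; exists z; split=> //; exact: (name_mono hT) hz bt' tt'.
  - move=> t x y y' [h1 h2] [h1' h2'].
    have nlt y1 y2 : T t [tuple of y1 :: x] 1 ->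
        (forall y', y' < y2 -> exists z, z <> 1 /\ T t [tuple of y' :: x] z) -> ~ y1 < y2.
      by move=> k1 k2 /k2 [z [z1 hz]]; apply: z1; apply: (name_fun hT) hz k1.
    by case: (lt_total y y') => [[/(nlt _ _ h1 h2')//|//]|/(nlt _ _ h1' h2)].
move=> q qp x t ut; have [t1 [y [ut1 tt1 Ty]]] := h q qp x t ut.
(* The bound y may be nonstandard, so the string that decides all values below it comes from an
   induction inside the model; the statement is Sigma1. *)
have H : forall n, exists t', in_U t' q /\ (fsub t1 t' /\
    forall y', y' < n -> exists z, T t' [tuple of y' :: x] z).
  apply: sig_ind.
  - sig_tac.
    exact: (sig_name_at x (inl 2%N) (inl 0%N) (inl 1%N) (name_Sigma1 hT)).
  - by exists t1; split=> //; split=> // y' /lt0.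
  - move=> n [t2 [ut2 [t12 h2]]].
    have [t3 [z [ut3 t23 hz]]] := dT q qp [tuple of n :: x] t2 ut2.
    exists t3; split=> //; split; first by move=> i /t12 /t23.
    move=> y'; rewrite ltS => -[/h2 [z' hz']|->]; last by exists z.
    by exists z'; apply: (name_mono hT) hz' (U_binstr ut3) t23.
have [t2 [ut2 [t12 h2]]] := H y.
have {}Ty := name_mono hT Ty (U_binstr ut2) t12.
suff [y0 hy0] : exists y0, minN T t2 x y0.
  by exists t2, y0; split=> // i /tt1 /t12.
(* On [t2] a failure is again a Sigma1 statement, a decided value other than 1. Without a least
   success, failure below n propagates up to n = y, and y itself would be least. *)
apply: NNPP => nmin.
have P : forall n, n < y + 1 -> forall y', y' < n -> exists z, z <> 1 /\ T t2 [tuple of y' :: x] z.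
  apply: sig_ind.
  - sig_tac.
    exact: (sig_name_at x (inr t2) (inl 0%N) (inl 1%N) (name_Sigma1 hT)).
  - by move=> _ y' /lt0.
  - move=> n IH; rewrite ltS => hn.
    have ny : n < y by apply: lt_le_trans hn; apply: le_refl.
    move=> y'; rewrite ltS => -[/(IH (ltW ny))//|->].
    have [z hz] := h2 n ny; exists z; split=> // z1; apply: nmin; exists n.
    by split; [rewrite -z1 | apply: IH; apply: ltW].
by apply: nmin; exists y; split=> //; apply: P; apply: le_refl.
Qed.

(** * Locality as density *)

Definition is_pair (s : N) : Prop :=
  exists a, a < s + 1 /\ exists b, b < s + 1 /\ s = ⟨a, b⟩.

(* The projections of the pairing function, with value 0 outside its range. *)
Definition pfst (s a : N) : Prop :=
  (exists b, b < s + 1 /\ s = ⟨a, b⟩) \/ (~ is_pair s /\ a = 0).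

Definition psnd (s b : N) : Prop :=
  (exists a, a < s + 1 /\ s = ⟨a, b⟩) \/ (~ is_pair s /\ b = 0).

Lemma is_pair_pair (a b : N) : is_pair ⟨a, b⟩.
Proof. by exists a; split; [exact: pair_gel | exists b; split=> //; exact: pair_ger]. Qed.

Lemma sig_pfst : sig2 pfst.
Proof. by rewrite /pfst /is_pair; sig_tac; d0_tac. Qed.

Lemma sig_psnd : sig2 psnd.
Proof. by rewrite /psnd /is_pair; sig_tac; d0_tac. Qed.

Lemma pfst_pair (a b c : N) : pfst ⟨a, b⟩ c <-> c = a.
Proof.
split; last by move=> ->; left; exists b; split=> //; exact: pair_ger.
by case=> [[b' [_ /pair_inj []]]//|[/(_ (is_pair_pair _ _))]].
Qed.

Lemma psnd_pair (a b c : N) : psnd ⟨a, b⟩ c <-> c = b.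
Proof.
split; last by move=> ->; left; exists a; split=> //; exact: pair_gel.
by case=> [[b' [_ /pair_inj []]]//|[/(_ (is_pair_pair _ _))]].
Qed.

Lemma pfst_ex (s : N) : exists a, pfst s a.
Proof.
case: (classic (is_pair s)) => [[a [_ [b [_ ->]]]]|h]; first by exists a; apply/pfst_pair.
by exists 0; right.
Qed.

Lemma psnd_ex (s : N) : exists a, psnd s a.
Proof.
case: (classic (is_pair s)) => [[a [_ [b [_ ->]]]]|h]; first by exists b; apply/psnd_pair.
by exists 0; right.
Qed.

Lemma pfst_fun (s a b : N) : pfst s a -> pfst s b -> a = b.
Proof.
case: (classic (is_pair s)) => [[a' [_ [b' [_ ->]]]]|h]; first by move=> /pfst_pair -> /pfst_pair ->.
have K c : pfst s c -> c = 0.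
  case=> [[d [_ e]]|[]//]; case: h; rewrite e; exact: is_pair_pair.
by move=> /K -> /K ->.
Qed.

Lemma psnd_fun (s a b : N) : psnd s a -> psnd s b -> a = b.
Proof.
case: (classic (is_pair s)) => [[a' [_ [b' [_ ->]]]]|h]; first by move=> /psnd_pair -> /psnd_pair ->.
have K c : psnd s c -> c = 0.
  case=> [[d [_ e]]|[]//]; case: h; rewrite e; exact: is_pair_pair.
by move=> /K -> /K ->.
Qed.

(** Since the projections are total, each number decodes to exactly one tuple of each length. This
    enumerates the arguments of a name by stages. *)
Fixpoint decode (x : seq N) (s : N) : Prop :=
  if x is a :: x' then pfst s a /\ exists s', psnd s s' /\ decode x' s' else True.

Lemma decode_total k (s : N) : exists x : k.-tuple N, decode x s.
Proof.
elim: k s => [|k IH] s; first by exists [tuple].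
have [a ha] := pfst_ex s; have [s' hs'] := psnd_ex s; have [x hx] := IH s'.
by exists [tuple of a :: x]; split=> //; exists s'.
Qed.

Lemma decode_surj (x : seq N) : exists s, decode x s.
Proof.
elim: x => [|a x [s hs']]; first by exists 0.
exists ⟨a, s⟩; split; first by apply/pfst_pair.
by exists s; split=> //; apply/psnd_pair.
Qed.

Lemma decode_fun (x x' : seq N) s : size x = size x' -> decode x s -> decode x' s -> x = x'.
Proof.
elim: x x' s => [|a x IH] [|a' x'] s //= [e] [ha [u [hu dx]]] [ha' [u' [hu' dx']]].
by rewrite (pfst_fun ha ha') (IH x' u) // (psnd_fun hu hu').
Qed.

Lemma sig_decode (idx : seq nat) (r : nat -> nat) a :
  sig (fun e : env => decode [seq e (r i) | i <- idx] (e a)).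
Proof.
elim: idx r a => [|i idx IH] r a.
  by apply: (@sig_ext _ (fun=> (0 : N) = 0)) => //; sig_tac.
rewrite /=; sig_tac.
- by apply: sig2_app sig_pfst _ _; tm_step.
- by apply: sig2_app sig_psnd _ _; tm_step.
- exact: (IH (succn \o r) 0%N).
Qed.

(** Locality is applied at a condition that makes t an initial segment of all its sets. The set in
    the domain of F found there starts with t, and some longer initial segment decides F(x). *)
Lemma local_good p k (F : rname M k) : is_name F -> local_name p F -> good p F.
Proof.
move=> hF lF; split=> // q qp x t ut; have [r [rq btr]] := cond_below ut.
have [X [[h1 h2 _] /(_ x) [t1 [y [pt1 Ft1]]]]] := lF _ (extends_trans rq qp).
have pt := below_prefix (U_binstr ut) btr h1 h2.
have [t' [bt' pt' s s1]] := common_prefix (U_binstr ut) (name_str hF Ft1) pt pt1.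
exists t', y; split=> //; last exact: (name_mono hF Ft1 bt' s1).
by apply: U_ext rq _; apply: prefix_U h1 h2 bt' pt'.
Qed.

Lemma U_longer q t (l : N) : in_U t q -> exists t' l',
  [/\ in_U t' q, fsub t t', finseq t' l' & l <= l'].
Proof.
move=> ut; have [X [h1 h2 pt _]] := U_set ut; have [[l0 ft] _] := U_binstr ut.
have [t' [bt' ft' pt']] := restriction X (l0 + l).
exists t', (l0 + l); split=> //; last by rewrite leP; exists l0; ring.
  exact: prefix_U h1 h2 bt' pt'.
by apply: prefix_sub ft ft' _ pt pt'; rewrite leP; exists l.
Qed.

(* [t] forces that a finite part of the generic set has large submeasure. *)
Definition large (mu : set2 M) (s t : N) : Prop :=
  exists n c, [/\ fincode c, (forall i, i < n -> exists j, felem ⟨i, j⟩ t),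
    (forall i, i < c + 1 -> felem i c -> i < n /\ felem ⟨i, 1⟩ t),
    (forall i, i < n -> felem ⟨i, 1⟩ t -> felem i c) & ~ rle (mval mu c) (rnat s)].

Lemma sig_large (mu : set2 M) : sig2 (large mu).
Proof.
pose big (c m : N) := ~ rle (mval mu c) (rnat m).
apply: (@sig_ext _ (fun e => exists n c, fincode c /\
   ((forall i, i < n -> exists j, j < e 1%N + 1 /\ felem ⟨i, j⟩ (e 1%N)) /\
   ((forall i, i < c + 1 -> felem i c -> i < n /\ felem ⟨i, 1⟩ (e 1%N)) /\
   ((forall i, i < n -> felem ⟨i, 1⟩ (e 1%N) -> felem i c) /\ big c (e 0%N)))))).
  by sig_tac; apply: (sig2_app (sig_big mu)); tm_step.
move=> e; split=> -[n [c]].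
  by move=> [h1 [h2 [h3 [h4 h5]]]]; exists n, c; split=> // i /h2 [j [_ hj]]; exists j.
move=> [h1 h2 h3 h4 h5]; exists n, c; do !split=> //.
move=> i /h2 [j hj]; exists j; split=> //; apply: le_lt_trans (felem_lt hj).
by rewrite -ltS; apply: pair_ger.
Qed.

Lemma large_dense q t s : in_U t q -> exists t', [/\ in_U t' q, fsub t t' & large (smeas q) s t'].
Proof.
move=> ut; have [X [h1 h2 pt iX]] := U_set ut.
have [n [c [fc [hc big]]]] : exists n c, fincode c /\ ((forall i, felem i c <-> i ∈ X /\ i < n) /\
    ~ rle (mval (smeas q) c) (rnat s)).
  apply: NNPP => h; apply: iX; exists s => n c fc hc; apply: NNPP => nr; apply: h.
  by exists n, c.
have [[l0 ft] _] := U_binstr ut.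
have [t' [bt' ft' pt']] := restriction X (l0 + n).
have le : l0 <= l0 + n by rewrite leP; exists n.
have D i : i < n -> exists j, felem ⟨i, j⟩ t'.
  move=> il; apply/(finseq_lt _ ft'); apply: lt_le_trans il _.
  by rewrite leP; exists l0; ring.
exists t'; split; [exact: prefix_U h1 h2 bt' pt' | exact: prefix_sub ft ft' le pt pt' |].
exists n, c; split=> //.
- move=> i _ /hc [iX' il]; split=> //; have [j hj] := D i il.
  by move: (hj); case: (pt' _ _ hj) => [[_ ->]|[]].
- by move=> i il /pt' [[iX' _]|[_ /one_neq0]] //; apply/hc.
Qed.

Lemma large_infinite (mu X : set2 M) :
  (forall s, exists t, str_prefix t X /\ large mu s t) -> mu_infinite mu X.
Proof.
move=> h [m hm]; have [t [pt [n [c [fc h1 h2 h3 big]]]]] := h m; apply: big; apply: (hm n) => // i.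
split=> [hi|[iX il]].
  have [il hi1] := h2 i (felem_lt hi) hi; split=> //.
  by case: (pt _ _ hi1) => [[]//|[_ /one_neq0]].
have [j hj] := h1 i il; apply: h3 => //; move: (hj).
by case: (pt _ _ hj) => [[_ ->]|[]].
Qed.

(** The string chosen at stage s decides F at the tuple coded by s, is defined at s, and shows that
    the submeasure exceeds s. Each requirement is dense and Sigma1, so [dependent_choice]
    applies. *)
Lemma good_local p k (F : rname M k) : good p F -> local_name p F.
Proof.
move=> [hF dF] q qp.
have [t0 ut0] := U_inhabited q.
pose R (s t t' : N) := fsub t t' /\ ((exists x : k.-tuple N, decode x s /\ exists y, F t' x y) /\
  ((exists j, felem ⟨s, j⟩ t') /\ large (smeas q) s t')).
have sR : sig3 R.
  rewrite /R; sig_tac.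
  - pose P e := decode [seq e i | i <- [seq val i | i <- enum 'I_k]] (e k) /\
      exists y, F (e k.+2) [tuple e i | i < k] y.
    apply: sig_ext (@sig_ex_tuple k P _) _ => [|e].
      rewrite /P; sig_tac; first exact: (sig_decode _ id).
      exact: (sig_name (fun i : 'I_k => inl i.+1) (inl k.+3) (inl 0%N) (name_Sigma1 hF)).
    have PE (x : k.-tuple N) : P (ecat x e) <-> decode x (e 0%N) /\ exists y, F (e 2%N) x y.
      rewrite /P; have -> : ecat x e k = e 0%N by rewrite -{2}(addn0 k) ecat_tuple_ge.
      have -> : ecat x e k.+2 = e 2%N by rewrite -(addn2 k) ecat_tuple_ge.
      have e1 : [tuple ecat x e i | i < k] = x.
        by apply: eq_from_tnth => i; rewrite tnth_mktuple ecat_tnth.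
      by rewrite -map_comp -[X in decode X _]/(val [tuple ecat x e i | i < k]) e1.
    by split=> -[x /PE hx]; exists x.
  - exact: sig2_app (sig_large (smeas q)) (tm_var _ _) (tm_var _ _).
have [|s t ut|H [hH uH H0 HU HR]] := @dependent_choice (fun t => in_U t q) R t0 _ sR ut0.
- by sig_tac.
- have [x hx] := decode_total k s.
  have [t1 [y [ut1 tt1 Ft1]]] := dF _ qp x t ut.
  have [t2 [l' [ut2 t12 ft2 sl]]] := U_longer (s + 1) ut1.
  have [t3 [ut3 t23 lt3]] := large_dense s ut2.
  exists t3; split=> //; split; first by move=> i /tt1 /t12 /t23.
  split; first by exists x; split=> //; exists y; apply: (name_mono hF Ft1 (U_binstr ut3)) => i /t12 /t23.
  split=> //; have [j hj] : exists j, felem ⟨s, j⟩ t2.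
    by apply/(finseq_lt _ ft2); apply: lt_le_trans sl; apply: le_refl.
  by exists j; apply: t23.
have Hex s : exists t, H s t by have [t [ht _]] := uH s; exists t.
have mono s d t : H s t -> exists t', H (s + d) t' /\ fsub t t'.
  move=> Ht; move: d; apply: sig_ind.
  - by sig_tac; apply: sig2_app hH _ _; d0_tac.
  - by exists t; rewrite add0; split=> // i.
  - move=> d [t' [Ht' tt']]; have [t'' Ht''] := Hex (s + d + 1).
    exists t''; rewrite addA; split=> // i /tt'.
    by have [h _] := HR _ _ _ Ht' Ht''; apply: h.
(* Strings of two stages are compared at the stage s + s', which extends both. *)
have cons s s' t t' i j j' : H s t -> H s' t' -> felem ⟨i, j⟩ t -> felem ⟨i, j'⟩ t' -> j = j'.
  move=> Ht Ht' h h'.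
  have [u [Hu tu]] := mono _ s' _ Ht; have [u' [Hu' tu']] := mono _ s _ Ht'.
  have eu : u = u'.
    by have [v [_ uv]] := uH (s + s'); rewrite -(uv _ Hu); apply: uv; rewrite addC.
  have [[l fl] _] := U_binstr (HU _ _ Hu).
  by apply: finseq_fun fl (tu _ h) _; rewrite eu; apply: tu'.
have bits s t i j : H s t -> felem ⟨i, j⟩ t -> j = 0 \/ j = 1.
  by move=> /HU /U_binstr [_ b]; apply: b.
have [||X hX] := @comprehension (fun n => exists s t, H s t /\ felem ⟨n, 1⟩ t).
- by sig_tac; apply: sig2_app hH _ _; tm_step.
(* Every position is eventually in the domain of a string, so not receiving 1 means receiving 0;
   this makes the union Delta1. *)
- apply: (@sig_ext _ (fun e => exists s t, H s t /\ felem ⟨e 0%N, 0⟩ t)).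
    by sig_tac; apply: sig2_app hH _ _; tm_step.
  move=> e; split.
    move=> [s [t [Ht h]]] [s' [t' [Ht' h']]].
    by case: one_neq0; apply: cons Ht' Ht h' h.
  move=> h; have [t Ht] := Hex (e 0%N); have [t' Ht'] := Hex (e 0%N + 1).
  have [_ [_ [[j hj] _]]] := HR _ _ _ Ht Ht'; exists (e 0%N + 1), t'; split=> //.
  case: (bits _ _ _ _ Ht' hj) => ej; rewrite ej in hj; first by [].
  by case: h; exists (e 0%N + 1), t'.
have pX s t : H s t -> str_prefix t X.
  move=> Ht i j hij; case: (bits _ _ _ _ Ht hij) => ej; rewrite ej in hij *.
    right; split=> // /hX [s' [t' [Ht' h']]].
    by case: one_neq0; apply: cons Ht' Ht h' hij.
  by left; split=> //; apply/hX; exists s, t.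
exists X; split; first split.
- move=> i hi; have [t Ht] := Hex i; have [t' Ht'] := Hex (i + 1).
  have [_ [_ [hj _]]] := HR _ _ _ Ht Ht'; have [_ h1 _] := HU _ _ Ht'.
  by apply/hX; exists (i + 1), t'; split=> //; apply: h1.
- by move=> i /hX [s [t [/HU [_ _ h]]]]; apply: h.
- apply: large_infinite => s; have [t Ht] := Hex s; have [t' Ht'] := Hex (s + 1).
  have [_ [_ [_ h]]] := HR _ _ _ Ht Ht'; exists t'; split=> //; exact: pX Ht'.
- move=> x; have [s hs'] := decode_surj x; have [t Ht] := Hex s; have [t' Ht'] := Hex (s + 1).
  have [_ [[x' [hx' [y Fy]]] _]] := HR _ _ _ Ht Ht'.
  have e : x' = x by apply: val_inj; apply: decode_fun hx' hs'; rewrite !size_tuple.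
  by exists t', y; split; [exact: pX Ht' | rewrite -e].
Qed.

(** * Operations on names *)

Lemma tm_tnth k (r : nat -> nat) (a : 'I_k) : tm (fun e : env => tnth [tuple e (r i) | i < k] a).
Proof.
have [t [c h]] := tm_var M (r a); exists t, c => e.
by rewrite h tnth_mktuple.
Qed.

Ltac tm_extra ::= first [apply: (tm_tnth succn) | apply: (tm_tnth (fun i => i.+2))].

Definition chi k (P : k.-tuple N -> Prop) (x : k.-tuple N) (y : N) : Prop :=
  (P x /\ y = 1) \/ (~ P x /\ y = 0).

Lemma gfun_chi k (P : k.-tuple N -> Prop) : d0 (fun e => P [tuple e i.+1 | i < k]) -> gfun (chi P).
Proof.
move=> hP; split.
- by rewrite /chi; sig_tac; d0_tac.
- by move=> x y y' [[? ->]|[? ->]] [[? ->]|[? ->]].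
- by move=> x; case: (classic (P x)) => h; [exists 1; left | exists 0; right].
Qed.

Lemma gfun_tm k (g : k.-tuple N -> N) : tm (fun e => g [tuple e i.+1 | i < k]) ->
  gfun (fun x y => y = g x).
Proof.
move=> hg; split; [by sig_tac; d0_tac; exact: hg | by move=> x y y' -> -> | by move=> x; exists (g x)].
Qed.

Lemma gfun_app k (f : N -> N -> Prop) (a : 'I_k) : sig2 f ->
  (forall x y y', f x y -> f x y' -> y = y') -> (forall x, exists y, f x y) ->
  gfun (fun (x : k.-tuple N) y => f (tnth x a) y).
Proof.
move=> sf ff tf; split; [|by move=> x y y'; apply: ff | by move=> x; apply: tf].
by apply: sig2_app sf _ _; tm_step.
Qed.

Definition pcons k l (a : 'I_k) (s : 'I_l -> 'I_k) (i : 'I_l.+1) : 'I_k :=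
  if unlift ord0 i is Some j then s j else a.

Definition up1 k (i : 'I_k) : 'I_k.+1 := lift ord0 i.

Definition selN k l (F : rname M l) (s : 'I_l -> 'I_k) : rname M k :=
  fun t x z => F t [tuple tnth x (s i) | i < l] z.

Definition bindN k (G : rname M k) (F : rname M k.+1) : rname M k :=
  fun t x z => exists y, G t x y /\ F t [tuple of y :: x] z.

Definition caseN k (P : k.-tuple N -> Prop) (F G : rname M k) : rname M k :=
  fun t x z => (P x /\ F t x z) \/ (~ P x /\ G t x z).

Lemma sel_pcons k l (x : k.-tuple N) a (s : 'I_l -> 'I_k) :
  [tuple tnth x (pcons a s i) | i < l.+1] = [tuple of tnth x a :: [tuple tnth x (s i) | i < l]].
Proof.
rewrite cons_mktuple; apply: eq_from_tnth => i; rewrite !tnth_mktuple /pcons.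
by case: unlift.
Qed.

Lemma sel_up k l (x : k.-tuple N) y (s : 'I_l -> 'I_k) :
  [tuple tnth [tuple of y :: x] (up1 (s i)) | i < l] = [tuple tnth x (s i) | i < l].
Proof. by apply: eq_from_tnth => i; rewrite !tnth_mktuple /up1 tnthS. Qed.

Lemma tnth_up k (x : k.-tuple N) y (i : 'I_k) : tnth [tuple of y :: x] (up1 i) = tnth x i.
Proof. exact: tnthS. Qed.

Lemma good_sel p k l (F : rname M l) (s : 'I_l -> 'I_k) : good p F -> good p (selN F s).
Proof.
move=> [hF dF]; split; last by move=> q qp x t ut; apply: dF.
split.
- by move=> t x y; apply: (name_str hF).
- apply: sig_class.
  apply: sig_ext (sig_name (fun i => inl (s i).+2) (inl 0%N) (inl 1%N) (name_Sigma1 hF)) _ => e.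
  rewrite /selN; suff -> : [tuple val1 e (inl (s i).+2) | i < l] =
    [tuple tnth [tuple e j.+2 | j < k] (s i) | i < l] by [].
  by apply: eq_from_tnth => i; rewrite !tnth_mktuple.
- by move=> t t' x y; apply: (name_mono hF).
- by move=> t x y y'; apply: (name_fun hF).
Qed.

Lemma good_bind p k (G : rname M k) (F : rname M k.+1) : good p G -> good p F -> good p (bindN G F).
Proof.
move=> [hG dG] [hF dF]; split; last first.
  move=> q qp x t ut; have [t1 [y [ut1 tt1 Gy]]] := dG q qp x t ut.
  have [t2 [z [ut2 t12 Fz]]] := dF q qp [tuple of y :: x] t1 ut1.
  exists t2, z; split=> //; first by move=> i /tt1 /t12.
  by exists y; split=> //; apply: (name_mono hG Gy (U_binstr ut2)).
split.
- by move=> t x z [y [/(name_str hG)]].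
- apply: sig_class; rewrite /bindN; sig_tac.
    exact: (sig_name (fun i : 'I_k => inl i.+3) (inl 1%N) (inl 0%N) (name_Sigma1 hG)).
  exact: (sig_name_cons (fun i : 'I_k => inl i.+3) (inl 1%N) (inl 2%N) (inl 0%N) (name_Sigma1 hF)).
- move=> t t' x z [y [Gy Fz]] bt' tt'; exists y.
  by split; [apply: (name_mono hG Gy) | apply: (name_mono hF Fz)].
- move=> t x z z' [y [Gy Fz]] [y' [Gy' Fz']].
  by rewrite -(name_fun hG Gy Gy') in Fz'; apply: (name_fun hF Fz Fz').
Qed.

Lemma good_case p k (P : k.-tuple N -> Prop) (F G : rname M k) :
  d0 (fun e => P [tuple e i.+1 | i < k]) -> good p F -> good p G -> good p (caseN P F G).
Proof.
move=> hP [hF dF] [hG dG]; split; last first.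
  move=> q qp x t ut; case: (classic (P x)) => Px.
    by have [t1 [y [ut1 tt1 Fy]]] := dF q qp x t ut; exists t1, y; split=> //; left.
  by have [t1 [y [ut1 tt1 Gy]]] := dG q qp x t ut; exists t1, y; split=> //; right.
split.
- by move=> t x y [[_ /(name_str hF)]|[_ /(name_str hG)]].
- apply: sig_class; rewrite /caseN; sig_tac.
  + by apply: sig_d0; exact: (d0_ren succn hP).
  + exact: (sig_name (fun i : 'I_k => inl i.+2) (inl 0%N) (inl 1%N) (name_Sigma1 hF)).
  + exact: (d0_ren succn hP).
  + exact: (sig_name (fun i : 'I_k => inl i.+2) (inl 0%N) (inl 1%N) (name_Sigma1 hG)).
- move=> t t' x z [[Px Fz]|[Px Fz]] bt' tt'; [left | right]; split=> //.
    exact: (name_mono hF Fz).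
  exact: (name_mono hG Fz).
- move=> t x z z' [[Px h]|[Px h]] [[Px' h']|[Px' h']] //.
    exact: (name_fun hF h h').
  exact: (name_fun hG h h').
Qed.

Lemma good_nproj p k (i : 'I_k) : good p (@nproj M k i).
Proof. by apply: good_canon; apply: gfun_tm; tm_step. Qed.

Lemma good_warg p n k (W : rname M n.+1) (f : k.-tuple N -> N -> Prop) (g : 'I_n -> 'I_k) :
  gfun f -> good p W -> good p (warg W f g).
Proof.
move=> hf hW; apply: good_ncomp => // i; rewrite /scons.
by case: unlift => [j|]; [apply: good_nproj | apply: good_canon].
Qed.

Lemma wargP n k (W : rname M n.+1) (f : k.-tuple N -> N -> Prop) (g : 'I_n -> 'I_k) t x z :
  warg W f g t x z -> exists u, f x u /\ W t [tuple of u :: [tuple tnth x (g i) | i < n]] z.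
Proof.
move=> [y [h Wz]]; case/tupleP: y h Wz => u y h Wz; exists u; split.
  by have := h ord0; rewrite /scons unlift_none tnth0 => -[].
suff -> : [tuple tnth x (g i) | i < n] = y by [].
apply: eq_from_tnth => i; rewrite tnth_mktuple.
by have := h (lift ord0 i); rewrite /scons liftK tnthS => -[].
Qed.

Lemma wevenP n (W : rname M n.+1) t u (x : n.-tuple N) z :
  weven W t [tuple of u :: x] z -> W t [tuple of (1 + 1) * u :: x] z.
Proof. by move=> /wargP [v [->]]; rewrite (sel_up _ _ id) mktuple_tnth tnth0. Qed.

Lemma woddP n (W : rname M n.+1) t u (x : n.-tuple N) z :
  wodd W t [tuple of u :: x] z -> W t [tuple of (1 + 1) * u + 1 :: x] z.
Proof. by move=> /wargP [v [->]]; rewrite (sel_up _ _ id) mktuple_tnth tnth0. Qed.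

Lemma wsectP n (W : rname M n.+1) t u w (x : n.-tuple N) z :
  wsect W t [tuple of u :: [tuple of w :: x]] z -> W t [tuple of ⟨w, u⟩ :: x] z.
Proof.
move=> /wargP [v [->]]; rewrite (sel_up _ _ (lift ord0)) (sel_up _ _ id) mktuple_tnth.
by rewrite tnthS !tnth0.
Qed.

Lemma wtailP n (W : rname M n.+1) t u w (x : n.-tuple N) z :
  wtail W t [tuple of u :: [tuple of w :: x]] z -> W t [tuple of u + 1 :: x] z.
Proof.
move=> /wargP [v [->]]; rewrite (sel_up _ _ (lift ord0)) (sel_up _ _ id) mktuple_tnth.
by rewrite !tnth0.
Qed.

Lemma wheadP n (W : rname M n.+1) t (x : n.-tuple N) z :
  whead W t x z -> W t [tuple of 0 :: x] z.
Proof. by move=> /wargP [v [->]]; rewrite mktuple_tnth. Qed.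

Lemma good_weven p n (W : rname M n.+1) : good p W -> good p (weven W).
Proof. by move=> hW; apply: good_warg => //; apply: gfun_tm; do !tm_step. Qed.

Lemma good_wodd p n (W : rname M n.+1) : good p W -> good p (wodd W).
Proof. by move=> hW; apply: good_warg => //; apply: gfun_tm; do !tm_step. Qed.

Lemma good_wsect p n (W : rname M n.+1) : good p W -> good p (wsect W).
Proof. by move=> hW; apply: good_warg => //; apply: gfun_tm; do !tm_step. Qed.

Lemma good_wtail p n (W : rname M n.+1) : good p W -> good p (wtail W).
Proof. by move=> hW; apply: good_warg => //; apply: gfun_tm; do !tm_step. Qed.

Lemma good_whead p n (W : rname M n.+1) : good p W -> good p (whead W).
Proof. by move=> hW; apply: good_warg => //; apply: gfun_tm; do !tm_step. Qed.

Lemma good_nweak p n (G : rname M n) : good p G -> good p (nweak G).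
Proof. by move=> hG; apply: good_ncomp => // i; apply: good_nproj. Qed.

Lemma nweakP n (G : rname M n) t w (x : n.-tuple N) z :
  nweak G t [tuple of w :: x] z -> G t x z.
Proof.
move=> [y [h Gz]]; suff -> : x = y by [].
by apply: eq_from_tnth => i; have [_ ->] := h i; rewrite tnthS.
Qed.

(** * Halves and predecessors *)

Definition is_even (u : N) : Prop := exists h, h < u + 1 /\ u = (1 + 1) * h.

Definition half (u h : N) : Prop := u = (1 + 1) * h \/ u = (1 + 1) * h + 1.

Lemma double_inj (a b : N) : (1 + 1) * a = (1 + 1) * b -> a = b.
Proof.
have K (x y : N) : x < y -> (1 + 1) * x < (1 + 1) * y.
  by rewrite !ltP => -[k ->]; exists (k + k + 1); ring.
move=> e; case: (lt_total a b) => [[/K|//]|/K]; by rewrite e => /lt_irr.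
Qed.

Lemma odd_not_even (a b : N) : (1 + 1) * a + 1 <> (1 + 1) * b.
Proof.
case: (lt_total b a) => [/leP [k ->]|/ltP [k ->]] e.
  by apply: (@lt_irr ((1 + 1) * b)); rewrite -{2}e ltP; exists (k + k); ring.
by apply: (@lt_irr ((1 + 1) * a + 1)); rewrite {2}e ltP; exists (k + k); ring.
Qed.

Lemma half_fun (u h h' : N) : half u h -> half u h' -> h = h'.
Proof.
move=> [-> | ->] [e|e]; [exact: double_inj | by case: (odd_not_even (esym e)) |
  by case: (odd_not_even e) |].
by apply/double_inj/(addIx (k := 1)).
Qed.

Lemma half_ex (u : N) : exists h, half u h.
Proof.
move: u; apply: sig_ind; first by rewrite /half; sig_tac; d0_tac.
  by exists 0; left; ring.
move=> u [h [->|->]]; first by exists h; right.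
by exists (h + 1); left; ring.
Qed.

Lemma is_evenP (u : N) : is_even u <-> exists h, u = (1 + 1) * h.
Proof.
split=> [[h [_ ->]]|[h ->]]; exists h => //; split=> //.
by rewrite ltS'; exists h; ring.
Qed.

Definition predecessor (u v : N) : Prop := u = v + 1 \/ (u = 0 /\ v = 0).

Lemma predecessor_fun (u v w : N) : predecessor u v -> predecessor u w -> v = w.
Proof.
have n0 (x : N) : x + 1 <> 0 by apply: ax_succ_neq0 (rca0_basic hM) _.
move=> [-> |[-> ->]] [|[]//]; first exact: addIx.
  by move/n0.
by move/esym/n0.
Qed.

Lemma predecessor_ex (u : N) : exists v, predecessor u v.
Proof.
by case: (zero_or_succ u) => [->|[v ->]]; [exists 0; right | exists v; left].
Qed.

(** * Names for truth values and Skolem functions *)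

Section Skolem_names.
Variable p : condition M.

Definition i0 k : 'I_k.+1 := ord0.
Definition i1 k : 'I_k.+2 := up1 ord0.
Definition i2 k : 'I_k.+3 := up1 (up1 ord0).
Definition i3 k : 'I_k.+4 := up1 (up1 (up1 ord0)).

Definition pfstN k (a : 'I_k) : rname M k := canon (fun x y => pfst (tnth x a) y).
Definition psndN k (a : 'I_k) : rname M k := canon (fun x y => psnd (tnth x a) y).
Definition halfN k (a : 'I_k) : rname M k := canon (fun x y => half (tnth x a) y).
Definition predN k (a : 'I_k) : rname M k := canon (fun x y => predecessor (tnth x a) y).

Lemma good_pfstN k (a : 'I_k) : good p (pfstN a).
Proof. by apply/good_canon/gfun_app; [exact: sig_pfst | exact: pfst_fun | exact: pfst_ex]. Qed.

Lemma good_psndN k (a : 'I_k) : good p (psndN a).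
Proof. by apply/good_canon/gfun_app; [exact: sig_psnd | exact: psnd_fun | exact: psnd_ex]. Qed.

Lemma good_halfN k (a : 'I_k) : good p (halfN a).
Proof.
apply/good_canon/gfun_app; [|exact: half_fun | exact: half_ex].
by rewrite /half; sig_tac; d0_tac.
Qed.

Lemma good_predN k (a : 'I_k) : good p (predN a).
Proof.
apply/good_canon/gfun_app; [|exact: predecessor_fun | exact: predecessor_ex].
by rewrite /predecessor; sig_tac; d0_tac.
Qed.

Lemma good_chi k (P : k.-tuple N -> Prop) : d0 (fun e => P [tuple e i.+1 | i < k]) ->
  good p (canon (chi P)).
Proof. by move=> hP; apply/good_canon/gfun_chi. Qed.

(* Truth values of formulas: the value 1 means true. *)
Definition eqN n k (F : rname M k) (v : k.-tuple 'I_n) k' (F' : rname M k') (v' : k'.-tuple 'I_n) :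
    rname M n :=
  bindN (selN F (tnth v)) (bindN (selN F' (fun i => up1 (tnth v' i)))
    (canon (chi (fun x : n.+2.-tuple N => tnth x (@i0 _) = tnth x (@i1 _))))).

Lemma good_eqN n k (F : rname M k) (v : k.-tuple 'I_n) k' (F' : rname M k') (v' : k'.-tuple 'I_n) :
  good p F -> good p F' -> good p (eqN F v F' v').
Proof.
move=> hF hF'; apply: good_bind; first exact: good_sel.
by apply: good_bind; [exact: good_sel | apply: good_chi; d0_tac].
Qed.

Lemma map_tuple_sel n k (x : n.-tuple N) (v : k.-tuple 'I_n) :
  [tuple of map (tnth x) v] = [tuple tnth x (tnth v i) | i < k].
Proof. by apply: eq_from_tnth => i; rewrite tnth_map tnth_mktuple. Qed.

Lemma eqNP n k (F : rname M k) (v : k.-tuple 'I_n) k' (F' : rname M k') (v' : k'.-tuple 'I_n) t x z :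
  eqN F v F' v' t x z -> exists y y', [/\ F t [tuple of map (tnth x) v] y,
    F' t [tuple of map (tnth x) v'] y' & chi (fun=> y = y') x z].
Proof.
move=> [y [Fy [y' [Fy' [_ h]]]]]; exists y, y'.
rewrite !map_tuple_sel; rewrite /selN sel_up in Fy'; split=> //.
move: h; rewrite /chi /i1 tnth_up !tnth0 => -[[-> ->]|[h ->]]; first by left.
by right; split=> // /esym.
Qed.

Definition notN n (T : rname M n) : rname M n :=
  bindN T (canon (chi (fun x : n.+1.-tuple N => tnth x (@i0 _) <> 1))).

Lemma good_notN n (T : rname M n) : good p T -> good p (notN T).
Proof. by move=> hT; apply: good_bind => //; apply: good_chi; d0_tac. Qed.

Lemma notNP n (T : rname M n) t x z :
  notN T t x z -> exists y, T t x y /\ chi (fun=> y <> 1) x z.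
Proof. by move=> [y [Ty [_ h]]]; exists y; split=> //; move: h; rewrite /chi tnth0. Qed.

Definition andN n (T1 T2 : rname M n) : rname M n :=
  bindN T1 (bindN (selN T2 (@up1 n))
    (canon (chi (fun x : n.+2.-tuple N => tnth x (@i0 _) = 1 /\ tnth x (@i1 _) = 1)))).

Lemma good_andN n (T1 T2 : rname M n) : good p T1 -> good p T2 -> good p (andN T1 T2).
Proof.
move=> h1 h2; apply: good_bind => //; apply: good_bind; first exact: good_sel.
by apply: good_chi; d0_tac.
Qed.

Lemma andNP n (T1 T2 : rname M n) t x z :
  andN T1 T2 t x z -> exists y y', [/\ T1 t x y, T2 t x y' & chi (fun=> y = 1 /\ y' = 1) x z].
Proof.
move=> [y [Ty [y' [Ty' [_ h]]]]]; exists y, y'.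
rewrite /selN (sel_up _ _ id) mktuple_tnth in Ty'; split=> //.
by move: h; rewrite /chi /i1 tnth_up !tnth0 (and_comm (y' = 1)).
Qed.

(* [t |-> W1(t/2)] on even and [t |-> W2((t-1)/2)] on odd arguments. *)
Definition joinW n (W1 W2 : rname M n.+1) : rname M n.+1 :=
  caseN (fun x : n.+1.-tuple N => is_even (tnth x (@i0 _)))
    (bindN (halfN (@i0 _)) (selN W1 (pcons (@i0 _) (fun i => up1 (up1 i)))))
    (bindN (halfN (@i0 _)) (selN W2 (pcons (@i0 _) (fun i => up1 (up1 i))))).

Lemma good_joinW n (W1 W2 : rname M n.+1) : good p W1 -> good p W2 -> good p (joinW W1 W2).
Proof.
move=> h1 h2; apply: good_case; first by rewrite /is_even; d0_tac.
  by apply: good_bind; [exact: good_halfN | exact: good_sel].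
by apply: good_bind; [exact: good_halfN | exact: good_sel].
Qed.

Lemma joinW_even n (W1 W2 : rname M n.+1) t u (x : n.-tuple N) z :
  joinW W1 W2 t [tuple of (1 + 1) * u :: x] z -> W1 t [tuple of u :: x] z.
Proof.
rewrite /joinW /caseN /bindN /halfN /canon /selN tnth0.
have ev : is_even ((1 + 1) * u) by apply/is_evenP; exists u.
move=> [[_ [h [[_ hh] Wz]]]|[]//]; rewrite -(half_fun hh (or_introl (erefl _))).
by move: Wz; rewrite !(sel_pcons, sel_up _ _ (@up1 _), sel_up _ _ id, tnth0) mktuple_tnth.
Qed.

Lemma joinW_odd n (W1 W2 : rname M n.+1) t u (x : n.-tuple N) z :
  joinW W1 W2 t [tuple of (1 + 1) * u + 1 :: x] z -> W2 t [tuple of u :: x] z.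
Proof.
rewrite /joinW /caseN /bindN /halfN /canon /selN tnth0.
move=> [[/is_evenP [h /odd_not_even]]//|[_ [h [[_ hh] Wz]]]].
rewrite -(half_fun hh (or_intror (erefl _))).
by move: Wz; rewrite !(sel_pcons, sel_up _ _ (@up1 _), sel_up _ _ id, tnth0) mktuple_tnth.
Qed.

(** Meant for theta_H of a conjunction, which hands the same W to both conjuncts: W has to refute
    one of them, and the truth value [T] of the first tells which. *)
Definition ifW n (T : rname M n) (W1 W2 : rname M n.+1) : rname M n.+1 :=
  bindN (selN T (@up1 n)) (caseN (fun x : n.+2.-tuple N => tnth x (@i0 _) = 1)
    (selN W1 (@up1 _)) (selN W2 (@up1 _))).

Lemma good_ifW n (T : rname M n) (W1 W2 : rname M n.+1) :
  good p T -> good p W1 -> good p W2 -> good p (ifW T W1 W2).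
Proof.
move=> hT h1 h2; apply: good_bind; first exact: good_sel.
by apply: good_case; [d0_tac | exact: good_sel | exact: good_sel].
Qed.

Lemma ifWP n (T : rname M n) (W1 W2 : rname M n.+1) t u (x : n.-tuple N) z :
  ifW T W1 W2 t [tuple of u :: x] z -> exists y, T t x y /\
    ((y = 1 /\ W1 t [tuple of u :: x] z) \/ (y <> 1 /\ W2 t [tuple of u :: x] z)).
Proof.
move=> [y [Ty h]]; exists y; rewrite /selN (sel_up _ _ id) mktuple_tnth in Ty; split=> //.
by move: h; rewrite /caseN /selN tnth0 !(sel_up _ _ id) !mktuple_tnth.
Qed.

(* [u, x |-> W(t; w, x)] for [u = ⟨w,t⟩]. *)
Definition curryW n (W : rname M n.+2) : rname M n.+1 :=
  bindN (pfstN (@i0 _)) (bindN (psndN (@i1 _))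
    (selN W (pcons (@i0 _) (pcons (@i1 _) (fun i => up1 (up1 (up1 i))))))).

Lemma good_curryW n (W : rname M n.+2) : good p W -> good p (curryW W).
Proof.
move=> hW; apply: good_bind; first exact: good_pfstN.
by apply: good_bind; [exact: good_psndN | exact: good_sel].
Qed.

Lemma curryWP n (W : rname M n.+2) t u w v (x : n.-tuple N) z : pfst u w -> psnd u v ->
  curryW W t [tuple of u :: x] z -> W t [tuple of v :: [tuple of w :: x]] z.
Proof.
move=> hw hv [w' [[_]]]; rewrite tnth0 => /(pfst_fun hw) <- [v' [[_]]].
rewrite /i1 tnth_up tnth0 => /(psnd_fun hv) <-.
rewrite /selN !sel_pcons /i1 tnth_up !tnth0.
rewrite (sel_up _ _ (fun i => up1 (up1 i))) (sel_up _ _ (@up1 _)) (sel_up _ _ id).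
by rewrite mktuple_tnth.
Qed.

Lemma curryW_pair n (W : rname M n.+2) t w v (x : n.-tuple N) z :
  curryW W t [tuple of ⟨w, v⟩ :: x] z -> W t [tuple of v :: [tuple of w :: x]] z.
Proof. by apply: curryWP; [apply/pfst_pair | apply/psnd_pair]. Qed.

(* [0 |-> U(x)] and [t + 1 |-> W(t; U(x), x)]. *)
Definition headW n (U : rname M n) (W : rname M n.+2) : rname M n.+1 :=
  caseN (fun x : n.+1.-tuple N => tnth x (@i0 _) = 0) (selN U (@up1 _))
    (bindN (predN (@i0 _)) (bindN (selN U (fun i => up1 (up1 i)))
      (selN W (pcons (@i1 _) (pcons (@i0 _) (fun i => up1 (up1 (up1 i)))))))).

Lemma good_headW n (U : rname M n) (W : rname M n.+2) :
  good p U -> good p W -> good p (headW U W).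
Proof.
move=> hU hW; apply: good_case; [by d0_tac | exact: good_sel |].
apply: good_bind; first exact: good_predN.
by apply: good_bind; exact: good_sel.
Qed.

Lemma headW_0 n (U : rname M n) (W : rname M n.+2) t (x : n.-tuple N) z :
  headW U W t [tuple of 0 :: x] z -> U t x z.
Proof.
by rewrite /headW /caseN /selN tnth0 (sel_up _ _ id) mktuple_tnth => -[[]|[]].
Qed.

Lemma headW_S n (U : rname M n) (W : rname M n.+2) t u (x : n.-tuple N) z :
  headW U W t [tuple of u + 1 :: x] z ->
  exists w, U t x w /\ W t [tuple of u :: [tuple of w :: x]] z.
Proof.
have n0 : u + 1 <> 0 by apply: ax_succ_neq0 (rca0_basic hM) _.
move=> [[]|[_ [u' [[_]]]]]; first by rewrite tnth0 => /n0.
rewrite tnth0 => /predecessor_fun /(_ (or_introl (erefl _))) -> [w [Uw Wz]].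
exists w; move: Uw Wz; rewrite /selN !sel_pcons /i1 tnth_up !tnth0.
rewrite !(sel_up _ _ (fun i => up1 (up1 i))) !(sel_up _ _ (@up1 _)) !(sel_up _ _ id).
by rewrite mktuple_tnth.
Qed.

(* [W(t; U(x), x)] *)
Definition atW n (U : rname M n) (W : rname M n.+2) : rname M n.+1 :=
  bindN (selN U (@up1 _)) (selN W (pcons (@i1 _) (pcons (@i0 _) (fun i => up1 (up1 i))))).

Lemma good_atW n (U : rname M n) (W : rname M n.+2) : good p U -> good p W -> good p (atW U W).
Proof. by move=> hU hW; apply: good_bind; exact: good_sel. Qed.

Lemma atWP n (U : rname M n) (W : rname M n.+2) t u (x : n.-tuple N) z :
  atW U W t [tuple of u :: x] z ->
  exists w, U t x w /\ W t [tuple of u :: [tuple of w :: x]] z.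
Proof.
move=> [w [Uw Wz]]; exists w; move: Uw Wz; rewrite /selN !sel_pcons /i1 tnth_up !tnth0.
by rewrite !(sel_up _ _ (@up1 _)) !(sel_up _ _ id) mktuple_tnth.
Qed.

(* The Skolem function of [exists w, theta] from one of [theta]: for a witness
   [u = ⟨w,v⟩], [0 |-> w] and [t + 1 |-> W(t; v, w, x)]. *)
Definition exW n (W : rname M n.+3) : rname M n.+2 :=
  caseN (fun x : n.+2.-tuple N => tnth x (@i0 _) = 0) (pfstN (@i1 _))
    (bindN (predN (@i0 _)) (bindN (pfstN (@i2 _)) (bindN (psndN (@i3 _))
      (selN W (pcons (@i2 _) (pcons (@i0 _) (pcons (@i1 _)
        (fun i => up1 (up1 (up1 (up1 (up1 i)))))))))))).

Lemma good_exW n (W : rname M n.+3) : good p W -> good p (exW W).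
Proof.
move=> hW; apply: good_case; [by d0_tac | exact: good_pfstN |].
apply: good_bind; first exact: good_predN.
apply: good_bind; first exact: good_pfstN.
by apply: good_bind; [exact: good_psndN | exact: good_sel].
Qed.

Lemma exW_0 n (W : rname M n.+3) t u w (x : n.-tuple N) z : pfst u w ->
  exW W t [tuple of 0 :: [tuple of u :: x]] z -> z = w.
Proof.
move=> hw; rewrite /exW /caseN /pfstN /canon /i1 tnth_up !tnth0.
by move=> [[_ [_ /(pfst_fun hw)]]|[]].
Qed.

Lemma exW_S n (W : rname M n.+3) t h u w v (x : n.-tuple N) z : pfst u w -> psnd u v ->
  exW W t [tuple of h + 1 :: [tuple of u :: x]] z ->
  W t [tuple of h :: [tuple of v :: [tuple of w :: x]]] z.
Proof.
move=> hw hv; have n0 : h + 1 <> 0 by apply: ax_succ_neq0 (rca0_basic hM) _.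
move=> [[]|[_ [u' [[_]]]]]; first by rewrite tnth0 => /n0.
rewrite tnth0 => /predecessor_fun /(_ (or_introl (erefl _))) -> [w' [[_]]].
rewrite /i2 /i3 !tnth_up tnth0 => /(pfst_fun hw) <- [v' [[_]]].
rewrite !tnth_up tnth0 => /(psnd_fun hv) <-.
rewrite /selN !sel_pcons /i1 !tnth_up !tnth0.
rewrite (sel_up _ _ (fun i => up1 (up1 (up1 (up1 i))))) (sel_up _ _ (fun i => up1 (up1 (up1 i)))).
rewrite (sel_up _ _ (fun i => up1 (up1 i))) (sel_up _ _ (@up1 _)) (sel_up _ _ id).
by rewrite mktuple_tnth.
Qed.

End Skolem_names.

(** * The forcing relation *)

Definition good_form p n (phi : form M n) : Prop := all_names (fun k => @good p k) phi.

Lemma all_names_impl (P Q : forall k, rname M k -> Prop) n (phi : form M n) :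
  (forall k F, P k F -> Q k F) -> all_names P phi -> all_names Q phi.
Proof.
move=> PQ; elim: n / phi => [n k F v k' F' v'|n phi IH|n phi IH psi IH'|n phi IH] //=.
- by move=> [/PQ ? /PQ].
- by move=> [/IH ? /IH'].
Qed.

Lemma good_form_ext p q n (phi : form M n) : extends q p -> good_form p phi -> good_form q phi.
Proof. by move=> qp; apply: all_names_impl => k F; apply: good_ext. Qed.

Lemma forces_mono p q n (phi : form M n) x : extends q p -> forces phi p x -> forces phi q x.
Proof.
move=> qp; elim: n / phi x => [n k F v k' F' v'|n phi IH|n phi IH psi IH'|n phi IH] x /=.
- by move=> h t /(U_ext qp); apply: h.
- by move=> h [r [rq hr]]; apply: h; exists r; split=> //; apply: extends_trans rq qp.
- by move=> [/IH ? /IH'].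
- by move=> h w; apply/IH/h.
Qed.

(** Two different values at an atom are already seen on a string t. Below a condition that makes t
    an initial segment, every string is compatible with t, so no extension can force the
    equation. *)
Lemma forces_nforces p n (phi : form M n) x : good_form p phi -> ~ forces phi p x ->
  exists q, extends q p /\ forces (FNeg phi) q x.
Proof.
elim: n / phi p x => [n k F v k' F' v'|n phi IH|n phi IH psi IH'|n phi IH] p x /=.
- move=> [[nF _] [nF' _]] h; apply: NNPP => h'; apply: h => t ut y y' Fy Fy'; apply: NNPP => ne.
  have [r [rp btr]] := cond_below ut; apply: h'; exists r; split=> // -[r' [r'r h]]; apply: ne.
  have [t1 ut1] := U_inhabited r'.
  have [t2 [ut2 t02 _]] := amalgamation (U_binstr ut) (below_ext r'r btr) ut1.
  exact: (h t2 ut2 _ _ (name_mono nF Fy (U_binstr ut2) t02) (name_mono nF' Fy' (U_binstr ut2) t02)).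
- move=> _ /NNPP [q [qp hq]]; exists q; split=> // -[r [rq hr]]; apply: hr; exists r.
  by split; [exact: extends_refl | apply: forces_mono rq hq].
- move=> [g g'] h; case: (classic (forces phi p x)) => hx.
    have [|q [qp hq]] := IH' p x g'; first by tauto.
    by exists q; split=> // -[r [rq [_ hr]]]; apply: hq; exists r.
  have [q [qp hq]] := IH p x g hx.
  by exists q; split=> // -[r [rq [hr _]]]; apply: hq; exists r.
- move=> g h; have [w hw] : exists w, ~ forces phi p [tuple of w :: x].
    by apply: NNPP => h'; apply: h => w; apply: NNPP => hw; apply: h'; exists w.
  have [q [qp hq]] := IH p _ g hw.
  by exists q; split=> // -[r [rq hr]]; apply: hq; exists r; split=> //; apply: hr.
Qed.

Lemma forces_densely p n (phi : form M n) x : good_form p phi ->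
  (forall q, extends q p -> exists r, extends r q /\ forces phi r x) -> forces phi p x.
Proof.
move=> g h; apply: NNPP => /(forces_nforces g) [q [qp hq]].
by have [r [rq hr]] := h q qp; apply: hq; exists r.
Qed.

(** * Decided values and substitution *)

Definition decides p k (F : rname M k) x (y : N) : Prop :=
  forall t, in_U t p -> forall z, F t x z -> z = y.

Lemma decides_ext p q k (F : rname M k) x y : extends q p -> decides p F x y -> decides q F x y.
Proof. by move=> qp h t /(U_ext qp); apply: h. Qed.

Lemma below_decides p t k (F : rname M k) x y : is_name F -> below t p -> F t x y -> decides p F x y.
Proof.
move=> nF bt Fy t' ut' z Fz; have [t2 [ut2 tt2 t't2]] := amalgamation (name_str nF Fy) bt ut'.
exact: (name_fun nF (name_mono nF Fz (U_binstr ut2) t't2) (name_mono nF Fy (U_binstr ut2) tt2)).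
Qed.

Lemma decide p q k (F : rname M k) x : good p F -> extends q p ->
  exists r y, extends r q /\ decides r F x y.
Proof.
move=> [nF dF] qp; have [t ut] := U_inhabited q.
have [t' [y [ut' _ Fy]]] := dF q qp x t ut; have [r [rq bt]] := cond_below ut'.
by exists r, y; split=> //; apply: below_decides bt Fy.
Qed.

Lemma map_idvars n (x : n.-tuple N) : [tuple of map (tnth x) (idvars n)] = x.
Proof. by apply: eq_from_tnth => i; rewrite tnth_map tnth_ord_tuple. Qed.

Lemma good_scons p m n (G : rname M n) (s : 'I_m -> rname M n) :
  good p G -> (forall i, good p (s i)) -> forall i, good p (scons G s i).
Proof. by move=> hG hs i; rewrite /scons; case: unlift. Qed.

Lemma good_fsubst p m (phi : form M m) n (s : 'I_m -> rname M n) :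
  good_form p phi -> (forall i, good p (s i)) -> good_form p (fsubst phi s).
Proof.
elim: m / phi n s => [m k F v k' F' v'|m phi IH|m phi IH psi IH'|m phi IH] n s /=.
- by move=> [hF hF'] hs; split; apply: good_ncomp => // i.
- exact: IH.
- by move=> [/IH h /IH' h'] hs; split; [apply: h | apply: h'].
- move=> hphi hs; apply: IH => //; apply: good_scons; first exact: good_nproj.
  by move=> i; apply: good_nweak.
Qed.

Lemma decides_nproj p k (i : 'I_k) x : decides p (@nproj M k i) x (tnth x i).
Proof. by move=> t _ z [_ ->]. Qed.

Lemma decides_scons p m n (G : rname M n) (s : 'I_m -> rname M n) x w (y : m.-tuple N) :
  decides p G x w -> (forall i, decides p (s i) x (tnth y i)) ->
  forall i, decides p (scons G s i) x (tnth [tuple of w :: y] i).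
Proof.
by move=> hG hs i; rewrite /scons; case: unliftP => [j ->|->]; rewrite ?tnth0 ?tnthS.
Qed.

Lemma forces_fsubst p m (phi : form M m) n (s : 'I_m -> rname M n) x (y : m.-tuple N) :
  good_form p phi -> (forall i, good p (s i)) -> (forall i, decides p (s i) x (tnth y i)) ->
  forces (fsubst phi s) p x <-> forces phi p y.
Proof.
elim: m / phi p n s x y => [m k F v k' F' v'|m phi IH|m phi IH psi IH'|m phi IH] p n s x y /=.
- move=> [hF hF'] hs hy; rewrite map_idvars.
  have vE l (u : l.-tuple 'I_m) t (y' : l.-tuple N) : in_U t p ->
      (forall i, s (tnth u i) t x (tnth y' i)) -> y' = [tuple of map (tnth y) u].
    by move=> ut h; apply: eq_from_tnth => i; rewrite tnth_map; apply: hy (h i).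
  split=> h t ut z z'; last first.
    move=> [y1 [h1 Fz]] [y2 [h2 Fz']]; move: Fz Fz'.
    by rewrite (vE _ _ _ _ ut h1) (vE _ _ _ _ ut h2); apply: h.
  (* [t] may be too short for the substituted names to have values on it; it is lengthened until
     they do, and these values are those in [y]. *)
  move=> Fz Fz'; have [t1 [y1 [ut1 tt1 h1]]] := dense_all hs (extends_refl p) x ut.
  have bt1 := U_binstr ut1.
  have yE : y1 = y by apply: eq_from_tnth => i; apply: hy (h1 i).
  apply: (h t1 ut1); [exists [tuple of map (tnth y) v] | exists [tuple of map (tnth y) v']].
    by split; [move=> i; rewrite tnth_map -yE | exact: (name_mono (good_name hF) Fz)].
  by split; [move=> i; rewrite tnth_map -yE | exact: (name_mono (good_name hF') Fz')].
- move=> g hs hy.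
  have IHq q : extends q p -> forces (fsubst phi s) q x <-> forces phi q y.
    move=> qp; apply: IH; first exact: good_form_ext g.
      by move=> i; apply: good_ext (hs i).
    by move=> i; apply: decides_ext (hy i).
  by split=> h [q [qp hq]]; apply: h; exists q; split=> //; apply/(IHq q qp).
- by move=> [g g'] hs hy; rewrite (IH p n s x y) // (IH' p n s x y).
- move=> g hs hy.
  have K w : forces (fsubst phi (scons (@nproj M n.+1 ord0) (fun i => nweak (s i)))) p [tuple of w :: x]
      <-> forces phi p [tuple of w :: y].
    apply: IH => //.
      by apply: good_scons => [|i]; [exact: good_nproj | exact: good_nweak].
    apply: decides_scons => [|i]; first by rewrite -{2}(tnth0 w x); apply: decides_nproj.
    by move=> t ut z /nweakP; apply: hy.
  by split=> h w; apply/K.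
Qed.

(** * Skolemized formulas *)

Lemma good_skolem p s n (phi : form M n) (W : rname M n.+1) :
  good_form p phi -> good p W -> good_form p (skolem s phi W).
Proof.
elim: n / phi s W => [n k F v k' F' v'|n phi IH|n phi IH psi IH'|n phi IH] s W //=.
- exact: IH.
- move=> [/IH h /IH' h'] hW; case: s; split; [apply: h|apply: h'|apply: h|apply: h'] => //.
    exact: good_weven.
  exact: good_wodd.
- move=> g hW; case: s; first by apply: IH => //; apply: good_wsect.
  apply: good_fsubst; first by apply: IH => //; apply: good_wtail.
  by apply: good_scons => [|i]; [exact: good_whead | exact: good_nproj].
Qed.

(** Compatibility rather than equality: the names built from projections and case distinctions
    compute the intended values, but possibly on different strings. *)
Definition agree p n (W W' : rname M n.+1) (x : n.-tuple N) : Prop :=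
  forall t, in_U t p -> forall u z z', W t [tuple of u :: x] z -> W' t [tuple of u :: x] z' -> z = z'.

Lemma agree_ext p q n (W W' : rname M n.+1) x : extends q p -> agree p W W' x -> agree q W W' x.
Proof. by move=> qp h t /(U_ext qp); apply: h. Qed.

Lemma agree_sym p n (W W' : rname M n.+1) x : agree p W W' x -> agree p W' W x.
Proof. by move=> h t ut u z z' h1 h2; symmetry; apply: h h2 h1. Qed.

Lemma forces_at_head p s n (phi : form M n.+1) (W : rname M n.+1) x w :
  good_form p phi -> good p W -> decides p (whead W) x w ->
  forces (fsubst (skolem s phi (wtail W)) (scons (whead W) (fun i => nproj (M := M) i))) p x <->
  forces (skolem s phi (wtail W)) p [tuple of w :: x].
Proof.
move=> g hW hw; apply: forces_fsubst.
- by apply: good_skolem => //; apply: good_wtail.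
- by apply: good_scons => [|i]; [exact: good_whead | exact: good_nproj].
- by apply: decides_scons => // i; apply: decides_nproj.
Qed.

(** Only values of W matter. Negation exchanges W and W', which is harmless because agreement is
    symmetric. At a universal quantifier in theta_H, W(0) and W'(0) are densely decided, their
    values coincide, and both sides reduce to the same instance. *)
Lemma skolem_agree p s n (phi : form M n) (W W' : rname M n.+1) x :
  good_form p phi -> good p W -> good p W' -> agree p W W' x ->
  forces (skolem s phi W) p x -> forces (skolem s phi W') p x.
Proof.
elim: n / phi p s W W' x => [n k F v k' F' v'|n phi IH|n phi IH psi IH'|n phi IH] p s W W' x //.
- move=> g hW hW' a /= h [q [qp hq]]; apply: h; exists q; split=> //.
  apply: IH hq; [exact: good_form_ext g | exact: good_ext hW' | exact: good_ext hW |].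
  exact/agree_sym/(agree_ext qp).
- move=> [g g'] hW hW' a; case: s => /= -[h h']; split.
  + apply: IH h => //; [exact: good_weven | exact: good_weven |].
    by move=> t ut u z z' /wevenP k /wevenP k'; apply: a ut _ _ _ k k'.
  + apply: IH' h' => //; [exact: good_wodd | exact: good_wodd |].
    by move=> t ut u z z' /woddP k /woddP k'; apply: a ut _ _ _ k k'.
  + exact: IH h.
  + exact: IH' h'.
- move=> g hW hW' a; case: s => [h w|/= h].
    apply: IH (h w) => //; [exact: good_wsect | exact: good_wsect |].
    by move=> t ut u z z' /wsectP k /wsectP k'; apply: a ut _ _ _ k k'.
  apply: forces_densely.
    exact: (@good_skolem p false n (FAll phi)).
  move=> q qp; have [q1 [w [q1q hw]]] := decide x (good_whead hW) qp.
  have q1p : extends q1 p by exact: extends_trans q1q qp.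
  have [q2 [w' [q2q1 hw']]] := decide x (good_whead hW') q1p.
  have q2p : extends q2 p by exact: extends_trans q2q1 q1p.
  have g2 := good_form_ext q2p g; have hW2 : good q2 W by exact: good_ext q2p hW.
  have hW2' : good q2 W' by exact: good_ext q2p hW'.
  have ww : w = w'.
    have [t ut] := U_inhabited q2.
    have [t1 [z [ut1 _ hz]]] := good_dense (good_whead hW2) (extends_refl q2) x ut.
    have [t2 [z' [ut2 t12 hz']]] := good_dense (good_whead hW2') (extends_refl q2) x ut1.
    rewrite -(hw _ (U_ext q2q1 ut1) _ hz) -(hw' _ ut2 _ hz').
    apply: a (U_ext q2p ut2) _ _ _ _ (wheadP hz').
    exact: (name_mono (good_name hW) (wheadP hz) (U_binstr ut2) t12).
  exists q2; split; first exact: extends_trans q2q1 q1q.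
  apply/(forces_at_head _ _ _ hw') => //.
  have {}h := forces_mono q2p h; move/(forces_at_head _ g2 hW2 (decides_ext q2q1 hw)): h; rewrite ww.
  apply: IH => //; [exact: good_wtail | exact: good_wtail |].
  by move=> t ut u z z' /wtailP k /wtailP k'; apply: a (U_ext q2p ut) _ _ _ k k'.
Qed.

(** Both implications are proved together because negation turns one into the other. For theta_H of
    a universal formula, W(0) is densely decided, and the instance at its value is forced. *)
Lemma skolem_sound p n (phi : form M n) (W : rname M n.+1) x : good_form p phi -> good p W ->
  (forces (skolem true phi W) p x -> forces phi p x) /\
  (forces phi p x -> forces (skolem false phi W) p x).
Proof.
elim: n / phi p W x => [n k F v k' F' v'|n phi IH|n phi IH psi IH'|n phi IH] p W x g hW //.
- split=> /= h [q [qp hq]]; apply: h; exists q; split=> //.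
    by have [_ h] := IH q W x (good_form_ext qp g) (good_ext qp hW); apply: h.
  by have [h _] := IH q W x (good_form_ext qp g) (good_ext qp hW); apply: h.
- case: g => g g'; split=> /= -[h h']; split.
  + by have [k _] := IH p _ x g (good_weven hW); apply: k.
  + by have [k _] := IH' p _ x g' (good_wodd hW); apply: k.
  + by have [_ k] := IH p _ x g hW; apply: k.
  + by have [_ k] := IH' p _ x g' hW; apply: k.
- split=> h; first by move=> w; have [k _] := IH p _ [tuple of w :: x] g (good_wsect hW); apply/k/h.
  apply: forces_densely.
    exact: (@good_skolem p false n (FAll phi)).
  move=> q qp; have [r [w [rq hw]]] := decide x (good_whead hW) qp.
  have rp : extends r p by exact: extends_trans rq qp.
  have gr := good_form_ext rp g; have hWr : good r W by exact: good_ext rp hW.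
  exists r; split=> //; apply/(forces_at_head _ gr hWr hw).
  have [_ k] := IH r _ [tuple of w :: x] gr (good_wtail hWr).
  by apply: k; apply: forces_mono rp (h w).
Qed.

(** * Skolem functions *)

(* [T] is a truth value of [phi]; [WS] and [WH] are Skolem functions for [phi]
   and for its negation. *)
Record skolemizes p n (phi : form M n) (T : rname M n) (WS WH : rname M n.+1) : Prop := Skolemizes {
  sk_T : good p T;
  sk_WS : good p WS;
  sk_WH : good p WH;
  sk_truth : forall q x, extends q p -> forces phi q x <-> decides q T x 1;
  sk_S : forall q x, extends q p -> forces phi q x -> forces (skolem true phi WS) q x;
  sk_H : forall q x, extends q p -> forces (skolem false phi WH) q x -> forces phi q x }.

Lemma force_below p q n (phi : form M n) T WS WH t x z : skolemizes p phi T WS WH ->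
  extends q p -> in_U t q -> T t x z -> forces (FNeg phi) q x -> z <> 1.
Proof.
move=> sk qp ut Tz h e; rewrite e in Tz; have [r [rq bt]] := cond_below ut.
apply: h; exists r; split=> //; apply/(sk_truth sk); first exact: extends_trans rq qp.
exact: below_decides (good_name (sk_T sk)) bt Tz.
Qed.

Lemma sk_atom p n k (F : rname M k) (v : k.-tuple 'I_n) k' (F' : rname M k') (v' : k'.-tuple 'I_n) :
  good p F -> good p F' -> exists T WS WH, skolemizes p (FAtom F v F' v') T WS WH.
Proof.
move=> hF hF'; exists (eqN F v F' v'), (pfstN ord0), (pfstN ord0).
have hT := good_eqN v v' hF hF'.
split=> //; try exact: good_pfstN.
move=> q x qp; split=> /= [h t ut z /eqNP [y [y' [Fy Fy']]]|h t ut y y' Fy Fy'].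
  by case=> [[]//|[]]; case; apply: h ut _ _ Fy Fy'.
have [t1 [z [ut1 tt1 hz]]] := good_dense hT qp x ut.
have [y1 [y1' [Fy1 Fy1']]] := eqNP hz; rewrite (h _ ut1 _ hz).
have b1 := U_binstr ut1.
rewrite (name_fun (good_name hF) (name_mono (good_name hF) Fy b1 tt1) Fy1).
rewrite (name_fun (good_name hF') (name_mono (good_name hF') Fy' b1 tt1) Fy1').
by case=> [[]//|[_ /one_neq0]].
Qed.

Lemma sk_neg p n (phi : form M n) T WS WH : skolemizes p phi T WS WH ->
  skolemizes p (FNeg phi) (notN T) WH WS.
Proof.
move=> sk; have [hT hS hH tr S H] := sk; have hT' := good_notN hT; split=> //.
- move=> q x qp; split=> [h t ut z /notNP [y [Ty]]|h [r [rq hr]]].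
    by case=> [[]//|[ne _]]; case: ne; apply: force_below sk qp ut Ty h.
  have rp : extends r p by exact: extends_trans rq qp.
  have [t ut] := U_inhabited r; have [t1 [z [ut1 _ hz]]] := good_dense hT' rp x ut.
  have [y [Ty]] := notNP hz; rewrite (h _ (U_ext rq ut1) _ hz).
  rewrite (proj1 (tr r x rp) hr t1 ut1 _ Ty).
  by case=> [[]//|[_ /one_neq0]].
- move=> q x qp /= h [r [rq hr]]; apply: h; exists r; split=> //.
  by apply: H hr; exact: extends_trans rq qp.
- move=> q x qp /= h [r [rq hr]]; apply: h; exists r; split=> //.
  by apply: S hr; exact: extends_trans rq qp.
Qed.

Lemma sk_and p n (phi psi : form M n) T WS WH T' WS' WH' :
  good_form p phi -> good_form p psi ->
  skolemizes p phi T WS WH -> skolemizes p psi T' WS' WH' ->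
  skolemizes p (FAnd phi psi) (andN T T') (joinW WS WS') (ifW T WH' WH).
Proof.
move=> g g' sk sk'; have [hT hS hH tr S H] := sk; have [hT' hS' hH' tr' S' H'] := sk'.
have hA := good_andN hT hT'; have hJ := good_joinW hS hS'; have hI := good_ifW hT hH' hH.
split=> //.
- move=> q x qp; split=> [[/(tr _ _ qp) h /(tr' _ _ qp) h'] t ut z /andNP [y [y' [Ty Ty']]]|h].
    by rewrite (h _ ut _ Ty) (h' _ ut _ Ty'); case=> [[]//|[[]]].
  split.
    apply/(tr _ _ qp) => t ut z Tz; have [t1 [a [ut1 tt1 ha]]] := good_dense hA qp x ut.
    have [y [y' [Ty Ty']]] := andNP ha; rewrite (h _ ut1 _ ha).
    rewrite (name_fun (good_name hT) (name_mono (good_name hT) Tz (U_binstr ut1) tt1) Ty).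
    by case=> [[[]]//|[_ /one_neq0]].
  apply/(tr' _ _ qp) => t ut z Tz; have [t1 [a [ut1 tt1 ha]]] := good_dense hA qp x ut.
  have [y [y' [Ty Ty']]] := andNP ha; rewrite (h _ ut1 _ ha).
  rewrite (name_fun (good_name hT') (name_mono (good_name hT') Tz (U_binstr ut1) tt1) Ty').
  by case=> [[[]]//|[_ /one_neq0]].
- move=> q x qp [/(S _ _ qp) h /(S' _ _ qp) h'] /=.
  have gq := good_form_ext qp g; have gq' := good_form_ext qp g'.
  have hSq : good q WS by exact: good_ext qp hS.
  have hSq' : good q WS' by exact: good_ext qp hS'.
  have hJq : good q (joinW WS WS') by exact: good_ext qp hJ.
  split.
    apply: skolem_agree h => //; first exact: good_weven.
    move=> t ut u z z' k /wevenP /joinW_even k'; exact: (name_fun (good_name hS) k k').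
  apply: skolem_agree h' => //; first exact: good_wodd.
  move=> t ut u z z' k /woddP /joinW_odd k'; exact: (name_fun (good_name hS') k k').
- move=> q x qp /= [h h'].
  have hHp r : extends r q -> [/\ extends r p, good_form r phi, good_form r psi,
      good r WH & good r WH' /\ good r (ifW T WH' WH)].
    move=> rq; have rp : extends r p by exact: extends_trans rq qp.
    split=> //; [exact: good_form_ext g | exact: good_form_ext g' | exact: good_ext hH |].
    by split; [exact: good_ext hH' | exact: good_ext hI].
  (* Where phi is refuted its truth value is not 1, so [ifW] passes on [WH]; but then theta_H gives
     phi, a contradiction. *)
  have hphi : forces phi q x.
    apply: NNPP => /(forces_nforces (good_form_ext qp g)) [r [rq hr]].
    have [rp gr gr' hHr [hHr' hIr]] := hHp r rq.
    apply: (hr); exists r; split; first exact: extends_refl.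
    apply: (H _ _ rp); apply: skolem_agree (forces_mono rq h) => //.
    move=> t ut u z z' /ifWP [y [Ty [[ey _]|[_ k]]]] k'.
      by case: (force_below sk rp ut Ty hr).
    exact: (name_fun (good_name hH) k k').
  (* As phi is forced, its truth value is 1 and [ifW] passes on [WH']. *)
  split=> //; apply: NNPP => /(forces_nforces (good_form_ext qp g')) [r [rq hr]].
  have [rp gr gr' hHr [hHr' hIr]] := hHp r rq.
  apply: (hr); exists r; split; first exact: extends_refl.
  apply: (H' _ _ rp); apply: skolem_agree (forces_mono rq h') => //.
  move=> t ut u z z' /ifWP [y [Ty [[_ k]|[ny _]]]] k'.
    exact: (name_fun (good_name hH') k k').
  by case: ny; apply: (proj1 (tr _ _ rp) (forces_mono rq hphi) t ut).
Qed.

Lemma decides_unique p k (F G : rname M k) x (y z : N) : good p F -> good p G ->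
  (forall t a b, F t x a -> G t x b -> a = b) -> decides p F x y -> decides p G x z -> y = z.
Proof.
move=> hF hG FG hy hz; have [t ut] := U_inhabited p.
have [t1 [a [ut1 _ ha]]] := good_dense hF (extends_refl p) x ut.
have [t2 [b [ut2 t12 hb]]] := good_dense hG (extends_refl p) x ut1.
rewrite -(hy _ ut1 _ ha) -(hz _ ut2 _ hb).
exact: (FG t2 _ _ (name_mono (good_name hF) ha (U_binstr ut2) t12) hb).
Qed.

(** [chi] stands for a matrix guarded by a bound and [L] for the truth value of the guard: a
    counterexample satisfies the guard, the guard is closed downwards, and it densely fails
    somewhere. So the search [U] for the least w at which the guard or [chi] fails is local. It
    yields the least counterexample if there is one and otherwise the first number past the bound.
    Hence [chi] at U(x) has the truth value of the quantified formula, and U(x) is the head of the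
    dual Skolem function. *)
Lemma sk_ball p n (chi : form M n.+1) T WS WH (L : rname M n.+1) :
  good_form p chi -> skolemizes p chi T WS WH -> good p L ->
  (forall q w (x : n.-tuple N), extends q p -> forces (FNeg chi) q [tuple of w :: x] ->
     decides q L [tuple of w :: x] 1) ->
  (forall t w w' (x : n.-tuple N) z, L t [tuple of w :: x] 1 -> w' <= w ->
     L t [tuple of w' :: x] z -> z = 1) ->
  (forall q (x : n.-tuple N) t, extends q p -> in_U t q -> exists t' w z,
     [/\ in_U t' q, fsub t t', L t' [tuple of w :: x] z & z <> 1]) ->
  exists T' WS' WH', skolemizes p (FAll chi) T' WS' WH'.
Proof.
move=> g sk hL L1 L2 L3; have [hT hS hH tr S H] := sk.
pose R := notN (andN L T); have hR : good p R by apply/good_notN/good_andN.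
have RP t x a b c : L t x a -> T t x b -> R t x c -> c = 1 <-> ~ (a = 1 /\ b = 1).
  move=> La Tb /notNP [y [/andNP [a' [b' [La' Tb' hy]]] hc]].
  rewrite (name_fun (good_name hL) La La') (name_fun (good_name hT) Tb Tb').
  case: hy => [[k ey]|[k ey]]; case: hc => [[k' ->]|[k' ->]]; rewrite ey in k'.
  - by case: k'.
  - by split=> [/esym/one_neq0//|[]].
  - by split.
  - by case: k' => /esym/one_neq0.
pose U := minN R.
have hU : good p U.
  apply: good_minN => // q qp x t ut; have [t1 [w [a [ut1 tt1 La a1]]]] := L3 q x t qp ut.
  have [t2 [b [ut2 t12 Tb]]] := good_dense hT qp [tuple of w :: x] ut1.
  have [t3 [c [ut3 t23 Rc]]] := good_dense hR qp [tuple of w :: x] ut2.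
  have b3 := U_binstr ut3.
  have La3 : L t3 [tuple of w :: x] a by apply: (name_mono (good_name hL) La b3) => i /t12 /t23.
  have Tb3 := name_mono (good_name hT) Tb b3 t23.
  exists t3, w; split=> //; first by move=> i /tt1 /t12 /t23.
  by rewrite -[X in R _ _ X](proj2 (RP _ _ _ _ _ La3 Tb3 Rc)) // => -[].
pose T' := bindN U T; have hT' : good p T' by exact: good_bind.
have tr' q x : extends q p -> forces (FAll chi) q x <-> decides q T' x 1.
  move=> qp; split=> [h t ut z [w [_ Tz]]|h w].
    exact: (proj1 (tr q _ qp) (h w) t ut _ Tz).
  apply: NNPP => /(forces_nforces (good_form_ext qp g)) [r [rq hr]].
  have rp : extends r p by exact: extends_trans rq qp.
  have [t ut] := U_inhabited r.
  have [t1 [b [ut1 tt1 Tb1]]] := good_dense hT rp [tuple of w :: x] ut.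
  have [t2 [a [ut2 t12 La2]]] := good_dense hL rp [tuple of w :: x] ut1.
  have [t3 [c [ut3 t23 Tc]]] := good_dense hT' rp x ut2.
  have [w0 [[R0 Rlt] T0]] := Tc.
  have [t4 [d [ut4 t34 L0]]] := good_dense hL rp [tuple of w0 :: x] ut3.
  have b4 := U_binstr ut4.
  have t24 : fsub t2 t4 by move=> i /t23 /t34.
  have t14 : fsub t1 t4 by move=> i /t12 /t24.
  have {}La := name_mono (good_name hL) La2 b4 t24.
  have {}Tb := name_mono (good_name hT) Tb1 b4 t14.
  have {}R0 := name_mono (good_name hR) R0 b4 t34.
  have c1 : c = 1 by apply: (h t3 (U_ext rq ut3)).
  have {}T0 := name_mono (good_name hT) T0 b4 t34; rewrite c1 in T0.
  (* As [chi] is true at w0, the search stopped there because the guard fails. The refuted w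
     satisfies the guard, so it lies below w0, where the search would have stopped before. *)
  have d1 : d <> 1 by move=> d1; have [k _] := RP _ _ _ _ _ L0 T0 R0; apply: k.
  have b1 : b <> 1 := force_below sk rp ut4 Tb hr.
  have a1 : a = 1 := L1 r w x rp hr t4 ut4 _ La.
  case: (lt_total w0 w) => [le|/Rlt [e [e1 Re]]].
    by apply: d1; rewrite a1 in La; apply: L2 La le L0.
  have {}Re := name_mono (good_name hR) Re b4 t34.
  by apply: e1; apply/(RP _ _ _ _ _ La Tb Re) => -[].
exists T', (curryW WS), (headW U WH).
have hC := good_curryW hS; have hW := good_headW hU hH.
split=> // q x qp.
- move=> h w; apply: (@skolem_agree _ _ _ _ WS).
  + exact: good_form_ext g.
  + exact: good_ext hS.
  + exact/good_wsect/(good_ext qp hC).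
  + move=> t ut u z z' k /wsectP /curryW_pair.
    exact: (name_fun (good_name hS) k).
  + exact/S/h.
- move=> h; apply: NNPP => /(@forces_nforces q _ (FAll chi) _ (good_form_ext qp g)) [r [rq hr]].
  have rp : extends r p by exact: extends_trans rq qp.
  have [r1 [w [r1r hw]]] := decide x hU rp.
  have r1p : extends r1 p by exact: extends_trans r1r rp.
  have [r2 [w' [r2r1 hw']]] := decide x (good_whead hW) r1p.
  have r2p : extends r2 p by exact: extends_trans r2r1 r1p.
  have hUr : good r2 U by exact: good_ext hU.
  have hWr : good r2 (headW U WH) by exact: good_ext hW.
  have {}hw := decides_ext r2r1 hw.
  have ew : w' = w.
    apply: decides_unique (good_whead hWr) hUr _ hw' hw => t a b /wheadP /headW_0.
    exact: (name_fun (good_name hU)).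
  have gr := good_form_ext r2p g.
  have r2q : extends r2 q by apply: extends_trans r2r1 _; apply: extends_trans r1r rq.
  have {}h := forces_mono r2q h; move/(forces_at_head _ gr hWr hw'): h; rewrite ew => h.
  have hchi : forces chi r2 [tuple of w :: x].
    apply: (H _ _ r2p); apply: skolem_agree h => //; [exact: good_wtail | exact: good_ext hH |].
    move=> t ut u z z' /wtailP /headW_S [w1 [Uw1 k]]; rewrite (hw _ ut _ Uw1) in k.
    exact: (name_fun (good_name hH) k).
  (* Once [chi] is forced at the candidate w, the truth value [T'] is 1 and the whole universal
     formula is forced, against the choice of r. *)
  apply: hr; exists r2; split; first exact: extends_trans r2r1 r1r.
  apply/(tr' _ _ r2p) => t ut z [w1 [Uw1 Tz]]; rewrite (hw _ ut _ Uw1) in Tz.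
  exact: (proj1 (tr _ _ r2p) hchi t ut).
Qed.

Lemma leNP n k (F : rname M k) (v : k.-tuple 'I_n) t w (x : n.-tuple N) y :
  ncomp (@le_name M) (fun i : 'I_2 => if i == ord0 then @nproj M k.+1 ord0
              else ncomp F (fun j : 'I_k => @nproj M k.+1 (lift ord0 j))) t
    [tuple of map (tnth [tuple of w :: x]) [tuple of ord0 :: shift_vars v]] y ->
  exists b, F t [tuple of map (tnth x) v] b /\ chi (fun=> w <= b) x y.
Proof.
set X := [tuple of map _ _]; move=> [c [hc [_ hy]]].
have X0 : tnth X ord0 = w by rewrite tnth_map !tnth0.
have XS j : tnth X (lift ord0 j) = tnth [tuple of map (tnth x) v] j.
  by rewrite !tnth_map tnthS tnth_map tnthS.
have [_ h0] := hc ord0; have [d [hd Fd]] := hc ord_max.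
exists (tnth c ord_max); split; last by rewrite h0 X0 in hy.
by have <- : d = [tuple of map (tnth x) v] by apply: eq_from_tnth => j; have [_ ->] := hd j.
Qed.

Lemma sk_bounded p n (phi : form M n) : bounded phi -> good_form p phi ->
  exists T WS WH, skolemizes p phi T WS WH.
Proof.
elim=> {n phi} [n k F v k' F' v'|n phi _ IH|n phi psi _ IH _ IH'|n k F v phi nF _ IH].
- by move=> [hF hF']; apply: sk_atom.
- by move=> /IH [T [WS [WH sk]]]; exists (notN T), WH, WS; apply: sk_neg.
- move=> [g g']; have [T [WS [WH sk]]] := IH g; have [T' [WS' [WH' sk']]] := IH' g'.
  by exists (andN T T'), (joinW WS WS'), (ifW T WH' WH); apply: sk_and.
move=> [[gle g1] g]; have [T [WS [WH sk]]] := IH g.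
have gLe : good_form p (FLe F v) by split.
have [T1 [WS1 [WH1 sk1]]] := sk_atom [tuple of ord0 :: shift_vars v] [tuple] gle g1.
(* [FImp] is built from negation and conjunction, so the guarded matrix is covered by the cases
   already treated. *)
have sk2 := sk_neg (sk_and gLe (g : good_form p (FNeg phi)) sk1 (sk_neg sk)).
pose leF := ncomp (@le_name M) (fun i : 'I_2 => if i == ord0 then @nproj M k.+1 ord0
              else ncomp F (fun j : 'I_k => @nproj M k.+1 (lift ord0 j))).
pose oneN : rname M 0 := canon (fun _ y => y = 1).
pose L := eqN leF [tuple of ord0 :: shift_vars v] oneN [tuple].
have hL : good p L by apply: good_eqN.
have LP t w (x : n.-tuple N) z : L t [tuple of w :: x] z ->
    exists b, F t [tuple of map (tnth x) v] b /\ chi (fun=> w <= b) x z.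
  move=> /eqNP [y [y' [/leNP [b [Fb hb]] [_ ->] hz]]]; exists b; split=> //.
  case: hb hz => [[k1 ->]|[k1 ->]] [[k2 ->]|[k2 ->]]; [by left | by case: k2 | | by right].
  by case: (one_neq0 (esym k2)).
have gI : good_form p (FImp (FLe F v) phi) by split.
apply: sk_ball gI sk2 (hL) _ _ _.
- move=> q w x qp h t ut z Lz; apply: NNPP => z1.
  have [y [y' [Fy Fy' hz]]] := eqNP Lz.
  have ne : y <> y' by case: hz => [[_ /z1]|[]].
  have [r [rq bt]] := cond_below ut; apply: h; exists r; split=> // -[r' [r'r [h _]]].
  have [t1 ut1] := U_inhabited r'.
  have [t2 [ut2 tt2 _]] := amalgamation (U_binstr ut) (below_ext r'r bt) ut1.
  have b2 := U_binstr ut2; apply: ne.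
  exact: (h t2 ut2 _ _ (name_mono (good_name gle) Fy b2 tt2) (name_mono (good_name g1) Fy' b2 tt2)).
- move=> t w w' x z /LP [b [Fb hb]] le /LP [b' [Fb' hb']].
  rewrite (name_fun nF Fb' Fb) in hb'; case: hb' => [[]//|[nle _]]; case: nle.
  case: hb => [[wb _]|[_ /one_neq0]//]; move: le wb; rewrite !leP => -[c ->] [c' ->].
  by exists (c + c'); rewrite addA.
(* The bound b is the value of F at the parameters alone, so it can be read off with w = 0; the
   guard then fails at b + 1. *)
- move=> q x t qp ut.
  have [t1 [z [ut1 tt1 /LP [b [Fb _]]]]] := good_dense hL qp [tuple of 0 :: x] ut.
  have [t2 [z' [ut2 t12 Lz']]] := good_dense hL qp [tuple of b + 1 :: x] ut1.
  exists t2, (b + 1), z'; split=> //; first by move=> i /tt1 /t12.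
  have [b' [Fb' hb]] := LP _ _ _ _ Lz'.
  rewrite (name_fun nF Fb' (name_mono nF Fb (U_binstr ut2) t12)) in hb.
  case: hb => [[le _]|[_ ->] /esym/one_neq0//].
  by case: (lt_irr (lt_le_trans (le_refl b) le)).
Qed.

(* [T(u; x)] says that [u] codes witnesses for the leading existential quantifiers
   of [phi], and [W(-; u, x)] is then a Skolem function. *)
Record skolemizes_ex p n (phi : form M n) (T : rname M n.+1) (W : rname M n.+2) : Prop := SkolemizesEx {
  ske_T : good p T;
  ske_W : good p W;
  ske_witness : forall q x, extends q p -> forces phi q x ->
    exists r u, extends r q /\ decides r T [tuple of u :: x] 1;
  ske_S : forall q (x : n.-tuple N) u (W' : rname M n.+1), extends q p -> good q W' ->
    (forall t, in_U t q -> forall h z z', W' t [tuple of h :: x] z ->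
       W t [tuple of h :: [tuple of u :: x]] z' -> z = z') ->
    decides q T [tuple of u :: x] 1 -> forces (skolem true phi W') q x }.

Lemma ske_bounded p n (phi : form M n) T WS WH : good_form p phi -> skolemizes p phi T WS WH ->
  skolemizes_ex p phi (selN T (@up1 n)) (selN WS (pcons (@i0 _) (fun i => up1 (up1 i)))).
Proof.
move=> g [hT hS hH tr S H].
have TE q u (x : n.-tuple N) : decides q (selN T (@up1 n)) [tuple of u :: x] 1 <-> decides q T x 1.
  by rewrite /decides /selN (sel_up _ _ id) mktuple_tnth.
split; [exact: good_sel | exact: good_sel | |].
  (* There is no quantifier to witness, so the code of the witnesses is arbitrary. *)
  move=> q x qp h; exists q, 0; split; first exact: extends_refl.
  by apply/TE/(tr _ _ qp).
move=> q x u W' qp hW' a /TE /(tr _ _ qp) h.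
apply: (@skolem_agree _ _ _ _ WS); [exact: good_form_ext g | exact: good_ext hS | by [] | | exact: S].
move=> t ut h' z z' k k'; symmetry; apply: a ut _ _ _ k' _.
by rewrite /selN sel_pcons tnth0 (sel_up _ _ (@up1 _)) (sel_up _ _ id) mktuple_tnth.
Qed.

(** The formula is a negated universal of a negation, so its theta_S is a double negation of phi_S
    with W(0) put for the variable. Thus W(0) has to be the witness, and the tail of W a Skolem
    function for phi at this witness. *)
Lemma ske_ex p n (phi : form M n.+1) T W : good_form p phi -> skolemizes_ex p phi T W ->
  skolemizes_ex p (FEx phi) (curryW T) (exW W).
Proof.
move=> g [hT hW wit S]; have hC := good_curryW hT; have hE := good_exW hW; split=> //.
  move=> q x qp h; have [w hw] : exists w, ~ forces (FNeg phi) q [tuple of w :: x].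
    apply: NNPP => h'; apply: h; exists q; split; first exact: extends_refl.
    by move=> w; apply: NNPP => hw; apply: h'; exists w.
  have {hw} [r [rq hr]] : exists r, extends r q /\ forces phi r [tuple of w :: x] by apply: NNPP.
  have rp : extends r p by exact: extends_trans rq qp.
  have [r' [v [r'r hv]]] := wit _ _ rp hr; exists r', ⟨w, v⟩; split; first exact: extends_trans r'r rq.
  move=> t ut z /curryW_pair.
  exact: hv.
move=> q x u W' qp hW' a hu; have [w pw] := pfst_ex u; have [v pv] := psnd_ex u.
move=> [r [rq h]]; have rp : extends r p by exact: extends_trans rq qp.
have hW'r : good r W' by exact: good_ext hW'.
have [r1 [w' [r1r hw']]] := decide x (good_whead hW'r) (extends_refl r).
have r1p : extends r1 p by exact: extends_trans r1r rp.
have r1q : extends r1 q by exact: extends_trans r1r rq.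
have hW1 : good r1 W' by exact: good_ext hW'.
(* By hypothesis [W'] is compatible with [exW W], whose value at 0 is the first component of u. *)
have ew : w' = w.
  have [t ut] := U_inhabited r1.
  have [t1 [z [ut1 _ hz]]] := good_dense (good_whead hW1) (extends_refl r1) x ut.
  have [t2 [z' [ut2 t12 hz']]] := good_dense hE r1p [tuple of 0 :: [tuple of u :: x]] ut1.
  rewrite -(exW_0 pw hz') -(hw' _ ut1 _ hz).
  apply: (a t2 (U_ext r1q ut2) _ _ _ _ hz').
  exact: (name_mono (good_name hW') (wheadP hz) (U_binstr ut2) t12).
have {}h := forces_mono r1r h.
have g1 : good_form r1 (FNeg phi) := good_form_ext r1p g.
move/(@forces_at_head r1 false n (FNeg phi) W' x w' g1 hW1 hw'): h; rewrite ew => h.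
apply: h; exists r1; split; first exact: extends_refl.
apply: (S r1 _ v) => //; first exact: good_wtail.
  move=> t ut h z z' /wtailP k k'.
  have [t1 [z1 [ut1 tt1 hz1]]] := good_dense hE r1p [tuple of h + 1 :: [tuple of u :: x]] ut.
  have b1 := U_binstr ut1.
  rewrite (name_fun (good_name hW) (name_mono (good_name hW) k' b1 tt1) (exW_S pw pv hz1)).
  exact: (a t1 (U_ext r1q ut1) _ _ _ (name_mono (good_name hW') k b1 tt1) hz1).
move=> t ut z Tz; have [t1 [z1 [ut1 tt1 hz1]]] := good_dense hC r1p [tuple of u :: x] ut.
have b1 := U_binstr ut1.
rewrite (name_fun (good_name hT) (name_mono (good_name hT) Tz b1 tt1) (curryWP pw pv hz1)).
exact: (hu t1 (U_ext r1q ut1)).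
Qed.

Lemma ske_uniform p n (phi : form M n) T W : good_form p phi -> skolemizes_ex p phi T W ->
  (forall x, forces phi p x) ->
  exists W', good p W' /\ forall x, forces (skolem true phi W') p x.
Proof.
move=> g [hT hW wit S] h; pose U := minN T.
have hU : good p U.
  apply: good_minN => // q qp x t ut; have [r [rq bt]] := cond_below ut.
  have rp : extends r p by exact: extends_trans rq qp.
  (* The witness is decided only below an extension of q. Since t is an initial segment of all sets
     of r', amalgamation gives a string that extends t and still belongs to U(q). *)
  have [r' [u [r'r hu]]] := wit r x rp (forces_mono rp (h x)).
  have r'p : extends r' p by exact: extends_trans r'r rp.
  have [t0 ut0] := U_inhabited r'.
  have [t1 [ut1 tt1 _]] := amalgamation (U_binstr ut) (below_ext r'r bt) ut0.
  have [t2 [z [ut2 t12 Tz]]] := good_dense hT r'p [tuple of u :: x] ut1.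
  exists t2, u; split; [by apply: U_ext rq _; apply: U_ext r'r _ | by move=> i /tt1 /t12 |].
  by rewrite -[X in T _ _ X](hu _ ut2 _ Tz).
exists (atW U W); have hA := good_atW hU hW; split=> // x.
apply: forces_densely => [|q qp]; first exact: good_skolem.
have [t ut] := U_inhabited q; have [t1 [u [ut1 _ Uu]]] := good_dense hU qp x ut.
have [r [rq bt]] := cond_below ut1; have rp : extends r p by exact: extends_trans rq qp.
exists r; split=> //; apply: (S r x u _ rp (good_ext rp hA)).
  move=> t' ut' h' z z' /atWP [u' [Uu' k]] k'.
  rewrite (below_decides (good_name hU) bt Uu ut' Uu') in k.
  exact: (name_fun (good_name hW) k k').
by case: Uu => Tu _; apply: below_decides (good_name hT) bt Tu.
Qed.

Lemma Pi0_bounded m n (phi : form M n) : is_Pi m phi -> m = 0%N -> bounded phi.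
Proof. by case. Qed.

Lemma ske_Sigma1 p m n (phi : form M n) : is_Sigma m phi -> m = 1%N -> good_form p phi ->
  exists T W, skolemizes_ex p phi T W.
Proof.
elim=> {m n phi} [//|m n phi hphi [m0] g|m n phi _ IH m1 g].
  have [T [WS [WH sk]]] := sk_bounded (Pi0_bounded hphi m0) g.
  by eexists; eexists; apply: ske_bounded sk.
by have [T [W sk]] := IH m1 g; exists (curryW T), (exW W); apply: ske_ex.
Qed.

(** Forcing a universal formula means forcing all its instances. Quantifying over all x therefore
    lets the leading universal variables become parameters of the Skolem name, and [curryW] moves
    them into its argument again. *)
Lemma Pi2_skolem p m n (phi : form M n) : is_Pi m phi -> m = 2%N -> good_form p phi ->
  (forall x, forces phi p x) ->
  exists W, good p W /\ forall x, forces (skolem true phi W) p x.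
Proof.
elim=> {m n phi} [//|m n phi hphi [m1] g h|m n phi _ IH m2 g h].
  by have [T [W sk]] := ske_Sigma1 hphi m1 g; apply: ske_uniform sk h.
have [|W [hW hf]] := IH m2 g; first by move=> x; case/tupleP: x => w x; apply: h.
exists (curryW W); have hC := good_curryW hW; split=> // x w.
apply: skolem_agree (hf [tuple of w :: x]) => //; first exact: good_wsect.
move=> t ut u z z' k /wsectP /curryW_pair.
exact: (name_fun (good_name hW) k).
Qed.

Lemma all_names_and (P Q R : forall k, rname M k -> Prop) n (phi : form M n) :
  (forall k F, P k F -> Q k F -> R k F) -> all_names P phi -> all_names Q phi -> all_names R phi.
Proof.
move=> PQ; elim: n / phi => [n k F v k' F' v'|n phi IH|n phi IH psi IH'|n phi IH] //=.
- by move=> [? ?] [? ?]; split; apply: PQ.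
- by move=> [? ?] [? ?]; split; [apply: IH | apply: IH'].
Qed.

End Model.

Theorem theorem5 (M : l2struct) (hM : RCA0 M) (p : condition M)
    (theta : form M 0) (htheta : wf_form theta)
    (hlocal : local_form p theta) (hPi2 : is_Pi 2 theta) :
  forces theta p (nil_tuple _) <-> forces_S theta p.
Proof.
have g : good_form p theta.
  by apply: all_names_and htheta hlocal => k F; apply: (local_good hM).
split=> [h|[W [nW lW hf]]].
  have [|W [hW hf]] := Pi2_skolem hM hPi2 erefl g; first by move=> x; rewrite tuple0.
  by exists W; split; [exact: good_name hW | exact: (good_local hM) | exact: hf].
by have [h _] := skolem_sound hM (nil_tuple _) g (local_good hM nW lW); apply: h.
Qed.
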